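(* Let $\mathcal{C}$ be a partial 2-category. Then the completion $\widehat{\mathcal{C}}$ (whose objects are the objects of $\mathcal{C}$, whose 1-morphisms are equivalence classes of sequences of simple 1-morphisms, whose 2-morphisms are equivalence classes of diagrams of simple 2-morphisms, and whose compositions $\circ_h^1,\circ_h^2,\circ_v^2$ are induced by concatenation, all as defined in the context) is well defined and is a strict 2-category. In particular, up to canonical identification, the set $hom^2(\underline{\varphi},\underline{\psi})$ depends only on the classes $[\underline{\varphi}],[\underline{\psi}]\in hom^1(x,y)$.
   Context: Convention: compositions are written left to right; if $\varphi\colon x\to y$ and $\psi\colon y\to z$, the composition is $\varphi\circ\psi\colon x\to z$. PARTIAL 2-PRECATEGORY. A partial two-precategory $\mathcal{C}$ consists of: (1) A class of objects with an involution $x\mapsto x^{op}$. (2) For objects $x,y$ a class $shom^1(x,y)$ of simple 1-morphisms, an involutive adjunction $shom^1(x,y)\to shom^1(y,x)$, $\varphi\mapsto\varphi^T$, and an opposite involution $shom^1(x,y)\to shom^1(x^{op},y^{op})$. (3) For objects $x,y,z$ a subset $comp^1(x,y,z)\subset shom^1(x,y)\times shom^1(y,z)$ of composable pairs and a map $\circ_h^1\colon comp^1(x,y,z)\to shom^1(x,z)$ such that $(\varphi,\psi)\in comp^1(x,y,z)$ implies $(\psi^T,\varphi^T)\in comp^1(z,y,x)$ and $(\varphi\circ_h^1\psi)^T=\psi^T\circ_h^1\varphi^T$. Denote by $\underline{hom}^1(x,y)$ the class of finite (possibly empty if $x=y$) sequences $\underline{\varphi}=(\varphi_1,\dots,\varphi_k)$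 with $\varphi_i\in shom^1(x_{i-1},x_i)$, $x_0=x$, $x_k=y$; put $\underline{\varphi}^T=(\varphi_k^T,\dots,\varphi_1^T)$, let $\underline{\varphi}^{op}$ be the sequence of opposites, and let $\sharp_h^1$ be concatenation of sequences. (4) For $\underline{\varphi},\underline{\psi}\in\underline{hom}^1(x,y)$ a class $shom^2(\underline{\varphi},\underline{\psi})$ of simple 2-morphisms. (5) For $(\varphi,\psi)\in comp^1(x,y,z)$ an identification 2-morphism $I_y(\varphi,\psi)\in shom^2((\varphi,\psi),\varphi\circ_h^1\psi)$. (6) Cyclicity: coherent identifications $shom^2(\underline{\varphi}\sharp_h^1\underline{\chi},\underline{\psi}\sharp_h^1\underline{\rho})\simeq shom^2(\underline{\psi}^T\sharp_h^1\underline{\varphi},\underline{\rho}\sharp_h^1\underline{\chi}^T)$ (coherent: the composition of two such identifications is the identification associated with the resulting reordering), so that $shom^2(\underline{\varphi},\underline{\psi})$ depends only on the cyclic sequence $\underline{\varphi}\sharp_h^1\underline{\psi}^T$. (7) Opposites $shom^2(\underline{\varphi},\underline{\psi})\to shom^2(\underline{\varphi}^{op},\underline{\psi}^{op})$ and involutive adjunctions $shom^2(\underline{\varphi},\underline{\psi})\to shom^2(\underline{\psi},\underline{\varphi})$, $A\mapsto A^T$, the latter commuting with the cyclicity identifications. (8) For $\underline{\varphi},\underline{\chi},\underline{\psi}\in\underline{hom}^1(x,y)$ a subset $comp^2(\underline{\varphi},\underline{\chi},\underline{\psi})\subset shom^2(\underline{\varphi},\underline{\chi})\times shom^2(\underline{\chi},\underline{\psi})$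 of composable pairs and a vertical composition $\circ_v^2\colon comp^2(\underline{\varphi},\underline{\chi},\underline{\psi})\to shom^2(\underline{\varphi},\underline{\psi})$ such that $(A,B)$ composable implies $(B^T,A^T)$ composable and $(A\circ_v^2B)^T=B^T\circ_v^2A^T$. Moreover each $I_y(\varphi,\psi)$ can be vertically composed on the right and on the left with any adjacent 2-morphism. DIAGRAMS. $\underline{hom}^2(\underline{\varphi},\underline{\psi})$ is the set of planar, simply connected, polygonal diagrams of simple 2-morphisms from $\underline{\varphi}$ to $\underline{\psi}$: vertices are objects, edges are simple 1-morphisms, faces are simple 2-morphisms. If $\underline\varphi=\underline\psi$, the diagram with no face consisting only of $\underline{\varphi}$ is allowed (called an empty diagram). Vertical concatenation $\sharp_v^2\colon\underline{hom}^2(\underline{\varphi},\underline{\psi})\times\underline{hom}^2(\underline{\psi},\underline{\chi})\to\underline{hom}^2(\underline{\varphi},\underline{\chi})$ glues along $\underline{\psi}$. Horizontal concatenation $\sharp_h^2\colon\underline{hom}^2(\underline{\varphi},\underline{\psi})\times\underline{hom}^2(\underline{\varphi}',\underline{\psi}')\to\underline{hom}^2(\underline{\varphi}\sharp_h^1\underline{\varphi}',\underline{\psi}\sharp_h^1\underline{\psi}')$ glues along the common object $y$ that is the target of $\underline{\varphi},\underline{\psi}$ and the source of $\underline{\varphi}',\underline{\psi}'$. COMPOSITION/DECOMPOSITION. $\underline{\varphi}'$ is a composition of $\underline{\varphi}$ (and $\underline{\varphi}$ a decomposition of $\underline{\varphi}'$) if for some $i$ the pair $(\varphi_i,\varphi_{i+1})$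 is composable and $\underline{\varphi}'=(\dots,\varphi_{i-1},\varphi_i\circ_h^1\varphi_{i+1},\varphi_{i+2},\dots)$. PARTIAL 2-CATEGORY. A partial 2-precategory satisfying the Diagram axiom: let $\underline{\varphi}_0,\dots,\underline{\varphi}_k=\underline{\varphi}_0$ in $\underline{hom}^1(x,y)$ be such that each $\underline{\varphi}_{i+1}$ is a composition or a decomposition of $\underline{\varphi}_i$, and let $\mathcal{D}\in\underline{hom}^2(\underline{\varphi}_0,\underline{\varphi}_k)$ be the diagram obtained by patching together the corresponding identification 2-morphisms (for compositions) or their adjoints (for decompositions). Then for any $\underline{\psi}$ and any $L\in shom^2(\underline{\psi},\underline{\varphi}_0)$, the result $L\circ_v^2\mathcal{D}$ of composing $L$ successively (using cyclicity) with all these 2-morphisms equals $L$; and similarly $\mathcal{D}\circ_v^2L=L$ for all $L\in shom^2(\underline{\varphi}_0,\underline{\psi})$. COMPLETION $\widehat{\mathcal{C}}$. Objects: those of $\mathcal{C}$. 1-morphisms: $hom^1(x,y)$ is the quotient of $\underline{hom}^1(x,y)$ by the equivalence relation generated by identifying $\underline{\varphi}$ with $\underline{\varphi}'$ whenever $\underline{\varphi}'$ is a composition of $\underline{\varphi}$; moreover a $\varphi\in shom^1(x,x)$ that is an identity for $x$ (it can be composed left and right with any adjacent simple 1-morphism $\psi$, with $\varphi\circ_h^1\psi=\psi$, resp. $\psi\circ_h^1\varphi=\psi$) is identified with the empty sequence. 2-morphisms: $hom^2(\underline{\varphi},\underline{\psi})$ is the quotient of $\underline{hom}^2(\underline{\varphi},\underline{\psi})$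 by the relation generated by: if two faces $A,B$ of a diagram have connected intersection $\underline{\chi}$, so that by cyclicity $A\in shom^2(\underline{\alpha},\underline{\chi})$, $B\in shom^2(\underline{\chi},\underline{\beta})$, and if $A,B$ are composable, then the diagram is identified with the one obtained by removing $\underline{\chi}$ and merging the two faces into the single face $A\circ_v^2B$; also empty diagrams are identified with identities for $\circ_v^2$. If $\underline{\varphi},\underline{\varphi}'$ represent the same 1-morphism, a sequence of compositions and decompositions joining $\underline{\varphi}$ to $\underline{\varphi}'$ gives a diagram $\mathcal{D}$ of identification 2-morphisms and their adjoints, and vertical concatenation with this diagram (suitably oriented) gives a map $hom^2(\underline{\varphi},\underline{\psi})\to hom^2(\underline{\varphi}',\underline{\psi})$; similarly for $\underline{\psi}$. These maps are the canonical identifications (they are bijective and independent of the joining sequence), and $hom^2([\underline{\varphi}],[\underline{\psi}])$ is the resulting set. Identities: the class of the empty sequence for an object $x$; the class of the empty diagram consisting only of $\underline{\varphi}$ for a 1-morphism $[\underline{\varphi}]$. Compositions: $\circ_h^1,\circ_h^2,\circ_v^2$ are induced by $\sharp_h^1,\sharp_h^2,\sharp_v^2$.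
   Formalization: Dependence of hom^2 on classes only omits empty sequences of objects having an identity, which are matched by inserting that identity; identities for vertical composition are taken up to merging of faces; faces have at least one edge; identification 2-morphisms compose along any nonempty side. *)

(* Defs.v *)
From Stdlib Require Import Relations.
From Corelib Require Import ssreflect ssrfun.

Set Implicit Arguments.
Unset Strict Implicit.
Unset Printing Implicit Defensive.

(** * Sequences of composable arrows *)

Inductive path (O : Type) (E : O -> O -> Type) : O -> O -> Type :=
| pnil x : path E x x
| pcons x y z : E x y -> path E y z -> path E x z.

Arguments pnil {O E} x.
Arguments pcons {O E x y z} _ _.

Fixpoint papp {O} {E : O -> O -> Type} {x y z} (p : path E x y) :
    path E y z -> path E x z :=
  match p in path _ x y return path E y z -> path E x z with
  | pnil _ => fun q => q
  | pcons e p' => fun q => pcons e (papp p' q)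
  end.

Notation "p ## q" := (papp p q) (at level 48, right associativity).

Definition pone {O} {E : O -> O -> Type} {x y} (e : E x y) : path E x y :=
  pcons e (pnil y).

Definition ptwo {O} {E : O -> O -> Type} {x y z} (e : E x y) (f : E y z) :
    path E x z :=
  pcons e (pone f).

Definition nonempty {O} {E : O -> O -> Type} {x y} (p : path E x y) : Prop :=
  match p with pnil _ => False | pcons _ _ => True end.

(* [(e_1, ..., e_k)] becomes [(T e_k, ..., T e_1)]. *)
Fixpoint prev {O} {E : O -> O -> Type} (T : forall x y, E x y -> E y x)
    {x y} (p : path E x y) : path E y x :=
  match p in path _ x y return path E y x with
  | pnil x => pnil x
  | pcons e p' => prev T p' ## pone (T _ _ e)
  end.

Fixpoint pmap {O O'} {E : O -> O -> Type} {E' : O' -> O' -> Type}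
    (o : O -> O') (f : forall x y, E x y -> E' (o x) (o y))
    {x y} (p : path E x y) : path E' (o x) (o y) :=
  match p in path _ x y return path E' (o x) (o y) with
  | pnil x => pnil (o x)
  | pcons e p' => pcons (f _ _ e) (pmap f p')
  end.

Lemma papp_nil {O} {E : O -> O -> Type} {x y} (p : path E x y) :
  p ## pnil y = p.
Proof. by elim: p => //= {}x {}y z e p ->. Qed.

Lemma papp_assoc {O} {E : O -> O -> Type} {x y z t}
    (p : path E x y) (q : path E y z) (r : path E z t) :
  (p ## q) ## r = p ## q ## r.
Proof. by elim: p q => //= {}x {}y w e p IH q; rewrite IH. Qed.

Definition transport {O} {H : O -> O -> Type} {x x' y y'}
    (ex : x = x') (ey : y = y') (h : H x y) : H x' y' :=
  match ex in _ = x', ey in _ = y' return H x' y' with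
  | eq_refl, eq_refl => h
  end.

(** * Partial 2-precategories *)

Record partial_2precategory := Partial2Precategory {
  ob : Type;
  op0 : ob -> ob;
  op0K : forall x, op0 (op0 x) = x;

  shom1 : ob -> ob -> Type;
  tr1 : forall x y, shom1 x y -> shom1 y x;
  tr1K : forall x y (a : shom1 x y), tr1 (tr1 a) = a;
  op1 : forall x y, shom1 x y -> shom1 (op0 x) (op0 y);
  op1K : forall x y (a : shom1 x y),
    transport (op0K x) (op0K y) (op1 (op1 a)) = a;

  scomp1 : forall x y z, shom1 x y -> shom1 y z -> Prop;
  sh1 : forall x y z (a : shom1 x y) (b : shom1 y z),
    scomp1 a b -> shom1 x z;
  scomp1_tr : forall x y z (a : shom1 x y) (b : shom1 y z),
    scomp1 a b -> scomp1 (tr1 b) (tr1 a);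
  sh1_tr : forall x y z (a : shom1 x y) (b : shom1 y z)
      (h : scomp1 a b) (h' : scomp1 (tr1 b) (tr1 a)),
    tr1 (sh1 h) = sh1 h';

  shom2 : forall x y, path shom1 x y -> path shom1 x y -> Type;
  ident : forall x y z (a : shom1 x y) (b : shom1 y z) (h : scomp1 a b),
    shom2 (ptwo a b) (pone (sh1 h));

  (* Cyclicity: if the boundary [p ## q^T] is cut as [u ## v], moving [v] in
     front of [u] gives an identification with every [shom2 p' q'] whose
     boundary [p' ## q'^T] is [v ## u].  The identification of
     [shom2 (p ## c) (q ## r)] with [shom2 (q^T ## p) (r ## c^T)] is the case
     [u = p ## c ## r^T], [v = q^T]. *)
  cyc : forall x y x' y' (p q : path shom1 x y) (p' q' : path shom1 x' y')
      (u : path shom1 x x') (v : path shom1 x' x),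
    p ## prev tr1 q = u ## v -> p' ## prev tr1 q' = v ## u ->
    shom2 p q -> shom2 p' q';
  cyc_id : forall x y (p q : path shom1 x y)
      (e : p ## prev tr1 q = pnil x ## (p ## prev tr1 q))
      (e' : p ## prev tr1 q = (p ## prev tr1 q) ## pnil x) (A : shom2 p q),
    cyc e e' A = A;
  cyc_turn : forall x y y' (p q : path shom1 x y) (p' q' : path shom1 x y')
      (w : path shom1 x x)
      (e1 : p ## prev tr1 q = w ## pnil x)
      (e1' : p' ## prev tr1 q' = pnil x ## w)
      (e2 : p ## prev tr1 q = pnil x ## w)
      (e2' : p' ## prev tr1 q' = w ## pnil x) (A : shom2 p q),
    cyc e1 e1' A = cyc e2 e2' A;
  cyc_comp : forall x y x' y' x'' y'' (p q : path shom1 x y)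
      (p' q' : path shom1 x' y') (p'' q'' : path shom1 x'' y'')
      (u : path shom1 x x') (u' : path shom1 x' x'') (w : path shom1 x'' x)
      (e1 : p ## prev tr1 q = u ## (u' ## w))
      (e1' : p' ## prev tr1 q' = (u' ## w) ## u)
      (e2 : p' ## prev tr1 q' = u' ## (w ## u))
      (e2' : p'' ## prev tr1 q'' = (w ## u) ## u')
      (e3 : p ## prev tr1 q = (u ## u') ## w)
      (e3' : p'' ## prev tr1 q'' = w ## (u ## u')) (A : shom2 p q),
    cyc e2 e2' (cyc e1 e1' A) = cyc e3 e3' A;

  op2 : forall x y (p q : path shom1 x y),
    shom2 p q -> shom2 (pmap op1 p) (pmap op1 q);
  tr2 : forall x y (p q : path shom1 x y), shom2 p q -> shom2 q p;
  tr2K : forall x y (p q : path shom1 x y) (A : shom2 p q), tr2 (tr2 A) = A;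
  tr2_cyc : forall x y x' y' (p q : path shom1 x y) (p' q' : path shom1 x' y')
      (u : path shom1 x x') (v : path shom1 x' x)
      (e : p ## prev tr1 q = u ## v) (e' : p' ## prev tr1 q' = v ## u)
      (f : q ## prev tr1 p = prev tr1 v ## prev tr1 u)
      (f' : q' ## prev tr1 p' = prev tr1 u ## prev tr1 v) (A : shom2 p q),
    tr2 (cyc e e' A) = cyc f f' (tr2 A);

  scomp2 : forall x y (p c q : path shom1 x y),
    shom2 p c -> shom2 c q -> Prop;
  sv2 : forall x y (p c q : path shom1 x y) (A : shom2 p c) (B : shom2 c q),
    scomp2 A B -> shom2 p q;
  scomp2_tr : forall x y (p c q : path shom1 x y)
      (A : shom2 p c) (B : shom2 c q),
    scomp2 A B -> scomp2 (tr2 B) (tr2 A);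
  sv2_tr : forall x y (p c q : path shom1 x y) (A : shom2 p c) (B : shom2 c q)
      (h : scomp2 A B) (h' : scomp2 (tr2 B) (tr2 A)),
    tr2 (sv2 h) = sv2 h';

  (* Adjacency is understood up to cyclicity: identification 2-morphisms
     compose with every 2-morphism along any nonempty part [c] of their
     boundary. *)
  ident_scomp2r : forall x y z (a : shom1 x y) (b : shom1 y z)
      (h : scomp1 a b) x' y' (p c q : path shom1 x' y')
      (u : path shom1 x x') (v : path shom1 x' x)
      (e : ptwo a b ## prev tr1 (pone (sh1 h)) = u ## v)
      (e' : c ## prev tr1 q = v ## u) (A : shom2 p c),
    nonempty c -> scomp2 A (cyc e e' (ident h));
  ident_scomp2l : forall x y z (a : shom1 x y) (b : shom1 y z)
      (h : scomp1 a b) x' y' (p c q : path shom1 x' y')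
      (u : path shom1 x x') (v : path shom1 x' x)
      (e : ptwo a b ## prev tr1 (pone (sh1 h)) = u ## v)
      (e' : p ## prev tr1 c = v ## u) (B : shom2 c q),
    nonempty c -> scomp2 (cyc e e' (ident h)) B
}.

Arguments shom1 {C} : rename.
Arguments shom2 {C x y} : rename.
Arguments tr1 {C} [x y] _ : rename.
Arguments tr2 {C x y p q} _ : rename.
Arguments scomp1 {C x y z} _ _ : rename.
Arguments sh1 {C x y z a b} _ : rename.
Arguments ident {C x y z a b} _ : rename.
Arguments scomp2 {C x y p c q} _ _ : rename.
Arguments sv2 {C x y p c q A B} _ : rename.
Arguments cyc {C x y x' y' p q p' q' u v} _ _ _ : rename.

Notation seq1 C := (path (@shom1 C)).
Notation "p ^T" := (prev (@tr1 _) p) (at level 1, format "p ^T").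

(* [A'] is [A] read after moving [v] in front of [u] on the boundary. *)
Definition cyclic {C : partial_2precategory} {x y x' y' : ob C}
    {p q : seq1 C x y} {p' q' : seq1 C x' y'}
    (u : seq1 C x x') (v : seq1 C x' x)
    (A : shom2 p q) (A' : shom2 p' q') : Prop :=
  exists (e : p ## q^T = u ## v) (e' : p' ## q'^T = v ## u), cyc e e' A = A'.

(** * Diagrams

  A planar simply connected polygonal diagram from [p] to [q] is described by
  sweeping it out from [p] to [q], one face at a time: a layer replaces a
  subsequence [a] of the current sequence by [b] across a face [A : shom2 a b].
  Sweeps of one and the same diagram differ by exchanges of consecutive faces
  (relation [exchange] below).  Faces are polygons, so their boundary has at
  least one edge. *)

Definition polygon {C : partial_2precategory} {x y : ob C}
    (a b : seq1 C x y) : Prop :=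
  nonempty a \/ nonempty b.

Inductive layer {C : partial_2precategory} {x y : ob C}
    (p q : seq1 C x y) : Type :=
| Layer x' y' (l : seq1 C x x') (a b : seq1 C x' y') (A : shom2 a b)
    (r : seq1 C y' y) of polygon a b & p = l ## a ## r & q = l ## b ## r.

Arguments Layer {C x y p q x' y'} l {a b} A r _ _ _.

Inductive diag {C : partial_2precategory} {x y : ob C} :
    seq1 C x y -> seq1 C x y -> Type :=
| dempty p : diag p p
| dcons p q r : layer p q -> diag q r -> diag p r.

Arguments dempty {C x y} p.
Arguments dcons {C x y p q r} _ _.

Definition face {C : partial_2precategory} {x y : ob C} {a b : seq1 C x y}
    (A : shom2 a b) (h : polygon a b) : diag a b :=
  dcons (Layer (pnil x) A (pnil y) h
           (eq_sym (papp_nil a)) (eq_sym (papp_nil b)))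
        (dempty b).

Fixpoint vcat {C : partial_2precategory} {x y : ob C} {p q r : seq1 C x y}
    (D : diag p q) : diag q r -> diag p r :=
  match D in diag p q return diag q r -> diag p r with
  | dempty _ => fun E => E
  | dcons l D' => fun E => dcons l (vcat D' E)
  end.

Lemma layer_eql {C : partial_2precategory} {x y z x' y' : ob C}
    {p : seq1 C x y} {l : seq1 C x x'} {a : seq1 C x' y'} {r : seq1 C y' y}
    (s : seq1 C z x) :
  p = l ## a ## r -> s ## p = (s ## l) ## a ## r.
Proof. by move=> ->; rewrite papp_assoc. Qed.

Lemma layer_eqr {C : partial_2precategory} {x y z x' y' : ob C}
    {p : seq1 C x y} {l : seq1 C x x'} {a : seq1 C x' y'} {r : seq1 C y' y}
    (s : seq1 C y z) :
  p = l ## a ## r -> p ## s = l ## a ## r ## s.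
Proof. by move=> ->; rewrite !papp_assoc. Qed.

Definition layerl {C : partial_2precategory} {x y z : ob C}
    (s : seq1 C z x) {p q : seq1 C x y} (L : layer p q) :
    layer (s ## p) (s ## q) :=
  match L with
  | Layer l A r h e e' =>
      Layer (s ## l) A r h (layer_eql s e) (layer_eql s e')
  end.

Definition layerr {C : partial_2precategory} {x y z : ob C}
    {p q : seq1 C x y} (L : layer p q) (s : seq1 C y z) :
    layer (p ## s) (q ## s) :=
  match L with
  | Layer l A r h e e' =>
      Layer l A (r ## s) h (layer_eqr s e) (layer_eqr s e')
  end.

Fixpoint whiskerl {C : partial_2precategory} {x y z : ob C}
    (s : seq1 C z x) {p q : seq1 C x y} (D : diag p q) :
    diag (s ## p) (s ## q) :=
  match D in diag p q return diag (s ## p) (s ## q) with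
  | dempty p => dempty (s ## p)
  | dcons L D' => dcons (layerl s L) (whiskerl s D')
  end.

Fixpoint whiskerr {C : partial_2precategory} {x y z : ob C}
    {p q : seq1 C x y} (D : diag p q) (s : seq1 C y z) :
    diag (p ## s) (q ## s) :=
  match D in diag p q return diag (p ## s) (q ## s) with
  | dempty p => dempty (p ## s)
  | dcons L D' => dcons (layerr L s) (whiskerr D' s)
  end.

(* Gluing at the common object, swept from left to right. *)
Definition hcat {C : partial_2precategory} {x y z : ob C}
    {p q : seq1 C x y} {p' q' : seq1 C y z}
    (D : diag p q) (D' : diag p' q') : diag (p ## p') (q ## q') :=
  vcat (whiskerr D p') (whiskerl q D').

(** * Compositions, decompositions and the Diagram axiom *)

Inductive composition {C : partial_2precategory} {x y : ob C}
    (p p' : seq1 C x y) : Type :=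
| Composition x' m y' (l : seq1 C x x') (a : shom1 x' m) (b : shom1 m y')
    (h : scomp1 a b) (r : seq1 C y' y)
    of p = l ## ptwo a b ## r & p' = l ## pone (sh1 h) ## r.

Arguments Composition {C x y p p' x' m y'} l {a b} h r _ _.

Inductive idstep {C : partial_2precategory} {x y : ob C}
    (p p' : seq1 C x y) : Type :=
| Compose of composition p p'
| Decompose of composition p' p.

Inductive idseq {C : partial_2precategory} {x y : ob C} :
    seq1 C x y -> seq1 C x y -> Type :=
| inil p : idseq p p
| icons p p' p'' : idstep p p' -> idseq p' p'' -> idseq p p''.

Definition idlayer {C : partial_2precategory} {x y : ob C}
    {p p' : seq1 C x y} (s : idstep p p') : layer p p' :=
  match s with
  | Compose (Composition l h r e e') =>
      Layer l (ident h) r (or_introl I) e e'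
  | Decompose (Composition l h r e e') =>
      Layer l (tr2 (ident h)) r (or_introl I) e' e
  end.

Fixpoint iddiag {C : partial_2precategory} {x y : ob C}
    {p p' : seq1 C x y} (S : idseq p p') : diag p p' :=
  match S in idseq p p' return diag p p' with
  | inil p => dempty p
  | icons s S' => dcons (idlayer s) (iddiag S')
  end.

(* [M'] is the vertical composition, after cyclic reordering, of
   [M : shom2 s p] with the face of the layer [L]. *)
Definition vcomp_layer {C : partial_2precategory} {x y : ob C}
    {s p q : seq1 C x y} (M : shom2 s p) (L : layer p q) (M' : shom2 s q) :
    Prop :=
  match L with
  | @Layer _ _ _ _ _ x' y' l a b A r _ _ _ =>
      exists (N : shom2 (l^T ## s ## r^T) a) (h : scomp2 N A),
        cyclic (s ## r^T ## a^T) (l^T) M N /\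
        cyclic (l^T) (s ## r^T ## b^T) (sv2 h) M'
  end.

Definition layer_vcomp {C : partial_2precategory} {x y : ob C}
    {p q s : seq1 C x y} (L : layer p q) (M : shom2 q s) (M' : shom2 p s) :
    Prop :=
  match L with
  | @Layer _ _ _ _ _ x' y' l a b A r _ _ _ =>
      exists (N : shom2 b (l^T ## s ## r^T)) (h : scomp2 A N),
        cyclic l (b ## r ## s^T) M N /\
        cyclic (a ## r ## s^T) l (sv2 h) M'
  end.

Inductive vcomp_diag {C : partial_2precategory} {x y : ob C} {s : seq1 C x y} :
    forall p q : seq1 C x y, shom2 s p -> diag p q -> shom2 s q -> Prop :=
| vcomp_nil p (M : shom2 s p) : vcomp_diag M (dempty p) M
| vcomp_cons p q r (L : layer p q) (D : diag q r)
    (M : shom2 s p) (M' : shom2 s q) (M'' : shom2 s r) :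
    vcomp_layer M L M' -> vcomp_diag M' D M'' ->
    vcomp_diag M (dcons L D) M''.

Inductive diag_vcomp {C : partial_2precategory} {x y : ob C} {s : seq1 C x y} :
    forall p q : seq1 C x y, diag p q -> shom2 q s -> shom2 p s -> Prop :=
| nil_vcomp p (M : shom2 p s) : diag_vcomp (dempty p) M M
| cons_vcomp p q r (L : layer p q) (D : diag q r)
    (M : shom2 r s) (M' : shom2 q s) (M'' : shom2 p s) :
    diag_vcomp D M M' -> layer_vcomp L M' M'' ->
    diag_vcomp (dcons L D) M M''.

Record partial_2category := Partial2Category {
  precat :> partial_2precategory;
  diagram_axiomr : forall (x y : ob precat) (p : seq1 precat x y)
      (S : idseq p p) (s : seq1 precat x y) (M : shom2 s p),
    vcomp_diag M (iddiag S) M;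
  diagram_axioml : forall (x y : ob precat) (p : seq1 precat x y)
      (S : idseq p p) (s : seq1 precat x y) (M : shom2 p s),
    diag_vcomp (iddiag S) M M
}.

(** * Quotients *)

Definition quot (T : Type) (R : T -> T -> Prop) : Type :=
  {P : T -> Prop | exists t, P = R t}.

Definition cls {T : Type} (R : T -> T -> Prop) (t : T) : quot R :=
  exist _ (R t) (ex_intro _ t eq_refl).

(** * 1-morphisms of the completion *)

Definition is_identity1 {C : partial_2precategory} {x : ob C}
    (e : shom1 x x) : Prop :=
  (forall y (a : shom1 x y), exists h : scomp1 e a, sh1 h = a) /\
  (forall y (a : shom1 y x), exists h : scomp1 a e, sh1 h = a).

Inductive step1 {C : partial_2precategory} {x y : ob C} :
    seq1 C x y -> seq1 C x y -> Prop :=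
| step1_comp p p' : composition p p' -> step1 p p'
| step1_id z (l : seq1 C x z) (e : shom1 z z) (r : seq1 C z y) :
    is_identity1 e -> step1 (l ## pone e ## r) (l ## r).

Definition hom1 (C : partial_2precategory) (x y : ob C) : Type :=
  quot (clos_refl_sym_trans (seq1 C x y) step1).

Definition cls1 {C : partial_2precategory} {x y : ob C} (p : seq1 C x y) :
    hom1 x y :=
  cls (clos_refl_sym_trans (seq1 C x y) step1) p.

(** * Identifications of diagrams *)

(* Consecutive faces either meet the current sequence along disjoint
   subsequences, or share the part [c] of their boundaries; in the second case
   sweeping them in the other order changes the way their boundaries are cut. *)
Inductive exchange {C : partial_2precategory} {x y : ob C} :
    forall p q q' r : seq1 C x y,
    layer p q -> layer q r -> layer p q' -> layer q' r -> Prop :=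
| exchange_far (p q q' r : seq1 C x y) x1 y1 x2 y2
    (k : seq1 C x x1) (b b' : seq1 C x1 y1) (m : seq1 C y1 x2)
    (a a' : seq1 C x2 y2) (t : seq1 C y2 y)
    (B : shom2 b b') (A : shom2 a a') hB hB' hA hA'
    (e1 : p = k ## b ## m ## a ## t) (e2 : q = k ## b' ## m ## a ## t)
    (e3 : q = (k ## b' ## m) ## a ## t) (e4 : r = (k ## b' ## m) ## a' ## t)
    (f1 : p = (k ## b ## m) ## a ## t) (f2 : q' = (k ## b ## m) ## a' ## t)
    (f3 : q' = k ## b ## m ## a' ## t) (f4 : r = k ## b' ## m ## a' ## t) :
    exchange (Layer k B (m ## a ## t) hB e1 e2)
             (Layer (k ## b' ## m) A t hA e3 e4)
             (Layer (k ## b ## m) A t hA' f1 f2)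
             (Layer k B (m ## a' ## t) hB' f3 f4)
| exchange_adjacent (p q q' r : seq1 C x y) x1 z w y2
    (k : seq1 C x x1) (b : seq1 C x1 z) (b' : seq1 C x1 w) (c : seq1 C w z)
    (a : seq1 C z y2) (a' : seq1 C w y2) (t : seq1 C y2 y)
    (B : shom2 b (b' ## c)) (A : shom2 (c ## a) a')
    (B' : shom2 (b ## c^T) b') (A' : shom2 a (c^T ## a')) hB hB' hA hA'
    (e1 : p = k ## b ## a ## t) (e2 : q = k ## (b' ## c) ## a ## t)
    (e3 : q = (k ## b') ## (c ## a) ## t) (e4 : r = (k ## b') ## a' ## t)
    (f1 : p = (k ## b) ## a ## t) (f2 : q' = (k ## b) ## (c^T ## a') ## t)
    (f3 : q' = k ## (b ## c^T) ## a' ## t) (f4 : r = k ## b' ## a' ## t) :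
    cyclic (pnil x1) (b ## c^T ## b'^T) B B' ->
    cyclic c (a ## a'^T) A A' ->
    exchange (Layer k B (a ## t) hB e1 e2)
             (Layer (k ## b') A t hA e3 e4)
             (Layer (k ## b) A' t hA' f1 f2)
             (Layer k B' (a' ## t) hB' f3 f4).

(* [M] is [A] composed with [B] along [c].  The two faces play symmetric roles,
   so the composable pair may also be ([B], [A]), with [c] read backwards. *)
Definition glue {C : partial_2precategory} {x y : ob C} {p c q : seq1 C x y}
    (A : shom2 p c) (B : shom2 c q) (M : shom2 p q) : Prop :=
  (exists h : scomp2 A B, sv2 h = M) \/
  (exists (B' : shom2 (q^T) (c^T)) (A' : shom2 (c^T) (p^T)) (h : scomp2 B' A'),
     cyclic c (q^T) B B' /\ cyclic p (c^T) A A' /\ cyclic (q^T) p (sv2 h) M).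

(* Consecutive faces [A], [B] whose intersection is the sequence [c] are merged
   into a single face.  On either side of [c], at most one of the two faces has
   further edges on the intermediate sequence, whence four cases. *)
Inductive merge {C : partial_2precategory} {x y : ob C} :
    forall p q r : seq1 C x y, layer p q -> layer q r -> layer p r -> Prop :=
| merge_lower (p q r : seq1 C x y) x1 y1 x2 y2
    (k : seq1 C x x1) (l : seq1 C x1 x2) (c b : seq1 C x2 y2)
    (s : seq1 C y2 y1) (a : seq1 C x1 y1) (t : seq1 C y1 y)
    (A : shom2 a (l ## c ## s)) (B : shom2 c b) (M : shom2 a (l ## b ## s))
    (A' : shom2 (l^T ## a ## s^T) c) (M' : shom2 (l^T ## a ## s^T) b) hA hB hM
    (e1 : p = k ## a ## t) (e2 : q = k ## (l ## c ## s) ## t)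
    (e3 : q = (k ## l) ## c ## s ## t) (e4 : r = (k ## l) ## b ## s ## t)
    (f1 : p = k ## a ## t) (f2 : r = k ## (l ## b ## s) ## t) :
    cyclic (a ## s^T ## c^T) (l^T) A A' -> glue A' B M' ->
    cyclic (l^T) (a ## s^T ## b^T) M' M ->
    merge (Layer k A t hA e1 e2) (Layer (k ## l) B (s ## t) hB e3 e4)
          (Layer k M t hM f1 f2)
| merge_upper (p q r : seq1 C x y) x1 y1 x2 y2
    (k : seq1 C x x1) (l : seq1 C x1 x2) (a c : seq1 C x2 y2)
    (s : seq1 C y2 y1) (b : seq1 C x1 y1) (t : seq1 C y1 y)
    (A : shom2 a c) (B : shom2 (l ## c ## s) b) (M : shom2 (l ## a ## s) b)
    (B' : shom2 c (l^T ## b ## s^T)) (M' : shom2 a (l^T ## b ## s^T)) hA hB hM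
    (e1 : p = (k ## l) ## a ## s ## t) (e2 : q = (k ## l) ## c ## s ## t)
    (e3 : q = k ## (l ## c ## s) ## t) (e4 : r = k ## b ## t)
    (f1 : p = k ## (l ## a ## s) ## t) (f2 : r = k ## b ## t) :
    cyclic l (c ## s ## b^T) B B' -> glue A B' M' ->
    cyclic (a ## s ## b^T) l M' M ->
    merge (Layer (k ## l) A (s ## t) hA e1 e2) (Layer k B t hB e3 e4)
          (Layer k M t hM f1 f2)
| merge_left (p q r : seq1 C x y) x1 x2 y2 y1
    (k : seq1 C x x1) (l : seq1 C x1 x2) (c : seq1 C x2 y2)
    (s : seq1 C y2 y1) (a : seq1 C x1 y2) (b : seq1 C x2 y1) (t : seq1 C y1 y)
    (A : shom2 a (l ## c)) (B : shom2 (c ## s) b) (M : shom2 (a ## s) (l ## b))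
    (A' : shom2 (l^T ## a) c) (B' : shom2 c (b ## s^T))
    (M' : shom2 (l^T ## a) (b ## s^T)) hA hB hM
    (e1 : p = k ## a ## s ## t) (e2 : q = k ## (l ## c) ## s ## t)
    (e3 : q = (k ## l) ## (c ## s) ## t) (e4 : r = (k ## l) ## b ## t)
    (f1 : p = k ## (a ## s) ## t) (f2 : r = k ## (l ## b) ## t) :
    cyclic (a ## c^T) (l^T) A A' -> cyclic (pnil x2) (c ## s ## b^T) B B' ->
    glue A' B' M' -> cyclic (l^T) (a ## s ## b^T) M' M ->
    merge (Layer k A (s ## t) hA e1 e2) (Layer (k ## l) B t hB e3 e4)
          (Layer k M t hM f1 f2)
| merge_right (p q r : seq1 C x y) x1 x2 y2 y1
    (k : seq1 C x x1) (l : seq1 C x1 x2) (c : seq1 C x2 y2)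
    (s : seq1 C y2 y1) (a : seq1 C x2 y1) (b : seq1 C x1 y2) (t : seq1 C y1 y)
    (A : shom2 a (c ## s)) (B : shom2 (l ## c) b) (M : shom2 (l ## a) (b ## s))
    (A' : shom2 (a ## s^T) c) (B' : shom2 c (l^T ## b))
    (M' : shom2 (a ## s^T) (l^T ## b)) hA hB hM
    (e1 : p = (k ## l) ## a ## t) (e2 : q = (k ## l) ## (c ## s) ## t)
    (e3 : q = k ## (l ## c) ## s ## t) (e4 : r = k ## b ## s ## t)
    (f1 : p = k ## (l ## a) ## t) (f2 : r = k ## (b ## s) ## t) :
    cyclic (pnil x2) (a ## s^T ## c^T) A A' -> cyclic l (c ## b^T) B B' ->
    glue A' B' M' -> cyclic (a ## s^T ## b^T) l M' M ->
    merge (Layer (k ## l) A t hA e1 e2) (Layer k B (s ## t) hB e3 e4)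
          (Layer k M t hM f1 f2).

Definition diag_rel (C : partial_2precategory) : Type :=
  forall (x y : ob C) (p q : seq1 C x y), diag p q -> diag p q -> Prop.

Inductive diag_closure {C : partial_2precategory} (R : diag_rel C) :
    diag_rel C :=
| closure_step x y (p q : seq1 C x y) (D D' : diag p q) :
    R x y p q D D' -> diag_closure R D D'
| closure_refl x y (p q : seq1 C x y) (D : diag p q) : diag_closure R D D
| closure_sym x y (p q : seq1 C x y) (D D' : diag p q) :
    diag_closure R D D' -> diag_closure R D' D
| closure_trans x y (p q : seq1 C x y) (D D' D'' : diag p q) :
    diag_closure R D D' -> diag_closure R D' D'' -> diag_closure R D D''
| closure_cons x y (p q r : seq1 C x y) (L : layer p q) (D D' : diag q r) :
    diag_closure R D D' -> diag_closure R (dcons L D) (dcons L D').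

Inductive merge_step {C : partial_2precategory} : diag_rel C :=
| step_exchange x y (p q q' r s : seq1 C x y) (L : layer p q)
    (L' : layer q r) (K : layer p q') (K' : layer q' r) (D : diag r s) :
    exchange L L' K K' ->
    merge_step (dcons L (dcons L' D)) (dcons K (dcons K' D))
| step_merge x y (p q r s : seq1 C x y) (L : layer p q) (L' : layer q r)
    (K : layer p r) (D : diag r s) :
    merge L L' K -> merge_step (dcons L (dcons L' D)) (dcons K D).

(* [M] is an identity for the vertical composition.  Composites are taken up to
   merging of faces: as in the Diagram axiom, the composition may have to be
   carried out through successive simple 2-morphisms. *)
Definition is_identity2 {C : partial_2precategory} {x y : ob C}
    {a : seq1 C x y} (M : shom2 a a) : Prop :=
  (forall (b : seq1 C x y) (L : shom2 a b) hM hL,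
     diag_closure (@merge_step C) (vcat (face M hM) (face L hL)) (face L hL)) /\
  (forall (b : seq1 C x y) (L : shom2 b a) hM hL,
     diag_closure (@merge_step C) (vcat (face L hL) (face M hM)) (face L hL)).

Inductive diag_step {C : partial_2precategory} : diag_rel C :=
| step_merge_step x y (p q : seq1 C x y) (D D' : diag p q) :
    merge_step D D' -> diag_step D D'
| step_identity x y (p q : seq1 C x y) x' y' (l : seq1 C x x')
    (a : seq1 C x' y') (r : seq1 C y' y) (M : shom2 a a) h
    (e e' : p = l ## a ## r) (D : diag p q) :
    is_identity2 M -> diag_step (dcons (Layer l M r h e e') D) D.

Definition diag_eq {C : partial_2precategory} {x y : ob C} {p q : seq1 C x y} :
    diag p q -> diag p q -> Prop :=
  @diag_closure C (@diag_step C) x y p q.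

(** * 2-morphisms of the completion *)

Definition hom2_seq {C : partial_2precategory} {x y : ob C}
    (p q : seq1 C x y) : Type :=
  quot (@diag_eq C x y p q).

Definition cls2_seq {C : partial_2precategory} {x y : ob C}
    {p q : seq1 C x y} (D : diag p q) : hom2_seq p q :=
  cls (@diag_eq C x y p q) D.

(* A diagram between representatives of the 1-morphisms [f] and [g]. *)
Inductive rep2 {C : partial_2precategory} {x y : ob C} (f g : hom1 x y) :
    Type :=
| Rep2 (p q : seq1 C x y) of cls1 p = f & cls1 q = g & diag p q.

Arguments Rep2 {C x y f g p q} _ _ _.

(* The canonical identifications.  No sequence of compositions and
   decompositions joins an empty sequence to the identity [e] it is identified
   with; inserting [e] is inserting an empty sequence, so the corresponding
   identification inserts the empty diagram on [e]. *)
Inductive rep2_step {C : partial_2precategory} {x y : ob C}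
    (f g : hom1 x y) : rep2 f g -> rep2 f g -> Prop :=
| rep2_canonical (p p' q q' : seq1 C x y) (hp : cls1 p = f) (hp' : cls1 p' = f)
    (hq : cls1 q = g) (hq' : cls1 q' = g) (D : diag p q) (D' : diag p' q')
    (S : idseq p' p) (T : idseq q q') :
    diag_eq (vcat (iddiag S) (vcat D (iddiag T))) D' ->
    rep2_step (Rep2 hp hq D) (Rep2 hp' hq' D')
| rep2_identity z (e : shom1 z z) (p q : seq1 C x z) (p' q' : seq1 C z y)
    (D : diag p q) (D' : diag p' q') hp hq hp' hq' :
    is_identity1 e ->
    rep2_step (Rep2 hp hq (hcat D D'))
              (Rep2 hp' hq' (hcat D (hcat (dempty (pone e)) D'))).

Definition hom2 {C : partial_2precategory} {x y : ob C} (f g : hom1 x y) :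
    Type :=
  quot (clos_refl_sym_trans (rep2 f g) (@rep2_step C x y f g)).

Definition cls2 {C : partial_2precategory} {x y : ob C} {p q : seq1 C x y}
    (D : diag p q) : hom2 (cls1 p) (cls1 q) :=
  cls (clos_refl_sym_trans _ (@rep2_step C x y (cls1 p) (cls1 q)))
      (Rep2 eq_refl eq_refl D).

(* [p] is not the empty sequence of an object having an identity [e].  In that
   case no diagram of identification 2-morphisms joins [p] to the sequence [e]
   of the same class, and only nonempty sequences are compared. *)
Definition regular {C : partial_2precategory} {x y : ob C} (p : seq1 C x y) :
    Prop :=
  match p with
  | pnil x => ~ exists e : shom1 x x, is_identity1 e
  | pcons _ _ => True
  end.

(** * Strict 2-categories (compositions in diagrammatic order) *)

Record two_category_data (O : Type) (H1 : O -> O -> Type)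
    (H2 : forall x y, H1 x y -> H1 x y -> Type) := TwoCategoryData {
  id1 : forall x, H1 x x;
  hcomp1 : forall x y z, H1 x y -> H1 y z -> H1 x z;
  id2 : forall x y (f : H1 x y), H2 x y f f;
  vcomp2 : forall x y (f g h : H1 x y), H2 x y f g -> H2 x y g h -> H2 x y f h;
  hcomp2 : forall x y z (f g : H1 x y) (f' g' : H1 y z),
    H2 x y f g -> H2 y z f' g' -> H2 x z (hcomp1 f f') (hcomp1 g g')
}.

Arguments id1 {O H1 H2} _ x.
Arguments hcomp1 {O H1 H2} _ {x y z} _ _.
Arguments id2 {O H1 H2} _ {x y} _.
Arguments vcomp2 {O H1 H2} _ {x y f g h} _ _.
Arguments hcomp2 {O H1 H2} _ {x y z f g f' g'} _ _.

Record is_strict_2category (O : Type) (H1 : O -> O -> Type)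
    (H2 : forall x y, H1 x y -> H1 x y -> Type)
    (K : two_category_data H2) : Prop := IsStrict2Category {
  hcomp1_assoc : forall x y z t (f : H1 x y) (g : H1 y z) (h : H1 z t),
    hcomp1 K (hcomp1 K f g) h = hcomp1 K f (hcomp1 K g h);
  hcomp1_idl : forall x y (f : H1 x y), hcomp1 K (id1 K x) f = f;
  hcomp1_idr : forall x y (f : H1 x y), hcomp1 K f (id1 K y) = f;
  vcomp2_assoc : forall x y (f g h k : H1 x y)
      (A : H2 x y f g) (B : H2 x y g h) (D : H2 x y h k),
    vcomp2 K (vcomp2 K A B) D = vcomp2 K A (vcomp2 K B D);
  vcomp2_idl : forall x y (f g : H1 x y) (A : H2 x y f g),
    vcomp2 K (id2 K f) A = A;
  vcomp2_idr : forall x y (f g : H1 x y) (A : H2 x y f g),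
    vcomp2 K A (id2 K g) = A;
  hcomp2_id2 : forall x y z (f : H1 x y) (g : H1 y z),
    hcomp2 K (id2 K f) (id2 K g) = id2 K (hcomp1 K f g);
  hcomp2_vcomp2 : forall x y z (f g h : H1 x y) (f' g' h' : H1 y z)
      (A : H2 x y f g) (B : H2 x y g h) (A' : H2 y z f' g') (B' : H2 y z g' h'),
    hcomp2 K (vcomp2 K A B) (vcomp2 K A' B') =
    vcomp2 K (hcomp2 K A A') (hcomp2 K B B');
  hcomp2_assoc : forall x y z t (f f' : H1 x y) (g g' : H1 y z) (h h' : H1 z t)
      (A : H2 x y f f') (B : H2 y z g g') (D : H2 z t h h'),
    transport (hcomp1_assoc f g h) (hcomp1_assoc f' g' h')
      (hcomp2 K (hcomp2 K A B) D) = hcomp2 K A (hcomp2 K B D);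
  hcomp2_idl : forall x y (f g : H1 x y) (A : H2 x y f g),
    transport (hcomp1_idl f) (hcomp1_idl g)
      (hcomp2 K (id2 K (id1 K x)) A) = A;
  hcomp2_idr : forall x y (f g : H1 x y) (A : H2 x y f g),
    transport (hcomp1_idr f) (hcomp1_idr g)
      (hcomp2 K A (id2 K (id1 K y))) = A
}.

(* The identities and compositions of [K] are those induced by empty sequences,
   empty diagrams and concatenations. *)
Record is_completion (C : partial_2precategory)
    (K : two_category_data (@hom2 C)) : Prop := IsCompletion {
  id1_cls : forall x : ob C, id1 K x = cls1 (pnil x);
  hcomp1_cls : forall (x y z : ob C) (p : seq1 C x y) (q : seq1 C y z),
    hcomp1 K (cls1 p) (cls1 q) = cls1 (p ## q);
  id2_cls : forall (x y : ob C) (p : seq1 C x y),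
    id2 K (cls1 p) = cls2 (dempty p);
  vcomp2_cls : forall (x y : ob C) (p q r : seq1 C x y)
      (D : diag p q) (E : diag q r),
    vcomp2 K (cls2 D) (cls2 E) = cls2 (vcat D E);
  hcomp2_cls : forall (x y z : ob C) (p q : seq1 C x y) (p' q' : seq1 C y z)
      (D : diag p q) (E : diag p' q'),
    transport (hcomp1_cls p p') (hcomp1_cls q q')
      (hcomp2 K (cls2 D) (cls2 E)) = cls2 (hcat D E)
}.

(* Main.v *)
Require Import Defs.
From Stdlib Require Import Relations Lia.
From Stdlib Require Import Classical ClassicalEpsilon ProofIrrelevance.
From Stdlib Require Import FunctionalExtensionality PropExtensionality.
From Corelib Require Import ssreflect ssrfun ssrbool.

Set Implicit Arguments.
Unset Strict Implicit.
Unset Printing Implicit Defensive.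

(** Why the completion is a 2-category.

Everything rests on one fact: two sequences of compositions and decompositions
with the same source and target give equal diagrams ([thin]). The Diagram axiom
says so only after composition with a face along the whole sequence. An
identification 2-morphism composes with all its neighbours, so a face along the
whole current sequence absorbs all later compositions and decompositions
([absorbr]). If the empty diagram on a sequence is equal to such a face, the
sequence is called solid, and the loops on it are trivial. In general one takes
a longest prefix that is solid or a single 1-morphism. By maximality no step can
cross its end ([stuck_split]), and a loop cannot move this end ([stuck_loop]),
so that a loop splits into two loops and induction applies ([loop_trivial]).

By [thin], diagrams can be compared up to canonical identification of their
sources and targets ([ceq]). This comparison is compatible with both
concatenations and ignores reassociation, so that the laws of a strict
2-category for sequences and diagrams follow from interchange.

There remain the identity 1-morphisms, which are identified with empty
sequences, whereas no composition or decomposition starts from an empty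
sequence. One must know that inserting an identity [e] between two diagrams is
natural ([insert_identity]). The main case is a single face [A] with last source
edge [f] and last target edge [g]: on the boundary of [A] the edges [g] and [f]
meet, [e] can be inserted at this place next to either of them, and the Diagram
axiom equates the two results ([slide_right]). Faces with an empty source or
target are first joined to [e] ([slide_face]), and diagrams that pass through the
empty sequence are first swept in another order ([thicken]).

It follows that two representatives define the same 2-morphism exactly when they
are canonically identified after the identity of the target object, if there is
one, has been appended to them ([class2P]). The operations on the completion are
defined on regular representatives, and all remaining assertions are read off. *)

(** * Paths *)

(** The intermediate objects may differ, so the components are compared in a sigma type. *)
Lemma pcons_inj {O : Type} {E : O -> O -> Type} {x y y' z : O}
    (e : E x y) (p : path E y z) (e' : E x y') (p' : path E y' z) :
  pcons e p = pcons e' p' ->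
  existT (fun m => (E x m * path E m z)%type) y (e, p) =
  existT (fun m => (E x m * path E m z)%type) y' (e', p').
Proof.
pose head (a b : O) (w : path E a b) :
    option {m : O & (E a m * path E m b)%type} :=
  match w with
  | pnil _ => None
  | pcons f w' => Some (existT _ _ (f, w'))
  end.
by move=> h; apply: (f_equal (fun w => match head x z w with
                           | Some s => s | None => existT _ y (e, p) end) h).
Qed.

Lemma pcons_inj_mid {O : Type} {E : O -> O -> Type} {x y y' z : O}
    (e : E x y) (p : path E y z) (e' : E x y') (p' : path E y' z) :
  pcons e p = pcons e' p' -> y = y'.
Proof. by move=> h; apply: (f_equal (@projT1 _ _) (pcons_inj h)). Qed.

Lemma pcons_inj2 {O : Type} {E : O -> O -> Type} {x y z : O}
    (e : E x y) (p : path E y z) (e' : E x y) (p' : path E y z) :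
  pcons e p = pcons e' p' -> e = e' /\ p = p'.
Proof. by move=> h; case: (inj_pair2 _ _ _ _ _ (pcons_inj h)). Qed.

Lemma pcons_pnil {O : Type} {E : O -> O -> Type} {x y : O}
    (e : E x y) (p : path E y x) : pcons e p <> pnil x.
Proof.
pose empty (a b : O) (w : path E a b) :=
  match w with pnil _ => True | pcons _ _ => False end.
by move=> h; rewrite -/(empty x x (pcons e p)) h.
Qed.

Lemma nonempty_appl {O : Type} {E : O -> O -> Type} {x y z : O}
    (p : path E x y) (q : path E y z) : nonempty p -> nonempty (p ## q).
Proof. by case: p q. Qed.

Lemma nonempty_appr {O : Type} {E : O -> O -> Type} {x y z : O}
    (p : path E x y) (q : path E y z) : nonempty q -> nonempty (p ## q).
Proof. by case: p q. Qed.

Lemma nonempty_mid {O : Type} {E : O -> O -> Type} {x y z t : O}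
    (p : path E x y) (s : path E y z) (q : path E z t) :
  nonempty s -> nonempty (p ## s ## q).
Proof. by move=> h; apply/nonempty_appr/nonempty_appl. Qed.

(** Inversion with the endpoints left as variables, for use when they occur
elsewhere in the goal. *)
Lemma path_case {O : Type} {E : O -> O -> Type} {x y : O} (p : path E x y) :
  (exists exy : x = y, p = eq_rect x (path E x) (pnil x) y exy) \/
  exists m (e : E x m) (p' : path E m y), p = pcons e p'.
Proof. by case: p => [a|a b c e p]; [left; exists erefl|right; exists b, e, p]. Qed.

(** Levi's lemma for words, in its typed form. *)
Lemma levi {O : Type} {E : O -> O -> Type} {x y z z' : O}
    (u : path E x z) (v : path E z y) (u' : path E x z') (v' : path E z' y) :
  u ## v = u' ## v' ->
  (exists c : path E z z', u' = u ## c /\ v = c ## v') \/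
  (exists c : path E z' z, u = u' ## c /\ v' = c ## v).
Proof.
elim: u v u' v' => [a|a b c e u IH] v u' v' /=.
  by move=> ->; left; exists u'.
case: (path_case u') => [[ea ->]|[b' [e' [w' ->]]]].
  by subst z' => /= <-; right; exists (pcons e u).
move=> /= h; have eb := pcons_inj_mid h; subst b'.
have [<- {}h] := pcons_inj2 h.
by case: (IH _ _ _ h) => -[w [-> ->]]; [left|right]; exists w.
Qed.

Lemma papp_eq_nil {O : Type} {E : O -> O -> Type} {x y : O}
    (u : path E x y) (v : path E y x) :
  u ## v = pnil x -> ~ nonempty u /\ ~ nonempty v.
Proof.
case: (path_case u) => [[ea ->]|[m [e [w ->]]]]; last by move=> /= h; case: (pcons_pnil h).
by subst y => /= ->; split=> [[]|[]].
Qed.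

Fixpoint plen {O : Type} {E : O -> O -> Type} {x y : O} (p : path E x y) : nat :=
  match p with pnil _ => 0 | pcons _ p' => S (plen p') end.

Lemma plen_app {O : Type} {E : O -> O -> Type} {x y z : O}
    (p : path E x y) (q : path E y z) : plen (p ## q) = plen p + plen q.
Proof. by elim: p q => //= {}x {}y w e p IH q; rewrite IH. Qed.

(** A composition or decomposition of [s] against a cut of the sequence: only in
the third case does it join the two parts. *)
Lemma cut_cases {O : Type} {E : O -> O -> Type} {x y x' y' z : O}
    (l : path E x x') (s : path E x' y') (r : path E y' y)
    (u : path E x z) (v : path E z y) :
  l ## s ## r = u ## v ->
  [\/ exists c, u = l ## s ## c /\ r = c ## v,
      exists c, l = u ## c /\ v = c ## s ## r |
      exists s1 s2, [/\ nonempty s1, nonempty s2, s = s1 ## s2, u = l ## s1 &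
                        v = s2 ## r]].
Proof.
move=> h; case: (levi h) => -[c [hl hr]]; last first.
  by apply: Or32; exists c.
case: (levi hr) => -[d [hc hd]].
  by apply: Or31; exists d; rewrite hl hc.
case: (path_case c) => [[ea ec]|[m [e [w ec]]]].
  subst z c; apply: Or32; exists (pnil x').
  by rewrite hl /= !papp_nil hr; split.
case: (path_case d) => [[ea ed]|[m' [e' [w' ed]]]].
  subst y' d; apply: Or31; exists (pnil z).
  by rewrite hc hl papp_nil papp_nil; split; last by rewrite hd.
by apply: Or33; exists c, d; split=> //; rewrite ?ec ?ed.
Qed.

Lemma pone_split {O : Type} {E : O -> O -> Type} {x y z : O} (f : E x y)
    (s1 : path E x z) (s2 : path E z y) :
  pone f = s1 ## s2 -> nonempty s1 -> nonempty s2 -> False.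
Proof.
case: (path_case s1) => [[ea ->]|[b [e [s1' ->]]]]; first by subst z.
move=> /= h _; have eb := pcons_inj_mid h; subst b.
have [_ h2] := pcons_inj2 h.
by have [_] := papp_eq_nil (esym h2).
Qed.

Lemma ptwo_split {O : Type} {E : O -> O -> Type} {x y z : O} {m : O}
    (f : E x m) (g : E m y) (s1 : path E x z) (s2 : path E z y) :
  ptwo f g = s1 ## s2 -> nonempty s1 -> nonempty s2 ->
  exists em : m = z,
    s1 = eq_rect m (path E x) (pone f) z em /\
    s2 = eq_rect m (fun k => path E k y) (pone g) z em.
Proof.
case: (path_case s1) => [[ea ->]|[b [e [s1' ->]]]]; first by subst z.
move=> /= h _ h2; have eb := pcons_inj_mid h; subst b.
have {h} [-> h] := pcons_inj2 h.
case: (path_case s1') => [[ea es]|[b [e' [s1'' es]]]].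
  by subst z s1'; exists erefl; split=> //=; rewrite h.
rewrite es /= in h; have eb := pcons_inj_mid h; subst b.
have {h} [_ h] := pcons_inj2 h.
by have [_] := papp_eq_nil (esym h).
Qed.

Lemma snoc_case {O : Type} {E : O -> O -> Type} {x y : O} (p : path E x y) :
  nonempty p -> exists z (p' : path E x z) (f : E z y), p = p' ## pone f.
Proof.
elim: p => // a b c e p IH _; case: (path_case p) => [[ea ep]|[d [e' [w ep]]]].
  by subst c p; exists a, (pnil a), e.
have [|z [p' [f ->]]] := IH; first by rewrite ep.
by exists z, (pcons e p'), f.
Qed.

Lemma cons_case {O : Type} {E : O -> O -> Type} {x y : O} (p : path E x y) :
  nonempty p -> exists z (f : E x z) (p' : path E z y), p = pone f ## p'.
Proof. by case: p => // a b c e p _; exists b, e, p. Qed.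

Lemma prev_app {C : partial_2precategory} {x y z : ob C}
    (p : seq1 C x y) (q : seq1 C y z) : (p ## q)^T = q^T ## p^T.
Proof.
elim: p q => [a|a b c e p IH] q /=; first by rewrite papp_nil.
by rewrite IH papp_assoc.
Qed.

Lemma prevK {C : partial_2precategory} {x y : ob C} (p : seq1 C x y) :
  (p^T)^T = p.
Proof.
by elim: p => //= a b c e p IH; rewrite prev_app IH /= tr1K.
Qed.

(* Equality of concatenations up to associativity and reversal. *)
Ltac pathq :=
  subst;
  rewrite /= ?papp_nil ?prev_app ?prevK ?papp_assoc /= ?papp_nil ?prevK
          ?papp_assoc ?tr1K; reflexivity.

(** * Rotations of simple 2-morphisms *)

Lemma cyclic_fun {C : partial_2precategory} {x y x' y' : ob C}
    {p q : seq1 C x y} {p' q' : seq1 C x' y'} {u u' : seq1 C x x'}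
    {v v' : seq1 C x' x} {A : shom2 p q} {B B' : shom2 p' q'} :
  cyclic u v A B -> cyclic u' v' A B' -> u = u' -> v = v' -> B = B'.
Proof.
move=> [e [e' <-]] [f [f' <-]] eu ev; subst u' v'.
by rewrite (proof_irrelevance _ f e) (proof_irrelevance _ f' e').
Qed.

Lemma cyclic_ex {C : partial_2precategory} {x y x' y' : ob C}
    {p q : seq1 C x y} {p' q' : seq1 C x' y'} (u : seq1 C x x')
    (v : seq1 C x' x) (A : shom2 p q) :
  p ## q^T = u ## v -> p' ## q'^T = v ## u ->
  exists B : shom2 p' q', cyclic u v A B.
Proof. by move=> e e'; exists (cyc e e' A), e, e'. Qed.

Lemma cyclic_refl {C : partial_2precategory} {x y : ob C}
    {p q : seq1 C x y} (A : shom2 p q) (w : seq1 C x x) :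
  p ## q^T = w -> cyclic (pnil x) w A A.
Proof.
move=> <-; exists erefl, (esym (papp_nil _)).
exact: cyc_id.
Qed.

(** A trivial rotation moves nothing or everything. *)
Lemma cyclic_refl' {C : partial_2precategory} {x y : ob C}
    {p q : seq1 C x y} (A : shom2 p q) (w : seq1 C x x) :
  p ## q^T = w -> cyclic w (pnil x) A A.
Proof.
move=> <-; exists (esym (papp_nil _)), erefl.
by rewrite (@cyc_turn C x y y p q p q (p ## q^T) _ _ erefl
              (esym (papp_nil _))) cyc_id.
Qed.

Lemma cyclic_comp {C : partial_2precategory} {x y x' y' x'' y'' : ob C}
    {p q : seq1 C x y} {p' q' : seq1 C x' y'} {p'' q'' : seq1 C x'' y''}
    {u : seq1 C x x'} {u' : seq1 C x' x''} {w : seq1 C x'' x}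
    {A : shom2 p q} {A' : shom2 p' q'} {A'' : shom2 p'' q''} :
  cyclic u (u' ## w) A A' -> cyclic u' (w ## u) A' A'' ->
  cyclic (u ## u') w A A''.
Proof.
move=> [e1 [e1' <-]] [e2 [e2' <-]].
have e3 : p ## q^T = (u ## u') ## w by rewrite e1 papp_assoc.
have e3' : p'' ## q''^T = w ## u ## u' by rewrite e2' papp_assoc.
by exists e3, e3'; rewrite (cyc_comp e1 e1' e2 e2' e3 e3').
Qed.

Lemma cyclic_sym {C : partial_2precategory} {x y x' y' : ob C}
    {p q : seq1 C x y} {p' q' : seq1 C x' y'} {u : seq1 C x x'}
    {v : seq1 C x' x} {A : shom2 p q} {A' : shom2 p' q'} :
  cyclic u v A A' -> cyclic v u A' A.
Proof.
move=> [e [e' eA]].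
have [B hB] := @cyclic_ex C x' y' x y p' q' p q v u A' e' e.
suff -> : A = B by [].
have h1 : cyclic u (v ## pnil x) A A'.
  by rewrite papp_nil; exists e, e'.
have h2 := cyclic_comp h1 hB.
exact: cyclic_fun (cyclic_refl' A e) h2 erefl erefl.
Qed.

(** When the two rotations together exceed a full turn, only the excess [c]
remains. *)
Lemma cyclic_trans {C : partial_2precategory} {x y x' y' x'' y'' : ob C}
    {p q : seq1 C x y} {p' q' : seq1 C x' y'} {p'' q'' : seq1 C x'' y''}
    {u : seq1 C x x'} {v : seq1 C x' x} {u' : seq1 C x' x''}
    {v' : seq1 C x'' x'}
    {A : shom2 p q} {A' : shom2 p' q'} {A'' : shom2 p'' q''} :
  cyclic u v A A' -> cyclic u' v' A' A'' ->
  exists (u'' : seq1 C x x'') v'', cyclic u'' v'' A A''.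
Proof.
move=> h h'; have [f1 [f1' _]] := h; have [f2 [f2' _]] := h'.
have e : v ## u = u' ## v' by rewrite -f1' f2.
case: (levi e) => -[c [e1 e2]]; subst.
- have [X hX] : exists X : shom2 p'' q'', cyclic c (v' ## v) A X.
    by apply: cyclic_ex; rewrite ?f1 ?f2' papp_assoc.
  have [Y hY] : exists Y : shom2 p' q', cyclic v' (v ## c) X Y.
    by apply: cyclic_ex; rewrite ?f1' ?f2' ?papp_assoc.
  have eY := cyclic_fun (cyclic_comp hX hY) h erefl erefl; subst Y.
  exists c, (v' ## v).
  by rewrite -(cyclic_fun (cyclic_sym hY) h' erefl erefl).
- by exists (u ## u'), c; apply: cyclic_comp h h'.
Qed.

Lemma cyclic_tr {C : partial_2precategory} {x y x' y' : ob C}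
    {p q : seq1 C x y} {p' q' : seq1 C x' y'} {u : seq1 C x x'}
    {v : seq1 C x' x} {A : shom2 p q} {A' : shom2 p' q'} :
  cyclic u v A A' -> cyclic (v^T) (u^T) (tr2 A) (tr2 A').
Proof.
move=> [e [e' <-]].
have f : q ## p^T = v^T ## u^T by rewrite -prev_app -e prev_app prevK.
have f' : q' ## p'^T = u^T ## v^T by rewrite -prev_app -e' prev_app prevK.
by exists f, f'; rewrite (tr2_cyc e e' f f').
Qed.

(** * Flexible faces *)

(** The composability that holds for identification 2-morphisms, in a form that
passes to their rotations and adjoints. *)
Definition flexible {C : partial_2precategory} {x y : ob C} {p q : seq1 C x y}
    (A : shom2 p q) : Prop :=
  (forall x' y' (a c b : seq1 C x' y') u v (A' : shom2 c b) (B : shom2 a c),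
     cyclic u v A A' -> nonempty c -> scomp2 B A') /\
  (forall x' y' (a c b : seq1 C x' y') u v (A' : shom2 a c) (B : shom2 c b),
     cyclic u v A A' -> nonempty c -> scomp2 A' B).

Lemma flexible_ident {C : partial_2precategory} {x y z : ob C}
    {a : shom1 x y} {b : shom1 y z} (h : scomp1 a b) : flexible (ident h).
Proof.
split=> x' y' p c q u v A' B [e [e' <-]] hc.
  exact: ident_scomp2r.
exact: ident_scomp2l.
Qed.

Lemma flexible_tr2 {C : partial_2precategory} {x y : ob C} {p q : seq1 C x y}
    {A : shom2 p q} : flexible A -> flexible (tr2 A).
Proof.
move=> [hr hl]; split=> x' y' a c b u v A' B hA hc.
- have := cyclic_tr hA; rewrite tr2K => hA'.
  have := hl _ _ _ _ _ _ _ _ (tr2 B) hA' hc => h.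
  by have := scomp2_tr h; rewrite !tr2K.
- have := cyclic_tr hA; rewrite tr2K => hA'.
  have := hr _ _ _ _ _ _ _ _ (tr2 B) hA' hc => h.
  by have := scomp2_tr h; rewrite !tr2K.
Qed.

Lemma flexible_cyclic {C : partial_2precategory} {x y x' y' : ob C}
    {p q : seq1 C x y} {p' q' : seq1 C x' y'} {u : seq1 C x x'}
    {v : seq1 C x' x} {A : shom2 p q} {A' : shom2 p' q'} :
  cyclic u v A A' -> flexible A -> flexible A'.
Proof.
move=> hA [hr hl]; split=> x'' y'' a c b u' v' A'' B hA' hc;
  have [u'' [v'' hA'']] := cyclic_trans hA hA'.
- exact: hr hA'' hc.
- exact: hl hA'' hc.
Qed.

Lemma flexible_glue {C : partial_2precategory} {x y : ob C} {p c q : seq1 C x y}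
    (A : shom2 p c) (B : shom2 c q) :
  flexible A \/ flexible B -> nonempty c -> exists h : scomp2 A B, glue A B (sv2 h).
Proof.
move=> hf hc; have h : scomp2 A B.
  by case: hf => -[hr hl]; [apply: hl _ hc|apply: hr _ hc];
     apply: cyclic_refl.
by exists h; left; exists h.
Qed.

(** * Diagrams up to merging *)

Lemma layer_ext {C : partial_2precategory} {x y : ob C} {p q : seq1 C x y}
    {x' y' : ob C} {l l' : seq1 C x x'} {a b : seq1 C x' y'} {A : shom2 a b}
    {r r' : seq1 C y' y} {h h' : polygon a b}
    {e1 : p = l ## a ## r} {e2 : q = l ## b ## r}
    {e1' : p = l' ## a ## r'} {e2' : q = l' ## b ## r'} :
  l = l' -> r = r' -> Layer l A r h e1 e2 = Layer l' A r' h' e1' e2'.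
Proof.
move=> el er; subst l' r'.
by rewrite (proof_irrelevance _ h h') (proof_irrelevance _ e1 e1')
           (proof_irrelevance _ e2 e2').
Qed.

Ltac layerq := apply: layer_ext; pathq.

Lemma vcat_dempty {C : partial_2precategory} {x y : ob C} {p q : seq1 C x y}
    (D : diag p q) : vcat D (dempty q) = D.
Proof. by elim: D => //= {}p {}q r L D ->. Qed.

Lemma vcat_assoc {C : partial_2precategory} {x y : ob C} {p q r s : seq1 C x y}
    (D : diag p q) (E : diag q r) (F : diag r s) :
  vcat (vcat D E) F = vcat D (vcat E F).
Proof. by elim: D E => //= {}p {}q t L D IH E; rewrite IH. Qed.

Lemma whiskerl_vcat {C : partial_2precategory} {x y z : ob C}
    {p q r : seq1 C x y} (s : seq1 C z x) (D : diag p q) (E : diag q r) :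
  whiskerl s (vcat D E) = vcat (whiskerl s D) (whiskerl s E).
Proof. by elim: D E => //= {}p {}q t L D IH E; rewrite IH. Qed.

Lemma whiskerr_vcat {C : partial_2precategory} {x y z : ob C}
    {p q r : seq1 C x y} (D : diag p q) (E : diag q r) (s : seq1 C y z) :
  whiskerr (vcat D E) s = vcat (whiskerr D s) (whiskerr E s).
Proof. by elim: D E => //= {}p {}q t L D IH E; rewrite IH. Qed.

(** Equality by exchanges and mergers alone, the relation in which [is_identity2]
is expressed. *)
Definition mergeable {C : partial_2precategory} {x y : ob C} {p q : seq1 C x y} :
    diag p q -> diag p q -> Prop :=
  @diag_closure C (@merge_step C) x y p q.

Lemma closure_vcatl {C : partial_2precategory} (R : diag_rel C) {x y : ob C}
    {p q r : seq1 C x y} (D : diag p q) {E E' : diag q r} :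
  diag_closure R E E' -> diag_closure R (vcat D E) (vcat D E').
Proof.
by elim: D E E' => //= {}p {}q t L D IH E E' h; apply/closure_cons/IH.
Qed.

Lemma closure_vcatr {C : partial_2precategory} (R : diag_rel C) :
  (forall (x y : ob C) (p q r : seq1 C x y) (D D' : diag p q) (E : diag q r),
     R x y p q D D' -> R x y p r (vcat D E) (vcat D' E)) ->
  forall (x y : ob C) (p q r : seq1 C x y) (D D' : diag p q) (E : diag q r),
  diag_closure R D D' -> diag_closure R (vcat D E) (vcat D' E).
Proof.
move=> hR x y p q r D D' E h; elim: h r E => {x y p q D D'}.
- by move=> x y p q D D' h r E; apply/closure_step/hR.
- by move=> x y p q D r E; apply: closure_refl.
- by move=> x y p q D D' _ IH r E; apply: closure_sym.
- by move=> x y p q D D' D'' _ IH _ IH' r E; apply: closure_trans (IH' _ _).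
- by move=> x y p q r L D D' _ IH s E; apply/closure_cons/IH.
Qed.

Lemma merge_step_vcat {C : partial_2precategory} (x y : ob C)
    (p q r : seq1 C x y) (D D' : diag p q) (E : diag q r) :
  merge_step D D' -> merge_step (vcat D E) (vcat D' E).
Proof.
move=> h; case: h r E => {x y p q D D'}.
- by move=> x y p q q' t s L L' K K' D h r E; apply: step_exchange.
- by move=> x y p q t s L L' K D h r E; apply: step_merge.
Qed.

Lemma diag_step_vcat {C : partial_2precategory} (x y : ob C)
    (p q r : seq1 C x y) (D D' : diag p q) (E : diag q r) :
  diag_step D D' -> diag_step (vcat D E) (vcat D' E).
Proof.
move=> h; case: h r E => {x y p q D D'}.
- by move=> x y p q D D' h r E; apply/step_merge_step/merge_step_vcat.
- by move=> x y p q x' y' l a t M h e e' D hM r E; apply: step_identity.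
Qed.

Lemma mergeable_vcat {C : partial_2precategory} {x y : ob C} {p q r : seq1 C x y}
    {D D' : diag p q} {E E' : diag q r} :
  mergeable D D' -> mergeable E E' -> mergeable (vcat D E) (vcat D' E').
Proof.
move=> h h'; apply: closure_trans (closure_vcatl D' h').
by apply: closure_vcatr h => *; apply: merge_step_vcat.
Qed.

Lemma diag_eq_refl {C : partial_2precategory} {x y : ob C} {p q : seq1 C x y}
    (D : diag p q) : diag_eq D D.
Proof. exact: closure_refl. Qed.

Lemma diag_eq_sym {C : partial_2precategory} {x y : ob C} {p q : seq1 C x y}
    {D D' : diag p q} : diag_eq D D' -> diag_eq D' D.
Proof. exact: closure_sym. Qed.

Lemma diag_eq_trans {C : partial_2precategory} {x y : ob C} {p q : seq1 C x y}
    {D D' D'' : diag p q} : diag_eq D D' -> diag_eq D' D'' -> diag_eq D D''.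
Proof. exact: closure_trans. Qed.

#[export] Hint Resolve diag_eq_refl : core.

Lemma diag_eq_vcat {C : partial_2precategory} {x y : ob C} {p q r : seq1 C x y}
    {D D' : diag p q} {E E' : diag q r} :
  diag_eq D D' -> diag_eq E E' -> diag_eq (vcat D E) (vcat D' E').
Proof.
move=> h h'; apply: closure_trans (closure_vcatl D' h').
by apply: closure_vcatr h => *; apply: diag_step_vcat.
Qed.

Lemma mergeable_diag_eq {C : partial_2precategory} {x y : ob C} {p q : seq1 C x y}
    {D D' : diag p q} : mergeable D D' -> diag_eq D D'.
Proof.
elim=> {x y p q D D'}.
- by move=> x y p q D D' h; apply/closure_step/step_merge_step.
- by move=> x y p q D; apply: closure_refl.
- by move=> x y p q D D' _; apply: closure_sym.
- by move=> x y p q D D' D'' _ h _; apply: closure_trans h.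
- by move=> x y p q r L D D' _; apply: closure_cons.
Qed.

(** ** Whiskering *)

(** Whiskering reassociates the outer sequences of a layer, so the constructors of
[exchange] and [merge] apply to whiskered layers only after these are rewritten. *)
Lemma exchange_eq {C : partial_2precategory} {x y : ob C}
    {p q q' r : seq1 C x y} {L L1 : layer p q} {L' L1' : layer q r}
    {K K1 : layer p q'} {K' K1' : layer q' r} :
  exchange L1 L1' K1 K1' -> L = L1 -> L' = L1' -> K = K1 -> K' = K1' ->
  exchange L L' K K'.
Proof. by move=> h -> -> -> ->. Qed.

Lemma merge_eq {C : partial_2precategory} {x y : ob C}
    {p q r : seq1 C x y} {L L1 : layer p q} {L' L1' : layer q r}
    {K K1 : layer p r} :
  merge L1 L1' K1 -> L = L1 -> L' = L1' -> K = K1 -> merge L L' K.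
Proof. by move=> h -> -> ->. Qed.

Lemma exchange_layerl {C : partial_2precategory} {x y z : ob C}
    {p q q' r : seq1 C x y} {L : layer p q} {L' : layer q r}
    {K : layer p q'} {K' : layer q' r} (s : seq1 C z x) :
  exchange L L' K K' ->
  exchange (layerl s L) (layerl s L') (layerl s K) (layerl s K').
Proof.
case=> {p q q' r L L' K K'}.
- move=> p q q' r x1 y1 x2 y2 k b b' m a a' t B A hB hB' hA hA'
    e1 e2 e3 e4 f1 f2 f3 f4 /=.
  unshelve eapply (exchange_eq (@exchange_far C z y _ _ _ _ x1 y1 x2 y2
    (s ## k) b b' m a a' t B A hB hB' hA hA' _ _ _ _ _ _ _ _));
    first [layerq|clear; pathq|pathq].
- move=> p q q' r x1 w v y2 k b b' c a a' t B A B' A' hB hB' hA hA'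
    e1 e2 e3 e4 f1 f2 f3 f4 cB cA /=.
  unshelve eapply (exchange_eq (@exchange_adjacent C z y _ _ _ _ x1 w v y2
    (s ## k) b b' c a a' t B A B' A' hB hB' hA hA' _ _ _ _ _ _ _ _ cB cA));
    first [layerq|pathq].
Qed.

Lemma exchange_layerr {C : partial_2precategory} {x y z : ob C}
    {p q q' r : seq1 C x y} {L : layer p q} {L' : layer q r}
    {K : layer p q'} {K' : layer q' r} (s : seq1 C y z) :
  exchange L L' K K' ->
  exchange (layerr L s) (layerr L' s) (layerr K s) (layerr K' s).
Proof.
case=> {p q q' r L L' K K'}.
- move=> p q q' r x1 y1 x2 y2 k b b' m a a' t B A hB hB' hA hA'
    e1 e2 e3 e4 f1 f2 f3 f4 /=.
  unshelve eapply (exchange_eq (@exchange_far C x z _ _ _ _ x1 y1 x2 y2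
    k b b' m a a' (t ## s) B A hB hB' hA hA' _ _ _ _ _ _ _ _));
    first [layerq|pathq].
- move=> p q q' r x1 w v y2 k b b' c a a' t B A B' A' hB hB' hA hA'
    e1 e2 e3 e4 f1 f2 f3 f4 cB cA /=.
  unshelve eapply (exchange_eq (@exchange_adjacent C x z _ _ _ _ x1 w v y2
    k b b' c a a' (t ## s) B A B' A' hB hB' hA hA' _ _ _ _ _ _ _ _ cB cA));
    first [layerq|pathq].
Qed.

Lemma merge_layerl {C : partial_2precategory} {x y z : ob C}
    {p q r : seq1 C x y} {L : layer p q} {L' : layer q r} {K : layer p r}
    (s : seq1 C z x) :
  merge L L' K -> merge (layerl s L) (layerl s L') (layerl s K).
Proof.
case=> {p q r L L' K}.
- move=> p q r x1 y1 x2 y2 k l c b t a u A B M A' M' hA hB hM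
    e1 e2 e3 e4 f1 f2 cA g cM /=.
  unshelve eapply (merge_eq (@merge_lower C z y _ _ _ x1 y1 x2 y2
    (s ## k) l c b t a u A B M A' M' hA hB hM _ _ _ _ _ _ cA g cM));
    first [layerq|pathq].
- move=> p q r x1 y1 x2 y2 k l a c t b u A B M B' M' hA hB hM
    e1 e2 e3 e4 f1 f2 cB g cM /=.
  unshelve eapply (merge_eq (@merge_upper C z y _ _ _ x1 y1 x2 y2
    (s ## k) l a c t b u A B M B' M' hA hB hM _ _ _ _ _ _ cB g cM));
    first [layerq|pathq].
- move=> p q r x1 x2 y2 y1 k l c t a b u A B M A' B' M' hA hB hM
    e1 e2 e3 e4 f1 f2 cA cB g cM /=.
  unshelve eapply (merge_eq (@merge_left C z y _ _ _ x1 x2 y2 y1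
    (s ## k) l c t a b u A B M A' B' M' hA hB hM _ _ _ _ _ _ cA cB g cM));
    first [layerq|pathq].
- move=> p q r x1 x2 y2 y1 k l c t a b u A B M A' B' M' hA hB hM
    e1 e2 e3 e4 f1 f2 cA cB g cM /=.
  unshelve eapply (merge_eq (@merge_right C z y _ _ _ x1 x2 y2 y1
    (s ## k) l c t a b u A B M A' B' M' hA hB hM _ _ _ _ _ _ cA cB g cM));
    first [layerq|pathq].
Qed.

Lemma merge_layerr {C : partial_2precategory} {x y z : ob C}
    {p q r : seq1 C x y} {L : layer p q} {L' : layer q r} {K : layer p r}
    (s : seq1 C y z) :
  merge L L' K -> merge (layerr L s) (layerr L' s) (layerr K s).
Proof.
case=> {p q r L L' K}.
- move=> p q r x1 y1 x2 y2 k l c b t a u A B M A' M' hA hB hM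
    e1 e2 e3 e4 f1 f2 cA g cM /=.
  unshelve eapply (merge_eq (@merge_lower C x z _ _ _ x1 y1 x2 y2
    k l c b t a (u ## s) A B M A' M' hA hB hM _ _ _ _ _ _ cA g cM));
    first [layerq|pathq].
- move=> p q r x1 y1 x2 y2 k l a c t b u A B M B' M' hA hB hM
    e1 e2 e3 e4 f1 f2 cB g cM /=.
  unshelve eapply (merge_eq (@merge_upper C x z _ _ _ x1 y1 x2 y2
    k l a c t b (u ## s) A B M B' M' hA hB hM _ _ _ _ _ _ cB g cM));
    first [layerq|pathq].
- move=> p q r x1 x2 y2 y1 k l c t a b u A B M A' B' M' hA hB hM
    e1 e2 e3 e4 f1 f2 cA cB g cM /=.
  unshelve eapply (merge_eq (@merge_left C x z _ _ _ x1 x2 y2 y1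
    k l c t a b (u ## s) A B M A' B' M' hA hB hM _ _ _ _ _ _ cA cB g cM));
    first [layerq|pathq].
- move=> p q r x1 x2 y2 y1 k l c t a b u A B M A' B' M' hA hB hM
    e1 e2 e3 e4 f1 f2 cA cB g cM /=.
  unshelve eapply (merge_eq (@merge_right C x z _ _ _ x1 x2 y2 y1
    k l c t a b (u ## s) A B M A' B' M' hA hB hM _ _ _ _ _ _ cA cB g cM));
    first [layerq|pathq].
Qed.

Lemma diag_eq_whiskerl {C : partial_2precategory} {x y z : ob C}
    {p q : seq1 C x y} (s : seq1 C z x) {D D' : diag p q} :
  diag_eq D D' -> diag_eq (whiskerl s D) (whiskerl s D').
Proof.
move=> h; elim: h s => {x y p q D D'}.
- move=> x y p q D D' h s; apply: closure_step; case: h s => {x y p q D D'}.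
    move=> x y p q D D' h s; apply: step_merge_step.
    case: h s => {x y p q D D'}.
      by move=> x y p q q' t r L L' K K' D h s; apply/step_exchange/exchange_layerl.
    by move=> x y p q t r L L' K D h s; apply/step_merge/merge_layerl.
  by move=> x y p q x' y' l a t M h e e' D hM s; apply: step_identity.
- by move=> x y p q D s; apply: closure_refl.
- by move=> x y p q D D' _ IH s; apply/closure_sym/IH.
- by move=> x y p q D D' D'' _ IH _ IH' s; apply: closure_trans (IH _) (IH' _).
- by move=> x y p q r L D D' _ IH s; apply/closure_cons/IH.
Qed.

Lemma diag_eq_whiskerr {C : partial_2precategory} {x y z : ob C}
    {p q : seq1 C x y} {D D' : diag p q} (s : seq1 C y z) :
  diag_eq D D' -> diag_eq (whiskerr D s) (whiskerr D' s).
Proof.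
move=> h; elim: h s => {x y p q D D'}.
- move=> x y p q D D' h s; apply: closure_step; case: h s => {x y p q D D'}.
    move=> x y p q D D' h s; apply: step_merge_step.
    case: h s => {x y p q D D'}.
      by move=> x y p q q' t r L L' K K' D h s; apply/step_exchange/exchange_layerr.
    by move=> x y p q t r L L' K D h s; apply/step_merge/merge_layerr.
  by move=> x y p q x' y' l a t M h e e' D hM s; apply: step_identity.
- by move=> x y p q D s; apply: closure_refl.
- by move=> x y p q D D' _ IH s; apply/closure_sym/IH.
- by move=> x y p q D D' D'' _ IH _ IH' s; apply: closure_trans (IH _) (IH' _).
- by move=> x y p q r L D D' _ IH s; apply/closure_cons/IH.
Qed.

(** A face on the left of an object and one on its right are far apart, so they
are exchanged one pair at a time. *)
Lemma diag_interchange {C : partial_2precategory} {x y z : ob C}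
    {p q : seq1 C x y} {p' q' : seq1 C y z} (D : diag p q) (D' : diag p' q') :
  diag_eq (vcat (whiskerr D p') (whiskerl q D'))
          (vcat (whiskerl p D') (whiskerr D q')).
Proof.
have layers (a b : seq1 C x y) (a' b' : seq1 C y z) (L : layer a b)
    (L' : layer a' b') (s : seq1 C x z) (E : diag _ s) :
  diag_eq (dcons (layerr L a') (dcons (layerl b L') E))
          (dcons (layerl a L') (dcons (layerr L b') E)).
  case: L E => x1 y1 k c d A t hA e1 e2 E.
  case: L' E => x2 y2 k' c' d' A' t' hA' e1' e2' E /=.
  apply/closure_step/step_merge_step/step_exchange.
  unshelve eapply (exchange_eq (@exchange_far C x z _ _ _ _ x1 y1 x2 y2
    k c d (t ## k') c' d' t' A A' hA hA hA' hA' _ _ _ _ _ _ _ _));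
    first [layerq|pathq].
have one (a b : seq1 C x y) (L : layer a b) (s : seq1 C x z)
    (E : diag _ s) :
  diag_eq (dcons (layerr L p') (vcat (whiskerl b D') E))
          (vcat (whiskerl a D') (dcons (layerr L q') E)).
  elim: D' E => {p' q'} [p' E|p' q' r' L' D' IH E] /=; first exact: closure_refl.
  apply: diag_eq_trans (layers _ _ _ _ _ _ _ _) _.
  by apply: closure_cons; apply: IH.
elim: D => {p q} [p|p q r L D IH] /=; first by rewrite vcat_dempty.
apply: diag_eq_trans (closure_cons _ IH) _.
exact: one.
Qed.

(** ** Placing a diagram between two sequences *)

(** Whiskering on both sides. The two equations leave the outer sequences in any
shape, so that associativity of concatenation needs no casts. *)
Definition emb {C : partial_2precategory} {x y x' y' : ob C}
    {a b : seq1 C x' y'} {p q : seq1 C x y} (l : seq1 C x x') (D : diag a b)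
    (r : seq1 C y' y) (e : p = l ## a ## r) (e' : q = l ## b ## r) :
    diag p q :=
  match esym e in _ = p0, esym e' in _ = q0 return diag p0 q0 with
  | erefl, erefl => whiskerl l (whiskerr D r)
  end.

Arguments emb {C x y x' y' a b p q} l D r e e'.

Lemma emb_layer {C : partial_2precategory} {x y x' y' x'' y'' : ob C}
    {a b c : seq1 C x' y'} {p m q : seq1 C x y} (l : seq1 C x x')
    (l' : seq1 C x' x'') (u v : seq1 C x'' y'') (A : shom2 u v)
    (r' : seq1 C y'' y') h e1 e2 (D : diag b c) (r : seq1 C y' y)
    (e : p = l ## a ## r) (e' : q = l ## c ## r) (em : m = l ## b ## r)
    (f1 : p = (l ## l') ## u ## r' ## r) (f2 : m = (l ## l') ## v ## r' ## r) :
  emb l (dcons (Layer l' A r' h e1 e2) D) r e e' =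
  dcons (Layer (l ## l') A (r' ## r) h f1 f2) (emb l D r em e').
Proof.
move: f1 f2; rewrite /emb; subst p q m => /= f1 f2.
by congr dcons; apply: layer_ext.
Qed.

Lemma emb_dempty {C : partial_2precategory} {x y x' y' : ob C}
    {a : seq1 C x' y'} {p : seq1 C x y} (l : seq1 C x x') (r : seq1 C y' y)
    (e e' : p = l ## a ## r) :
  emb l (dempty a) r e e' = dempty p.
Proof. by rewrite (proof_irrelevance _ e' e) /emb; subst p. Qed.

Lemma emb_face {C : partial_2precategory} {x y x' y' : ob C}
    {a b : seq1 C x' y'} {p q : seq1 C x y} (l : seq1 C x x') (A : shom2 a b)
    (h : polygon a b) (r : seq1 C y' y) (e : p = l ## a ## r)
    (e' : q = l ## b ## r) :
  emb l (face A h) r e e' = dcons (Layer l A r h e e') (dempty q).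
Proof.
rewrite /emb; subst p q => /=.
by congr dcons; apply: layer_ext; rewrite ?papp_nil.
Qed.

Lemma face_eq {C : partial_2precategory} {x y : ob C} {a b : seq1 C x y}
    (A : shom2 a b) (h : polygon a b) (e : a = pnil x ## a ## pnil y)
    (e' : b = pnil x ## b ## pnil y) :
  dcons (Layer (pnil x) A (pnil y) h e e') (dempty b) = face A h.
Proof. by congr dcons; apply: layer_ext. Qed.

Lemma emb_vcat {C : partial_2precategory} {x y x' y' : ob C}
    {a b c : seq1 C x' y'} {p m q : seq1 C x y} (l : seq1 C x x')
    (D : diag a b) (E : diag b c) (r : seq1 C y' y)
    (e : p = l ## a ## r) (e' : q = l ## c ## r) (em : m = l ## b ## r) :
  emb l (vcat D E) r e e' = vcat (emb l D r e em) (emb l E r em e').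
Proof.
by rewrite /emb; subst p q m => /=; rewrite whiskerr_vcat whiskerl_vcat.
Qed.

Lemma emb_eq {C : partial_2precategory} {x y x' y' : ob C}
    {a b : seq1 C x' y'} {p q : seq1 C x y} (l : seq1 C x x')
    (D D' : diag a b) (r : seq1 C y' y)
    (e : p = l ## a ## r) (e' : q = l ## b ## r) :
  diag_eq D D' -> diag_eq (emb l D r e e') (emb l D' r e e').
Proof.
move=> h; rewrite /emb; subst p q.
exact/diag_eq_whiskerl/diag_eq_whiskerr.
Qed.

Lemma emb_emb {C : partial_2precategory} {x y x' y' x'' y'' : ob C}
    {a b : seq1 C x'' y''} {p q : seq1 C x' y'} {p' q' : seq1 C x y}
    (l : seq1 C x x') (l' : seq1 C x' x'') (D : diag a b)
    (r' : seq1 C y'' y') (r : seq1 C y' y)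
    (f : p = l' ## a ## r') (f' : q = l' ## b ## r')
    (e : p' = l ## p ## r) (e' : q' = l ## q ## r)
    (g : p' = (l ## l') ## a ## (r' ## r)) (g' : q' = (l ## l') ## b ## (r' ## r)) :
  emb l (emb l' D r' f f') r e e' = emb (l ## l') D (r' ## r) g g'.
Proof.
elim: D p q p' q' f f' e e' g g' => {a b}.
  move=> a p q p' q' f f' e e' g g'.
  have epq : p = q by rewrite f f'.
  have epq' : p' = q' by rewrite g g'.
  by destruct epq, epq'; rewrite !emb_dempty.
move=> a b c [x3 y3 l3 a3 b3 A r3 h e1 e2] D IH p q p' q' f f' e e' g g'.
unshelve erewrite (@emb_layer _ _ _ _ _ _ _ _ _ _ p (l' ## b ## r') q);
  [reflexivity|pathq|pathq|].
unshelve erewrite (@emb_layer _ _ _ _ _ _ _ _ _ _ p' (l ## (l' ## b ## r') ## r) q');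
  [reflexivity|pathq|pathq|].
unshelve erewrite (@emb_layer _ _ _ _ _ _ _ _ _ _ p'
  (l ## (l' ## b ## r') ## r) q' (l ## l')); [pathq|pathq|pathq|].
congr dcons; first layerq.
exact: IH.
Qed.

Lemma emb_id {C : partial_2precategory} {x y : ob C} {p q : seq1 C x y}
    (D : diag p q) (e : p = pnil x ## p ## pnil y) (e' : q = pnil x ## q ## pnil y) :
  emb (pnil x) D (pnil y) e e' = D.
Proof.
elim: D e e' => [a|a b c [x3 y3 l3 a3 b3 A r3 h e1 e2] D IH] e e'.
  by rewrite emb_dempty.
unshelve erewrite (@emb_layer _ _ _ _ _ _ _ _ _ _ a b c); try pathq.
by rewrite IH; congr dcons; layerq.
Qed.

Lemma whiskerl_emb {C : partial_2precategory} {x y z : ob C}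
    {p q : seq1 C x y} (s : seq1 C z x) (D : diag p q)
    (e : s ## p = s ## p ## pnil y) (e' : s ## q = s ## q ## pnil y) :
  whiskerl s D = emb s D (pnil y) e e'.
Proof.
elim: D e e' => [a|a b c [x3 y3 l3 a3 b3 A r3 h e1 e2] D IH] e e'.
  by rewrite emb_dempty.
unshelve erewrite (@emb_layer _ _ _ _ _ _ _ _ _ _ (s ## a) (s ## b) (s ## c));
  try pathq.
by rewrite -IH /=; congr dcons; layerq.
Qed.

Lemma whiskerr_emb {C : partial_2precategory} {x y z : ob C}
    {p q : seq1 C x y} (D : diag p q) (s : seq1 C y z)
    (e : p ## s = pnil x ## p ## s) (e' : q ## s = pnil x ## q ## s) :
  whiskerr D s = emb (pnil x) D s e e'.
Proof.
elim: D e e' => [a|a b c [x3 y3 l3 a3 b3 A r3 h e1 e2] D IH] e e'.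
  by rewrite emb_dempty.
unshelve erewrite (@emb_layer _ _ _ _ _ _ _ _ _ _ (a ## s) (b ## s) (c ## s));
  try pathq.
by rewrite -IH /=; congr dcons; layerq.
Qed.

(** * Sequences of compositions and decompositions *)

Definition stepinv {C : partial_2precategory} {x y : ob C} {p q : seq1 C x y}
    (s : idstep p q) : idstep q p :=
  match s with Compose c => Decompose c | Decompose c => Compose c end.

Fixpoint idcat {C : partial_2precategory} {x y : ob C} {p q r : seq1 C x y}
    (S : idseq p q) : idseq q r -> idseq p r :=
  match S in idseq p q return idseq q r -> idseq p r with
  | inil _ => fun T => T
  | icons s S' => fun T => icons s (idcat S' T)
  end.

Fixpoint idinv {C : partial_2precategory} {x y : ob C} {p q : seq1 C x y}
    (S : idseq p q) : idseq q p :=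
  match S in idseq p q return idseq q p with
  | inil p => inil p
  | icons s S' => idcat (idinv S') (icons (stepinv s) (inil _))
  end.

Lemma iddiag_cat {C : partial_2precategory} {x y : ob C} {p q r : seq1 C x y}
    (S : idseq p q) (T : idseq q r) :
  iddiag (idcat S T) = vcat (iddiag S) (iddiag T).
Proof. by elim: S T => //= {}p {}q t s S IH T; rewrite IH. Qed.

Lemma idemb {C : partial_2precategory} {x y x' y' : ob C}
    {a b : seq1 C x' y'} {p q : seq1 C x y} (l : seq1 C x x') (S : idseq a b)
    (r : seq1 C y' y) (e : p = l ## a ## r) (e' : q = l ## b ## r) :
  exists T : idseq p q, iddiag T = emb l (iddiag S) r e e'.
Proof.
elim: S p e e' => [c p|c d f s S IH p] e e'.
  have epq : p = q by rewrite e e'.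
  by destruct epq; exists (inil _); rewrite emb_dempty.
have [T hT] := IH _ erefl e'.
have [s' hs'] : exists s' : idstep p (l ## d ## r), forall E : diag _ q,
    dcons (idlayer s') E =
    vcat (emb l (dcons (idlayer s) (dempty d)) r e erefl) E.
{ case: s => -[x1 m y1 k a1 b1 h t e1 e2].
  - unshelve eexists (Compose (@Composition C x y _ _ x1 m y1
      (l ## k) a1 b1 h (t ## r) _ _)); try pathq.
    move=> E /=; unshelve erewrite (@emb_layer _ _ _ _ _ _ _ _ _ _ p
      (l ## d ## r) (l ## d ## r)); try pathq.
    by rewrite emb_dempty /=; congr dcons; layerq.
  - unshelve eexists (Decompose (@Composition C x y _ _ x1 m y1
      (l ## k) a1 b1 h (t ## r) _ _)); try pathq.
    move=> E /=; unshelve erewrite (@emb_layer _ _ _ _ _ _ _ _ _ _ p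
      (l ## d ## r) (l ## d ## r)); try pathq.
    by rewrite emb_dempty /=; congr dcons; layerq. }
by exists (icons s' T) => /=; rewrite hs' hT -emb_vcat.
Qed.

(** ** Absorption of identification 2-morphisms *)

Lemma vcomp_layer_fun {C : partial_2precategory} {x y : ob C}
    {s p q : seq1 C x y} {M : shom2 s p} {L : layer p q} {M1 M2 : shom2 s q} :
  vcomp_layer M L M1 -> vcomp_layer M L M2 -> M1 = M2.
Proof.
case: L => x' y' l a b A r h e e' [N [hN [c1 c2]]] [N' [hN' [c1' c2']]].
have eN := cyclic_fun c1 c1' erefl erefl; subst N'.
rewrite (proof_irrelevance _ hN' hN) in c2'.
exact: cyclic_fun c2 c2' erefl erefl.
Qed.

(** [M] is rotated until its target is the source [a] of the flexible face. *)
Lemma vcomp_layer_ex {C : partial_2precategory} {x y x' y' : ob C}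
    {s p q : seq1 C x y} (M : shom2 s p) (l : seq1 C x x')
    (a b : seq1 C x' y') (A : shom2 a b) (r : seq1 C y' y) h e e' :
  flexible A -> nonempty a ->
  exists M' : shom2 s q, vcomp_layer M (Layer l A r h e e' : layer p q) M'.
Proof.
move=> fA ha; subst p q.
have [N hN] : exists N : shom2 (l^T ## s ## r^T) a,
    cyclic (s ## r^T ## a^T) (l^T) M N by apply: cyclic_ex; pathq.
have hNA : scomp2 N A by apply: (proj1 fA) _ ha; apply: cyclic_refl.
have [M' hM'] : exists M' : shom2 s (l ## b ## r),
    cyclic (l^T) (s ## r^T ## b^T) (sv2 hNA) M' by apply: cyclic_ex; pathq.
by exists M', N, hNA.
Qed.

Lemma layer_vcomp_ex {C : partial_2precategory} {x y x' y' : ob C}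
    {s p q : seq1 C x y} (M : shom2 q s) (l : seq1 C x x')
    (a b : seq1 C x' y') (A : shom2 a b) (r : seq1 C y' y) h e e' :
  flexible A -> nonempty b ->
  exists M' : shom2 p s, layer_vcomp (Layer l A r h e e' : layer p q) M M'.
Proof.
move=> fA hb; subst p q.
have [N hN] : exists N : shom2 b (l^T ## s ## r^T),
    cyclic l (b ## r ## s^T) M N by apply: cyclic_ex; pathq.
have hAN : scomp2 A N by apply: (proj2 fA) _ hb; apply: cyclic_refl.
have [M' hM'] : exists M' : shom2 (l ## a ## r) s,
    cyclic (a ## r ## s^T) l (sv2 hAN) M' by apply: cyclic_ex; pathq.
by exists M', N, hAN.
Qed.

(** The case of [merge_lower] in which the lower face spans the whole sequence. *)
Lemma vcomp_layer_merge {C : partial_2precategory} {x y : ob C}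
    {s p q : seq1 C x y} {M : shom2 s p} {L : layer p q} {M' : shom2 s q}
    (hM : polygon s p) (hM' : polygon s q) :
  vcomp_layer M L M' ->
  mergeable (vcat (face M hM) (dcons L (dempty q))) (face M' hM').
Proof.
case: L => x' y' l a b A r h e e' [N [hN [c1 c2]]].
apply/closure_step/step_merge; subst p q.
unshelve eapply (merge_eq (@merge_lower C x y _ _ _ x y x' y'
  (pnil x) l a b r s (pnil y) M A M' N (sv2 hN) hM h hM' _ _ _ _ _ _ c1 _ c2));
  first [layerq|pathq|by left; exists hN].
Qed.

(** The case of [merge_upper] in which the upper face spans the whole sequence. *)
Lemma layer_vcomp_merge {C : partial_2precategory} {x y : ob C}
    {s p q : seq1 C x y} {M : shom2 q s} {L : layer p q} {M' : shom2 p s}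
    (hM : polygon q s) (hM' : polygon p s) :
  layer_vcomp L M M' -> mergeable (dcons L (face M hM)) (face M' hM').
Proof.
case: L => x' y' l a b A r h e e' [N [hN [c1 c2]]].
apply/closure_step/step_merge; subst p q.
unshelve eapply (merge_eq (@merge_upper C x y _ _ _ x y x' y'
  (pnil x) l a b r s (pnil y) A M M' N (sv2 hN) h hM hM' _ _ _ _ _ _ c1 _ c2));
  first [layerq|pathq|by left; exists hN].
Qed.

Lemma idlayer_form {C : partial_2precategory} {x y : ob C} {p q : seq1 C x y}
    (s : idstep p q) :
  exists x' y' (l : seq1 C x x') (a b : seq1 C x' y') (A : shom2 a b) r h e e',
    [/\ idlayer s = Layer l A r h e e', flexible A, nonempty a & nonempty b].
Proof.
case: s => -[x' m y' l a b h r e e'].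
- exists x', y', l, (ptwo a b), (pone (sh1 h)), (ident h), r, (or_introl I), e, e'.
  by split=> //; apply: flexible_ident.
- exists x', y', l, (pone (sh1 h)), (ptwo a b), (tr2 (ident h)), r,
    (or_introl I), e', e.
  by split=> //; apply/flexible_tr2/flexible_ident.
Qed.

Lemma idstep_nonempty {C : partial_2precategory} {x y : ob C}
    {p q : seq1 C x y} (s : idstep p q) : nonempty p /\ nonempty q.
Proof.
have [x' [y' [l [a [b [A [r [h [e [e' [_ _ ha hb]]]]]]]]]]] := idlayer_form s.
by subst p q; split; apply: nonempty_mid.
Qed.

Lemma idseq_nonempty {C : partial_2precategory} {x y : ob C}
    {p q : seq1 C x y} (S : idseq p q) : nonempty p -> nonempty q.
Proof. by elim: S => // {}p {}q r /idstep_nonempty[_ h] _ IH _; apply: IH. Qed.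

(** [vcomp_diag] by recursion on the diagram, so that it can be inverted. *)
Fixpoint vcomp_rec {C : partial_2precategory} {x y : ob C} {s p q : seq1 C x y}
    (D : diag p q) : shom2 s p -> shom2 s q -> Prop :=
  match D in diag p q return shom2 s p -> shom2 s q -> Prop with
  | dempty _ => fun M M' => M = M'
  | dcons L D' => fun M M' => exists N, vcomp_layer M L N /\ vcomp_rec D' N M'
  end.

Lemma vcomp_diag_rec {C : partial_2precategory} {x y : ob C}
    {s p q : seq1 C x y} (M : shom2 s p) (D : diag p q) (M' : shom2 s q) :
  vcomp_diag M D M' -> vcomp_rec D M M'.
Proof. by elim=> //= {}p {}q r L {}D {}M {}M' N h _ IH; exists M'. Qed.

(** [diag_vcomp] by recursion on the diagram, so that it can be inverted. *)
Fixpoint rec_vcomp {C : partial_2precategory} {x y : ob C} {s p q : seq1 C x y}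
    (D : diag p q) : shom2 q s -> shom2 p s -> Prop :=
  match D in diag p q return shom2 q s -> shom2 p s -> Prop with
  | dempty _ => fun M M' => M = M'
  | dcons L D' => fun M M' => exists N, rec_vcomp D' M N /\ layer_vcomp L N M'
  end.

Lemma diag_vcomp_rec {C : partial_2precategory} {x y : ob C}
    {s p q : seq1 C x y} (M : shom2 q s) (D : diag p q) (M' : shom2 p s) :
  diag_vcomp D M M' -> rec_vcomp D M M'.
Proof. by elim=> //= {}p {}q r L {}D {}M {}M' N _ IH h; exists M'. Qed.

Lemma polygon_l {C : partial_2precategory} {x y : ob C} {p q : seq1 C x y} :
  nonempty p -> polygon p q.
Proof. by left. Qed.

Lemma polygon_r {C : partial_2precategory} {x y : ob C} {p q : seq1 C x y} :
  nonempty q -> polygon p q.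
Proof. by right. Qed.

Lemma vcomp_rec_merge {C : partial_2precategory} {x y : ob C}
    {s p q : seq1 C x y} (S : idseq p q) (M : shom2 s p) (M' : shom2 s q) hM hM' :
  vcomp_rec (iddiag S) M M' ->
  mergeable (vcat (face M hM) (iddiag S)) (face M' hM').
Proof.
elim: S M hM M' hM' => [r|p' q' r st S IH] M hM M' hM' /=.
  by move=> <-; rewrite (proof_irrelevance _ hM hM'); apply: closure_refl.
move=> [N [h1 h2]].
have hN : polygon s q' by apply/polygon_r; case: (idstep_nonempty st).
apply: closure_trans (IH N hN M' hM' h2).
exact: (mergeable_vcat (vcomp_layer_merge hM hN h1) (closure_refl _ _)).
Qed.

Lemma rec_vcomp_merge {C : partial_2precategory} {x y : ob C}
    {s p q : seq1 C x y} (S : idseq p q) (M : shom2 q s) (M' : shom2 p s) hM hM' :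
  rec_vcomp (iddiag S) M M' ->
  mergeable (vcat (iddiag S) (face M hM)) (face M' hM').
Proof.
elim: S M hM M' hM' => [r|p' q' r st S IH] M hM M' hM' /=.
  by move=> <-; rewrite (proof_irrelevance _ hM hM'); apply: closure_refl.
move=> [N [h1 h2]].
have hN : polygon q' s by apply/polygon_l; case: (idstep_nonempty st).
apply: closure_trans (layer_vcomp_merge hN hM' h2).
exact: closure_cons (IH M hM N hN h1).
Qed.

Lemma vcomp_rec_ex {C : partial_2precategory} {x y : ob C}
    {s p q : seq1 C x y} (S : idseq p q) (M : shom2 s p) :
  exists M' : shom2 s q, vcomp_rec (iddiag S) M M'.
Proof.
elim: S M => [r|p' q' r st S IH] M /=; first by exists M.
have [x' [y' [l [a [b [A [u [h [e [e' [-> fA ha _]]]]]]]]]]] := idlayer_form st.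
have [N hN] := vcomp_layer_ex M h e e' fA ha.
by have [M' hM'] := IH N; exists M', N.
Qed.

Lemma rec_vcomp_ex {C : partial_2precategory} {x y : ob C}
    {s p q : seq1 C x y} (S : idseq p q) (M : shom2 q s) :
  exists M' : shom2 p s, rec_vcomp (iddiag S) M M'.
Proof.
elim: S M => [r|p' q' r st S IH] M /=; first by exists M.
have [N hN] := IH M.
have [x' [y' [l [a [b [A [u [h [e [e' [-> fA _ hb]]]]]]]]]]] := idlayer_form st.
by have [M' hM'] := layer_vcomp_ex N h e e' fA hb; exists M', N.
Qed.

(** Each identification 2-morphism that follows rests with its whole source on the
target of the face reached so far, so the two are glued. *)
Lemma absorbr {C : partial_2precategory} {x y : ob C}
    {s p q : seq1 C x y} (S : idseq p q) (M : shom2 s p) hM :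
  nonempty p ->
  exists (M' : shom2 s q) hM', diag_eq (vcat (face M hM) (iddiag S)) (face M' hM').
Proof.
move=> hp; have [M' h] := vcomp_rec_ex S M.
exists M', (polygon_r (idseq_nonempty S hp)).
exact/mergeable_diag_eq/vcomp_rec_merge.
Qed.

Lemma absorbl {C : partial_2precategory} {x y : ob C}
    {s p q : seq1 C x y} (S : idseq p q) (M : shom2 q s) hM :
  nonempty p ->
  exists (M' : shom2 p s) hM', diag_eq (vcat (iddiag S) (face M hM)) (face M' hM').
Proof.
move=> hp; have [M' h] := rec_vcomp_ex S M.
exists M', (polygon_l hp).
exact/mergeable_diag_eq/rec_vcomp_merge.
Qed.

(** For a closed sequence the Diagram axiom says that the resulting face is [M]. *)
Lemma absorb_loopr {C : partial_2category} {x y : ob C}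
    {s p : seq1 C x y} (S : idseq p p) (M : shom2 s p) hM :
  mergeable (vcat (face M hM) (iddiag S)) (face M hM).
Proof. exact/vcomp_rec_merge/vcomp_diag_rec/diagram_axiomr. Qed.

Lemma absorb_loopl {C : partial_2category} {x y : ob C}
    {s p : seq1 C x y} (S : idseq p p) (M : shom2 p s) hM :
  mergeable (vcat (iddiag S) (face M hM)) (face M hM).
Proof. exact/rec_vcomp_merge/diag_vcomp_rec/diagram_axioml. Qed.

(** By the Diagram axiom the loop, hence the face into which it merges, composes
trivially with every face along [p]; it is then removed as an identity. *)
Lemma loop_face {C : partial_2category} {x y : ob C} {p : seq1 C x y}
    (S : idseq p p) (J : shom2 p p) hJ :
  mergeable (iddiag S) (face J hJ) -> diag_eq (face J hJ) (dempty p).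
Proof.
move=> h; apply/closure_step/step_identity.
split=> q L hM hL; rewrite (proof_irrelevance _ hM hJ).
- apply: closure_trans (absorb_loopl S L hL).
  exact: mergeable_vcat (closure_sym h) (closure_refl _ _).
- apply: closure_trans (absorb_loopr S L hL).
  exact: mergeable_vcat (closure_refl _ _) (closure_sym h).
Qed.

(** The Diagram axiom is about faces along a whole sequence; on a solid sequence
the empty diagram is equal to such a face. *)
Definition solid {C : partial_2precategory} {x y : ob C} (p : seq1 C x y) : Prop :=
  nonempty p /\
  exists (J : shom2 p p) (h : polygon p p), diag_eq (face J h) (dempty p).

(** An identification 2-morphism and its adjoint glue to one face, and together
they form a closed sequence to which [loop_face] applies. *)
Lemma loop_back {C : partial_2category} {x y z : ob C}
    {a : shom1 x y} {b : shom1 y z} (h : scomp1 a b) :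
  (solid (ptwo a b) /\
   diag_eq (vcat (face (ident h) (or_introl I)) (face (tr2 (ident h)) (or_introl I)))
           (dempty (ptwo a b))) /\
  (solid (pone (sh1 h)) /\
   diag_eq (vcat (face (tr2 (ident h)) (or_introl I)) (face (ident h) (or_introl I)))
           (dempty (pone (sh1 h)))).
Proof.
pose c1 := @Composition C x z (ptwo a b) (pone (sh1 h)) x y z
  (pnil x) a b h (pnil z) (esym (papp_nil _)) (esym (papp_nil _)).
split.
- pose S := icons (Compose c1) (icons (Decompose c1) (inil _)).
  have [J hJ] := vcomp_rec_ex (icons (Decompose c1) (inil _)) (ident h).
  have hp : polygon (ptwo a b) (ptwo a b) by left.
  have e : mergeable (iddiag S) (face J hp) := 
    @vcomp_rec_merge C x z _ _ _ _ (ident h) J (or_introl I) hp hJ.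
  have e' := loop_face e.
  split; first by split=> //; exists J, hp.
  exact: diag_eq_trans (mergeable_diag_eq e) e'.
- pose S := icons (Decompose c1) (icons (Compose c1) (inil _)).
  have [J hJ] := vcomp_rec_ex (icons (Compose c1) (inil _)) (tr2 (ident h)).
  have hp : polygon (pone (sh1 h)) (pone (sh1 h)) by left.
  have e : mergeable (iddiag S) (face J hp) := 
    @vcomp_rec_merge C x z _ _ _ _ (tr2 (ident h)) J (or_introl I) hp hJ.
  have e' := loop_face e.
  split; first by split=> //; exists J, hp.
  exact: diag_eq_trans (mergeable_diag_eq e) e'.
Qed.

Lemma stepinvr {C : partial_2category} {x y : ob C} {p q : seq1 C x y}
    (s : idstep p q) :
  diag_eq (dcons (idlayer s) (dcons (idlayer (stepinv s)) (dempty p))) (dempty p).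
Proof.
case: s => -[x' m y' l a b h r e e'] /=.
- have [[_ k] _] := loop_back h.
  have := emb_eq e e k; rewrite emb_dempty (emb_vcat _ _ e e e').
  by rewrite !emb_face.
- have [_ [_ k]] := loop_back h.
  have := emb_eq e' e' k; rewrite emb_dempty (emb_vcat _ _ e' e' e).
  by rewrite !emb_face.
Qed.

Lemma stepinvK {C : partial_2precategory} {x y : ob C} {p q : seq1 C x y}
    (s : idstep p q) : stepinv (stepinv s) = s.
Proof. by case: s. Qed.

Lemma idinvr {C : partial_2category} {x y : ob C} {p q : seq1 C x y}
    (S : idseq p q) :
  diag_eq (vcat (iddiag S) (iddiag (idinv S))) (dempty p).
Proof.
elim: S => [r|p' q' r s S IH] //=.
rewrite iddiag_cat -vcat_assoc.
apply: diag_eq_trans (stepinvr s).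
apply: closure_cons.
exact: (diag_eq_vcat IH (diag_eq_refl _)).
Qed.

Lemma idinvl {C : partial_2category} {x y : ob C} {p q : seq1 C x y}
    (S : idseq p q) :
  diag_eq (vcat (iddiag (idinv S)) (iddiag S)) (dempty q).
Proof.
elim: S => [r|p' q' r s S IH] //=.
rewrite iddiag_cat vcat_assoc /=.
apply: diag_eq_trans IH; apply: diag_eq_vcat => //.
have := stepinvr (stepinv s); rewrite stepinvK => h.
exact: (diag_eq_vcat h (diag_eq_refl (iddiag S))).
Qed.

(** The face [J] can be put in front of the loop, and absorbs it. *)
Lemma solid_loop {C : partial_2category} {x y : ob C} {p : seq1 C x y}
    (S : idseq p p) : solid p -> diag_eq (iddiag S) (dempty p).
Proof.
move=> [_ [J [hJ h]]].
apply: (diag_eq_trans _ h).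
apply: (diag_eq_trans _ (mergeable_diag_eq (absorb_loopr S J hJ))).
exact: (diag_eq_vcat (diag_eq_sym h) (diag_eq_refl (iddiag S))).
Qed.

(** [S] and its inverse are put around [J], which absorbs both. *)
Lemma solid_idseq {C : partial_2category} {x y : ob C} {p q : seq1 C x y}
    (S : idseq p q) : solid p -> solid q.
Proof.
move=> [hp [J [hJ h]]]; have hq := idseq_nonempty S hp.
have [M [hM e]] := absorbr S J hJ hp.
have [M' [hM' e']] := absorbl (idinv S) M hM hq.
split=> //; exists M', hM'.
apply: diag_eq_trans (diag_eq_sym e') _.
apply: diag_eq_trans (idinvl S).
apply: diag_eq_vcat => //; apply: diag_eq_trans (diag_eq_sym e) _.
exact: (diag_eq_vcat h (diag_eq_refl (iddiag S))).
Qed.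

(** ** Merging across a common side *)

(** Composability is needed only along the common part [c], and one flexible face
is enough for it. Here the lower face lies on the left. *)
Lemma merge_left_ex {C : partial_2precategory} {x y z t : ob C}
    (l : seq1 C x y) (c : seq1 C y z) (s : seq1 C z t)
    (a : seq1 C x z) (b : seq1 C y t)
    (A : shom2 a (l ## c)) (B : shom2 (c ## s) b) :
  flexible A \/ flexible B -> nonempty c ->
  exists (M : shom2 (a ## s) (l ## b)),
    forall (x0 y0 : ob C) (p m q q' : seq1 C x0 y0) (k : seq1 C x0 x)
      (w : seq1 C t y0) (D : diag q q') hA hB hM e1 e2 e3 e4 f1 f2,
    diag_eq (dcons (Layer k A (s ## w) hA e1 e2 : layer p m)
              (dcons (Layer (k ## l) B w hB e3 e4 : layer m q) D))
            (dcons (Layer k M w hM f1 f2) D).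
Proof.
move=> hf hc.
have [A' cA] : exists A' : shom2 (l^T ## a) c, cyclic (a ## c^T) (l^T) A A'.
  by apply: cyclic_ex; pathq.
have [B' cB] : exists B' : shom2 c (b ## s^T), cyclic (pnil y) (c ## s ## b^T) B B'.
  by apply: cyclic_ex; pathq.
have hf' : flexible A' \/ flexible B'.
  by case: hf => hf; [left; apply: flexible_cyclic cA hf|right; apply: flexible_cyclic cB hf].
have [h g] := flexible_glue hf' hc.
have [M cM] : exists M : shom2 (a ## s) (l ## b),
    cyclic (l^T) (a ## s ## b^T) (sv2 h) M.
  by apply: cyclic_ex; pathq.
exists M => *; apply/closure_step/step_merge_step/step_merge.
exact: merge_left cA cB g cM.
Qed.

(** As [merge_left_ex], with the lower face on the right. *)
Lemma merge_right_ex {C : partial_2precategory} {x y z t : ob C}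
    (l : seq1 C x y) (c : seq1 C y z) (s : seq1 C z t)
    (a : seq1 C y t) (b : seq1 C x z)
    (A : shom2 a (c ## s)) (B : shom2 (l ## c) b) :
  flexible A \/ flexible B -> nonempty c ->
  exists (M : shom2 (l ## a) (b ## s)),
    forall (x0 y0 : ob C) (p m q q' : seq1 C x0 y0) (k : seq1 C x0 x)
      (w : seq1 C t y0) (D : diag q q') hA hB hM e1 e2 e3 e4 f1 f2,
    diag_eq (dcons (Layer (k ## l) A w hA e1 e2 : layer p m)
              (dcons (Layer k B (s ## w) hB e3 e4 : layer m q) D))
            (dcons (Layer k M w hM f1 f2) D).
Proof.
move=> hf hc.
have [A' cA] : exists A' : shom2 (a ## s^T) c, cyclic (pnil y) (a ## s^T ## c^T) A A'.
  by apply: cyclic_ex; pathq.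
have [B' cB] : exists B' : shom2 c (l^T ## b), cyclic l (c ## b^T) B B'.
  by apply: cyclic_ex; pathq.
have hf' : flexible A' \/ flexible B'.
  by case: hf => hf; [left; apply: flexible_cyclic cA hf|right; apply: flexible_cyclic cB hf].
have [h g] := flexible_glue hf' hc.
have [M cM] : exists M : shom2 (l ## a) (b ## s),
    cyclic (a ## s^T ## b^T) l (sv2 h) M.
  by apply: cyclic_ex; pathq.
exists M => *; apply/closure_step/step_merge_step/step_merge.
exact: merge_right cA cB g cM.
Qed.

(** * Closed sequences of identifications are trivial *)

Lemma face_local {C : partial_2precategory} {x y x' y' : ob C}
    {p q : seq1 C x y} (l : seq1 C x x') (a : seq1 C x' y') (J : shom2 a a) h
    (r : seq1 C y' y) (e e' : p = l ## a ## r) (D : diag p q) :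
  diag_eq (face J h) (dempty a) -> diag_eq (dcons (Layer l J r h e e') D) D.
Proof.
move/(emb_eq e e'); rewrite emb_face emb_dempty => k.
exact: (diag_eq_vcat k (diag_eq_refl D)).
Qed.

Lemma step_compose {C : partial_2precategory} {x y x' m y' : ob C}
    (l : seq1 C x x') (a : shom1 x' m) (b : shom1 m y') (h : scomp1 a b)
    (r : seq1 C y' y) (p q : seq1 C x y) :
  p = l ## ptwo a b ## r -> q = l ## pone (sh1 h) ## r -> inhabited (idseq p q).
Proof.
by move=> e e'; split; apply: icons (Compose (Composition l h r e e')) (inil _).
Qed.

Lemma step_decompose {C : partial_2precategory} {x y x' m y' : ob C}
    (l : seq1 C x x') (a : shom1 x' m) (b : shom1 m y') (h : scomp1 a b)
    (r : seq1 C y' y) (p q : seq1 C x y) :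
  p = l ## pone (sh1 h) ## r -> q = l ## ptwo a b ## r -> inhabited (idseq p q).
Proof.
by move=> e e'; split; apply: icons (Decompose (Composition l h r e' e)) (inil _).
Qed.

(** The face on [u ## pone f] and the triangle of [f] and [g] share the side [f], so
they merge into a face whose source is the whole sequence; the adjoint triangle
leads back to that sequence. *)
Lemma solid_extend {C : partial_2category} {x y z t : ob C}
    (u : seq1 C x y) (f : shom1 y z) (g : shom1 z t) :
  scomp1 f g -> solid (u ## pone f) -> solid ((u ## pone f) ## pone g).
Proof.
move=> h [hu [J [hJ eJ]]]; set p := (u ## pone f) ## pone g.
have [M hM] := @merge_left_ex C x y z t u (pone f) (pone g) (u ## pone f)
  (pone (sh1 h)) J (ident h) (or_intror (flexible_ident h)) I.
have np : nonempty p by apply: nonempty_appr.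
have pM : polygon p (u ## pone (sh1 h)) by left.
have e0 : p = u ## ptwo f g ## pnil t by rewrite /p; pathq.
have e1 : u ## pone (sh1 h) = u ## pone (sh1 h) ## pnil t by pathq.
pose s := Decompose (Composition u h (pnil t) e0 e1).
have [J' [hJ' eJ']] := absorbr (icons s (inil _)) M pM (nonempty_appr _ (I : nonempty (pone (sh1 h)))).
split=> //; exists J', hJ'; apply: diag_eq_trans (diag_eq_sym eJ') _.
have f1 : p = pnil x ## p ## pnil t by pathq.
have e2 : p = pnil x ## (u ## pone f) ## pone g ## pnil t by rewrite /p; pathq.
have e3 : p = (pnil x ## u) ## (pone f ## pone g) ## pnil t by rewrite /p; pathq.
have e4 : u ## pone (sh1 h) = (pnil x ## u) ## pone (sh1 h) ## pnil t by pathq.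
have f2 : u ## pone (sh1 h) = pnil x ## (u ## pone (sh1 h)) ## pnil t by pathq.
apply: diag_eq_trans (stepinvr (Compose (Composition u h (pnil t) e0 e1))).
have := hM x t p p _ p (pnil x) (pnil t) (iddiag (icons s (inil _))) hJ
  (or_introl I) pM e2 e2 e3 e4 f1 f2 => k.
have -> : vcat (face M pM) (iddiag (icons s (inil p))) =
    dcons (Layer (pnil x) M (pnil t) pM f1 f2) (iddiag (icons s (inil p))).
  by congr dcons; apply: layer_ext.
apply: diag_eq_trans (diag_eq_sym k) _.
apply: diag_eq_trans (face_local _ _ _ eJ) _.
have -> : Layer (pnil x ## u) (ident h) (pnil t) (or_introl I) e3 e4 =
   Layer u (ident h) (pnil t) (or_introl I) e0 e1 by apply: layer_ext.
exact: diag_eq_refl.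
Qed.

(** A single 1-morphism that is not a composite may carry no face, but no step
starts from it either, so it is as good as a solid sequence. *)
Definition prefixable {C : partial_2precategory} {x y : ob C} (p : seq1 C x y) : Prop :=
  solid p \/ exists f : shom1 x y, p = pone f.

Lemma prefixable_nonempty {C : partial_2precategory} {x y : ob C} (p : seq1 C x y) :
  prefixable p -> nonempty p.
Proof. by case=> [[]|[f ->]]. Qed.

Lemma plen0 {O : Type} {E : O -> O -> Type} {x y : O} (p : path E x y) :
  plen p = 0 -> exists e : x = y, p = eq_rect x (path E x) (pnil x) y e.
Proof. by case: (path_case p) => // -[m [e [p' ->]]]. Qed.

Lemma plen_gt0 {O : Type} {E : O -> O -> Type} {x y : O} (p : path E x y) :
  nonempty p -> 0 < plen p.
Proof. by case: p => //= *; lia. Qed.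

Lemma solid_composite {C : partial_2category} {x y : ob C} (f : shom1 x y)
    (q : seq1 C x y) (s : idstep (pone f) q) : solid (pone f).
Proof.
case: s => -[x' m y' l a b h r e e'].
  by move: (f_equal plen e); rewrite !plen_app /=; lia.
have [el er] : plen l = 0 /\ plen r = 0.
  by move: (f_equal plen e'); rewrite !plen_app /=; lia.
have [ex ?] := plen0 el; have [ey ?] := plen0 er; subst x' y' l r.
by rewrite e' /=; case: (loop_back h) => _ [].
Qed.

Lemma idseq_single {C : partial_2category} {x y : ob C} (f : shom1 x y)
    (p q : seq1 C x y) (S : idseq p q) :
  p = pone f ->
  solid p \/ exists e : p = q, iddiag S = eq_rect p (diag p) (dempty p) q e.
Proof.
case: S => [r _|p' q' r s S ep]; first by right; exists erefl.
by subst p'; left; apply: solid_composite s.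
Qed.

Lemma prefixable_idseq {C : partial_2category} {x y : ob C} (p q : seq1 C x y)
    (S : idseq p q) : prefixable p -> prefixable q.
Proof.
case=> [h|[f ef]]; first by left; apply: solid_idseq S h.
case: (idseq_single S ef) => [h|[e _]]; first by left; apply: solid_idseq S h.
by right; exists f; rewrite -e.
Qed.

Lemma prefixable_loop {C : partial_2category} {x y : ob C} (p : seq1 C x y)
    (S : idseq p p) : prefixable p -> diag_eq (iddiag S) (dempty p).
Proof.
case=> [h|[f ef]]; first exact: solid_loop.
case: (idseq_single S ef) => [h|[e ->]]; first exact: solid_loop.
by rewrite (proof_irrelevance _ e erefl).
Qed.

(** For a single [f] the triangle of [f] and [g] itself is the required face. *)
Lemma prefixable_extend {C : partial_2category} {x y z t : ob C}
    (u : seq1 C x y) (f : shom1 y z) (g : shom1 z t) :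
  scomp1 f g -> prefixable (u ## pone f) -> prefixable ((u ## pone f) ## pone g).
Proof.
move=> h [hs|[f' ef]]; first by left; apply: solid_extend.
have l0 : plen u = 0 by move: (f_equal plen ef); rewrite plen_app /=; lia.
have [ex ?] := plen0 l0; subst y u.
by left; case: (loop_back h) => -[].
Qed.

(** Suppose that a beginning of [w] can be joined to [u]. A step inside this
beginning or after it does no harm, and a step across its end is a composition,
which extends it by [prefixable_extend]. *)
Lemma propagate {C : partial_2category} {x y z : ob C} (u : seq1 C x y)
    (w v : seq1 C y z) (S : idseq w v) :
  (exists t (w1 : seq1 C y t) w2,
     [/\ w = w1 ## w2, nonempty w1 & prefixable (u ## w1)]) ->
  exists t (v1 : seq1 C y t) v2,
     [/\ v = v1 ## v2, nonempty v1 & prefixable (u ## v1)].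
Proof.
elim: S => // {}w w' {}v s _ IH [t [w1 [w2 [ew n1 hs]]]]; apply: IH.
case: s => -[x' m y' l a b h r e e'].
- have := e; rewrite ew => /esym/cut_cases[|[c [ew1 ew2]]|].
  + move=> [c [ew1 ew2]]; exists t, (l ## pone (sh1 h) ## c), w2.
    split; [by rewrite e' ew2; pathq|exact: nonempty_mid|].
    have [T] : inhabited (idseq (u ## w1) (u ## l ## pone (sh1 h) ## c)).
      by apply: (@step_compose C x t x' m y' (u ## l) a b h c); pathq.
    exact: prefixable_idseq T hs.
  + by exists t, w1, (c ## pone (sh1 h) ## r); split=> //; rewrite e'; pathq.
  + move=> [s1 [s2 [k1 k2 es ew1 ew2]]].
    have [em [es1 es2]] := ptwo_split es k1 k2; subst t => /=.
    exists y', (l ## pone (sh1 h)), r; split; first by rewrite e'; pathq.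
      exact: nonempty_appr.
    have hs' : prefixable (((u ## l) ## pone a) ## pone b).
      apply: prefixable_extend => //; rewrite papp_assoc.
      by move: hs; rewrite ew1 es1.
    have [T] : inhabited (idseq (((u ## l) ## pone a) ## pone b)
                                (u ## l ## pone (sh1 h))).
      by apply: (@step_compose C x y' x' m y' (u ## l) a b h (pnil y')); pathq.
    exact: prefixable_idseq T hs'.
- have := e'; rewrite ew => /esym/cut_cases[|[c [ew1 ew2]]|].
  + move=> [c [ew1 ew2]]; exists t, (l ## ptwo a b ## c), w2.
    split; [by rewrite e ew2; pathq|exact: nonempty_mid|].
    have [T] : inhabited (idseq (u ## w1) (u ## l ## ptwo a b ## c)).
      by apply: (@step_decompose C x t x' m y' (u ## l) a b h c); pathq.
    exact: prefixable_idseq T hs.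
  + by exists t, w1, (c ## ptwo a b ## r); split=> //; rewrite e; pathq.
  + by move=> [s1 [s2 [k1 k2 es _ _]]]; case: (pone_split es k1 k2).
Qed.

(** [u] is a maximal prefixable part of [u ## v]. *)
Definition stuck {C : partial_2precategory} {x y z : ob C} (u : seq1 C x y)
    (v : seq1 C y z) : Prop :=
  prefixable u /\
  ~ exists t (v1 : seq1 C y t) v2,
      [/\ v = v1 ## v2, nonempty v1 & prefixable (u ## v1)].

Lemma stuck_ex {C : partial_2precategory} {x y : ob C} (p : seq1 C x y) :
  nonempty p -> exists z (u : seq1 C x z) v, p = u ## v /\ stuck u v.
Proof.
move=> /cons_case[z [f [p' ->]]].
have hf : prefixable (pone f) by right; exists f.
move: (pone f) hf => {f} u; have [n] : exists n, plen p' < n by exists (S (plen p')).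
elim: n z p' u => [|n IH] z v u hn hu; first by lia.
case: (classic (stuck u v)) => [h|h]; first by exists z, u, v.
have [t [v1 [v2 [ev n1 h1]]]] : exists t (v1 : seq1 C z t) v2,
    [/\ v = v1 ## v2, nonempty v1 & prefixable (u ## v1)].
  by apply: NNPP => k; apply: h.
have [||t' [u' [v' [e h']]]] := IH t v2 (u ## v1) => //.
  by move/plen_gt0: n1 hn; rewrite ev plen_app; lia.
by exists t', u', v'; rewrite ev -e papp_assoc.
Qed.

Lemma idseq_embed {C : partial_2precategory} {x y x' y' : ob C}
    {a b : seq1 C x' y'} (l : seq1 C x x') (S : idseq a b) (r : seq1 C y' y)
    (p q : seq1 C x y) :
  p = l ## a ## r -> q = l ## b ## r -> inhabited (idseq p q).
Proof. by move=> e e'; have [T _] := idemb S e e'; split. Qed.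

Lemma stuck_idseq {C : partial_2category} {x y z : ob C} (u u' : seq1 C x y)
    (v v' : seq1 C y z) (S : idseq u u') (T : idseq v v') :
  stuck u v -> stuck u' v'.
Proof.
move=> [hu hv]; split; first exact: prefixable_idseq S hu.
move=> [t [v1 [v2 [ev n1 h1]]]]; apply/hv/(propagate (idinv T)).
exists t, v1, v2; split=> //.
have [T'] : inhabited (idseq (u' ## v1) (u ## v1)).
  by apply: (idseq_embed (l := pnil x) (r := v1) (idinv S)).
exact: prefixable_idseq T' h1.
Qed.

Lemma emb_interchange {C : partial_2precategory} {x y z : ob C}
    {p q : seq1 C x y} {p' q' : seq1 C y z} (D : diag p q) (D' : diag p' q')
    {a b c d : seq1 C x z} e1 e2 e3 e4 f1 f2 f3 f4 :
  diag_eq (vcat (emb (pnil x) D p' e1 e2 : diag a b)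
                (emb q D' (pnil z) e3 e4 : diag b c))
          (vcat (emb p D' (pnil z) f1 f2 : diag a d)
                (emb (pnil x) D q' f3 f4 : diag d c)).
Proof.
have i1 : a = p ## p' by pathq.
have i2 : b = q ## p' by pathq.
have i3 : c = q ## q' by move: e4; rewrite papp_nil.
have i4 : d = p ## q' by pathq.
move: e1 e2 e3 e4 f1 f2 f3 f4; subst a b c d => e1 e2 e3 e4 f1 f2 f3 f4.
have := diag_interchange D D'.
rewrite (whiskerr_emb D e1 e2) (whiskerr_emb D f3 f4).
by rewrite (whiskerl_emb D' e3 e4) (whiskerl_emb D' f1 f2).
Qed.

Lemma stuck_step {C : partial_2category} {x y z : ob C} (p p' : seq1 C x y)
    (s : idstep p p') (u : seq1 C x z) (v : seq1 C z y) :
  p = u ## v -> stuck u v ->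
  (exists u1 (s1 : idstep u u1), p' = u1 ## v /\
     forall e1 e2 q (E : diag p' q), dcons (idlayer s) E =
       vcat (emb (pnil x) (dcons (idlayer s1) (dempty u1)) v e1 e2) E) \/
  (exists v1 (s1 : idstep v v1), p' = u ## v1 /\
     forall e1 e2 q (E : diag p' q), dcons (idlayer s) E =
       vcat (emb u (dcons (idlayer s1) (dempty v1)) (pnil y) e1 e2) E).
Proof.
case: s => -[x' m y' l a b h r e e'] ep [hu hv].
- have := etrans (esym e) ep => /cut_cases[|[c [eu ev]]|].
  + move=> [c [eu er]]; left.
    exists (l ## pone (sh1 h) ## c), (Compose (Composition l h c eu erefl)).
    split=> [|e1 e2 q E]; first by rewrite e' er; pathq.
    rewrite /=; unshelve erewrite (@emb_layer _ _ _ _ _ _ _ _ _ _ p p' p'); try pathq.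
    by rewrite emb_dempty /=; congr dcons; layerq.
  + right; exists (c ## pone (sh1 h) ## r), (Compose (Composition c h r ev erefl)).
    split=> [|e1 e2 q E]; first by rewrite e' eu; pathq.
    rewrite /=; unshelve erewrite (@emb_layer _ _ _ _ _ _ _ _ _ _ p p' p'); try pathq.
    by rewrite emb_dempty /=; congr dcons; layerq.
  + move=> [s1 [s2 [k1 k2 es eu ev]]]; case: hv.
    have [em [es1 es2]] := ptwo_split es k1 k2; subst z s1 s2.
    exists y', (pone b), r; split=> //; rewrite eu.
    by apply: (prefixable_extend h); rewrite -eu.
- have := etrans (esym e') ep => /cut_cases[|[c [eu ev]]|].
  + move=> [c [eu er]]; left.
    exists (l ## ptwo a b ## c), (Decompose (Composition l h c erefl eu)).
    split=> [|e1 e2 q E]; first by rewrite e er; pathq.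
    rewrite /=; unshelve erewrite (@emb_layer _ _ _ _ _ _ _ _ _ _ p p' p'); try pathq.
    by rewrite emb_dempty /=; congr dcons; layerq.
  + right; exists (c ## ptwo a b ## r), (Decompose (Composition c h r erefl ev)).
    split=> [|e1 e2 q E]; first by rewrite e eu; pathq.
    rewrite /=; unshelve erewrite (@emb_layer _ _ _ _ _ _ _ _ _ _ p p' p'); try pathq.
    by rewrite emb_dempty /=; congr dcons; layerq.
  + by move=> [s1 [s2 [k1 k2 es _ _]]]; case: (pone_split es k1 k2).
Qed.

(** A step across the end of [u] would be a composition and would extend [u]. So
each step takes place on one side, and [emb_interchange] sorts the steps. *)
Lemma stuck_split {C : partial_2category} {x y : ob C} (p q : seq1 C x y)
    (S : idseq p q) (z : ob C) (u : seq1 C x z) (v : seq1 C z y) :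
  p = u ## v -> stuck u v ->
  exists (u' : seq1 C x z) (v' : seq1 C z y) (S1 : idseq u u') (S2 : idseq v v'),
    q = u' ## v' /\
    forall e1 e2 e3 e4,
      diag_eq (iddiag S)
        (vcat (emb (pnil x) (iddiag S1) v e1 e2 : diag p (u' ## v))
              (emb u' (iddiag S2) (pnil y) e3 e4)).
Proof.
elim: S u v => {p q} [p|p p' q s S IH] u v ep hs.
  exists u, v, (inil u), (inil v); split=> // e1 e2 e3 e4 /=.
  subst p; rewrite emb_dempty /=.
  by rewrite (proof_irrelevance _ e4 e3) emb_dempty.
have [[u1 [s1 [ep' k]]]|[v1 [s1 [ep' k]]]] := stuck_step s ep hs.
- have hs' := stuck_idseq (icons s1 (inil _)) (inil v) hs.
  have [u' [v' [S1 [S2 [eq' k']]]]] := IH u1 v ep' hs'.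
  exists u', v', (icons s1 S1), S2; split=> // e1 e2 e3 e4 /=.
  have f1 : p' = pnil x ## u1 ## v by [].
  apply: diag_eq_trans (closure_cons _ (k' f1 e2 e3 e4)) _.
  rewrite (k e1 f1) -vcat_assoc -emb_vcat.
  exact: diag_eq_refl.
- have hs' := stuck_idseq (inil u) (icons s1 (inil _)) hs.
  have [u' [v' [S1 [S2 [eq' k']]]]] := IH u v1 ep' hs'.
  exists u', v', S1, (icons s1 S2); split=> // e1 e2 e3 e4 /=.
  have f1 : p' = pnil x ## u ## v1 by [].
  have f2 : u' ## v1 = pnil x ## u' ## v1 by [].
  have f3 : u' ## v1 = u' ## v1 ## pnil y by rewrite papp_nil.
  have f4 : p' = u ## v1 ## pnil y by rewrite papp_nil.
  have f5 : p = u ## v ## pnil y by rewrite papp_nil.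
  apply: diag_eq_trans (closure_cons _ (k' f1 f2 f3 e4)) _.
  rewrite (k f5 f4) -vcat_assoc.
  rewrite (_ : dcons (idlayer s1) (iddiag S2) =
     vcat (dcons (idlayer s1) (dempty v1)) (iddiag S2)) //.
  rewrite (emb_vcat _ _ e3 e4 f3) -[in X in diag_eq _ X]vcat_assoc.
  apply: diag_eq_vcat => //.
  exact/diag_eq_sym/emb_interchange.
Qed.

Lemma idseq_empty {C : partial_2precategory} {x y : ob C} (p q : seq1 C x y)
    (S : idseq p q) :
  ~ nonempty p -> exists e : p = q, iddiag S = eq_rect p (diag p) (dempty p) q e.
Proof.
by case: S => [r _|p' q' r s S []]; [exists erefl|case: (idstep_nonempty s)].
Qed.

(** The two sides might exchange a piece [c]. If [u] gains it, then [u ## c] is a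
longer prefix. If [u] loses it, then [u] rewrites to [u ## c] and [c ## v] to
[v], and [propagate] turns [c] into a beginning of [v] that is joined to [u]. Both
contradict the maximality of [u]. *)
Lemma stuck_loop {C : partial_2category} {x y z : ob C} (u u' : seq1 C x z)
    (v v' : seq1 C z y) (S1 : idseq u u') (S2 : idseq v v') :
  stuck u v -> u ## v = u' ## v' -> u = u' /\ v = v'.
Proof.
move=> [hu hv] e; case: (levi e) => -[c [eu ev]];
  case: (path_case c) => [[ez ec]|hc].
- by rewrite eu ev ec (proof_irrelevance _ ez erefl) /= papp_nil.
- case: hv; exists z, c, v'; split=> //; first by case: hc => m [? [? ->]].
  by rewrite -eu; apply: prefixable_idseq S1 hu.
- by rewrite eu ev ec (proof_irrelevance _ ez erefl) /= papp_nil.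
- case: hv; apply: (propagate (idinv S2)).
  exists z, c, v; split=> //; first by case: hc => m [? [? ->]].
  have [T] : inhabited (idseq u (u ## c)).
    apply: (idseq_embed (l := pnil x) (r := c) (idinv S1)) => //.
  exact: prefixable_idseq T hu.
Qed.

(** The Diagram axiom needs a face along the whole sequence. A sequence that has
none is cut after a maximal prefix: a loop is then a loop on each side, the
prefix is handled by the axiom and the rest by induction. *)
Lemma loop_trivial {C : partial_2category} {x y : ob C} (p : seq1 C x y)
    (S : idseq p p) : diag_eq (iddiag S) (dempty p).
Proof.
have [n hn] : exists n, plen p < n by exists (Datatypes.S (plen p)).
elim: n x p S hn => [|n IH] x p S hn; first by lia.
case: (classic (nonempty p)) => [hp|/(idseq_empty S)[e ->]]; last first.
  by rewrite (proof_irrelevance _ e erefl).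
have [z [u [v [ep hs]]]] := stuck_ex hp.
have [u' [v' [S1 [S2 [ep' k]]]]] := stuck_split S ep hs.
have [eu ev] := stuck_loop S1 S2 hs (etrans (esym ep) ep').
subst u' v'.
have e1 : p = pnil x ## u ## v by [].
have e2 : u ## v = pnil x ## u ## v by [].
have e3 : u ## v = u ## v ## pnil y by rewrite papp_nil.
have e4 : p = u ## v ## pnil y by rewrite papp_nil.
apply: diag_eq_trans (k e1 e2 e3 e4) _.
have h1 : diag_eq (iddiag S1) (dempty u) by apply: prefixable_loop; case: hs.
have h2 : diag_eq (iddiag S2) (dempty v).
  apply: IH; move: hn; rewrite ep plen_app.
  by have := plen_gt0 (prefixable_nonempty (proj1 hs)); lia.
apply: diag_eq_trans (diag_eq_vcat (emb_eq e1 e2 h1) (emb_eq e3 e4 h2)) _.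
clear; subst p; rewrite emb_dempty.
by rewrite (proof_irrelevance _ e4 e3) emb_dempty.
Qed.

(** One of the two sequences followed by the inverse of the other is a loop. *)
Lemma thin {C : partial_2category} {x y : ob C} {p q : seq1 C x y}
    (S T : idseq p q) : diag_eq (iddiag S) (iddiag T).
Proof.
apply: diag_eq_trans (_ : diag_eq (vcat (iddiag (idcat S (idinv T))) (iddiag T)) _).
  rewrite iddiag_cat vcat_assoc -[X in diag_eq X _]vcat_dempty.
  by apply: diag_eq_vcat => //; apply/diag_eq_sym/idinvl.
exact: (diag_eq_vcat (loop_trivial _) (diag_eq_refl (iddiag T))).
Qed.

(** * Canonical identifications *)

(** Equality of diagrams after identification of their sources and targets by
compositions and decompositions. Reassociation of sequences is a special case, so
this relation also makes casts invisible. *)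
Definition ceq {C : partial_2precategory} {x y : ob C} {p q p' q' : seq1 C x y}
    (D : diag p q) (D' : diag p' q') : Prop :=
  exists (S : idseq p p') (T : idseq q q'),
    diag_eq (vcat (iddiag S) D') (vcat D (iddiag T)).

(** By [thin] the sequences that join sources and targets are immaterial. *)
Lemma ceq_any {C : partial_2category} {x y : ob C} {p q p' q' : seq1 C x y}
    {D : diag p q} {D' : diag p' q'} (S : idseq p p') (T : idseq q q') :
  ceq D D' -> diag_eq (vcat (iddiag S) D') (vcat D (iddiag T)).
Proof.
move=> [S' [T' h]].
apply: diag_eq_trans (diag_eq_vcat (thin S S') (diag_eq_refl D')) _.
apply: diag_eq_trans h _.
exact: diag_eq_vcat (diag_eq_refl D) (thin T' T).
Qed.

Lemma diag_eq_ceq {C : partial_2precategory} {x y : ob C} {p q : seq1 C x y}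
    {D D' : diag p q} : diag_eq D D' -> ceq D D'.
Proof.
move=> h; exists (inil _), (inil _) => /=.
by rewrite vcat_dempty; apply: diag_eq_sym.
Qed.

Lemma ceq_refl {C : partial_2precategory} {x y : ob C} {p q : seq1 C x y}
    (D : diag p q) : ceq D D.
Proof. exact: diag_eq_ceq. Qed.

Lemma ceq_diag_eq {C : partial_2category} {x y : ob C} {p q : seq1 C x y}
    {D D' : diag p q} : ceq D D' -> diag_eq D D'.
Proof.
by move/(ceq_any (inil _) (inil _)) => /=; rewrite vcat_dempty; apply: diag_eq_sym.
Qed.

Lemma ceq_sym {C : partial_2category} {x y : ob C} {p q p' q' : seq1 C x y}
    {D : diag p q} {D' : diag p' q'} : ceq D D' -> ceq D' D.
Proof.
move=> [S [T h]]; exists (idinv S), (idinv T).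
have e1 : diag_eq D (vcat D (vcat (iddiag T) (iddiag (idinv T)))).
  rewrite -[X in diag_eq X _]vcat_dempty.
  by apply: diag_eq_vcat => //; apply/diag_eq_sym/idinvr.
apply: diag_eq_trans (diag_eq_vcat (diag_eq_refl _) e1) _.
rewrite -(vcat_assoc D) -vcat_assoc; apply: diag_eq_vcat => //.
apply: diag_eq_trans (diag_eq_vcat (diag_eq_refl _) (diag_eq_sym h)) _.
rewrite -vcat_assoc.
exact: (diag_eq_vcat (idinvl S) (diag_eq_refl D')).
Qed.

Lemma ceq_trans {C : partial_2precategory} {x y : ob C}
    {p q p' q' p'' q'' : seq1 C x y}
    {D : diag p q} {D' : diag p' q'} {D'' : diag p'' q''} :
  ceq D D' -> ceq D' D'' -> ceq D D''.
Proof.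
move=> [S [T h]] [S' [T' h']]; exists (idcat S S'), (idcat T T').
rewrite !iddiag_cat vcat_assoc.
apply: diag_eq_trans (diag_eq_vcat (diag_eq_refl _) h') _.
rewrite -!vcat_assoc; exact: diag_eq_vcat.
Qed.

Lemma ceq_vcat {C : partial_2category} {x y : ob C}
    {p q r p' q' r' : seq1 C x y} {D : diag p q} {E : diag q r}
    {D' : diag p' q'} {E' : diag q' r'} :
  ceq D D' -> ceq E E' -> ceq (vcat D E) (vcat D' E').
Proof.
move=> [S [T h]] hE; have [_ [U _]] := hE; have hE' := ceq_any T U hE.
exists S, U; rewrite -vcat_assoc.
apply: diag_eq_trans (diag_eq_vcat h (diag_eq_refl _)) _.
rewrite !vcat_assoc.
exact: diag_eq_vcat.
Qed.

Lemma ceq_iddiag {C : partial_2precategory} {x y : ob C} {p q : seq1 C x y}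
    (S : idseq p q) : ceq (iddiag S) (dempty q).
Proof. by exists S, (inil _); rewrite /= !vcat_dempty. Qed.

Lemma ceq_vcat_idl {C : partial_2category} {x y : ob C} {p q r : seq1 C x y}
    (S : idseq p q) (D : diag q r) : ceq (vcat (iddiag S) D) D.
Proof. exact: ceq_vcat (ceq_iddiag S) (ceq_refl D). Qed.

Lemma ceq_vcat_idr {C : partial_2category} {x y : ob C} {p q r : seq1 C x y}
    (D : diag p q) (S : idseq q r) : ceq (vcat D (iddiag S)) D.
Proof.
apply: ceq_sym; exists (inil _), S; exact: diag_eq_refl.
Qed.

Lemma ceq_emb {C : partial_2precategory} {x y x' y' : ob C}
    {a b a' b' : seq1 C x' y'} {D : diag a b} {D' : diag a' b'}
    {p q p' q' : seq1 C x y} {l : seq1 C x x'} {r : seq1 C y' y}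
    (e : p = l ## a ## r) (f : q = l ## b ## r)
    (e' : p' = l ## a' ## r) (f' : q' = l ## b' ## r) :
  ceq D D' -> ceq (emb l D r e f) (emb l D' r e' f').
Proof.
move=> [S [T h]].
have [S' hS] := idemb S e e'; have [T' hT] := idemb T f f'.
by exists S', T'; rewrite hS hT -!emb_vcat; apply: emb_eq.
Qed.

Lemma ceq_emb_pi {C : partial_2precategory} {x y x' y' : ob C}
    {a b : seq1 C x' y'} {D : diag a b} {p q p' q' : seq1 C x y}
    {l l' : seq1 C x x'} {r r' : seq1 C y' y}
    (e : p = l ## a ## r) (f : q = l ## b ## r)
    (e' : p' = l' ## a ## r') (f' : q' = l' ## b ## r') :
  l = l' -> r = r' -> ceq (emb l D r e f) (emb l' D r' e' f').
Proof. by move=> el er; subst l' r'; apply/ceq_emb/ceq_refl. Qed.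

Lemma ceq_emb_nil {C : partial_2precategory} {x y : ob C}
    {a b : seq1 C x y} {D : diag a b} {p q : seq1 C x y} 
    (e : p = pnil x ## a ## pnil y) (f : q = pnil x ## b ## pnil y) :
  ceq (emb (pnil x) D (pnil y) e f) D.
Proof.
have e' : a = pnil x ## a ## pnil y by rewrite /= papp_nil.
have f' : b = pnil x ## b ## pnil y by rewrite /= papp_nil.
by rewrite -[X in ceq _ X](emb_id _ e' f'); apply: ceq_emb_pi.
Qed.

Lemma ceq_emb2 {C : partial_2precategory} {x y x' y' x'' y'' : ob C}
    {a b : seq1 C x'' y''} {p q : seq1 C x' y'} {p' q' p1 q1 : seq1 C x y}
    {l : seq1 C x x'} {l' : seq1 C x' x''} {D : diag a b}
    {r' : seq1 C y'' y'} {r : seq1 C y' y} {l1 : seq1 C x x''} {r1 : seq1 C y'' y}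
    (f : p = l' ## a ## r') (f' : q = l' ## b ## r')
    (e : p' = l ## p ## r) (e' : q' = l ## q ## r)
    (g : p1 = l1 ## a ## r1) (g' : q1 = l1 ## b ## r1) :
  l1 = l ## l' -> r1 = r' ## r ->
  ceq (emb l (emb l' D r' f f') r e e') (emb l1 D r1 g g').
Proof.
move=> el er; unshelve erewrite emb_emb; try pathq.
exact: ceq_emb_pi.
Qed.

Lemma wl_emb {C : partial_2precategory} {x y z : ob C} {p q : seq1 C x y}
    (s : seq1 C z x) (D : diag p q) :
  exists e e', whiskerl s D = emb s D (pnil y) e e'.
Proof.
have e : s ## p = s ## p ## pnil y by rewrite papp_nil.
have e' : s ## q = s ## q ## pnil y by rewrite papp_nil.
by exists e, e'; apply: whiskerl_emb.
Qed.

Lemma wr_emb {C : partial_2precategory} {x y z : ob C} {p q : seq1 C x y}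
    (D : diag p q) (s : seq1 C y z) :
  exists e e', whiskerr D s = emb (pnil x) D s e e'.
Proof. by exists erefl, erefl; apply: whiskerr_emb. Qed.

Lemma ceq_wl {C : partial_2precategory} {x y z : ob C} {p q p' q' : seq1 C x y}
    (s : seq1 C z x) {D : diag p q} {D' : diag p' q'} :
  ceq D D' -> ceq (whiskerl s D) (whiskerl s D').
Proof.
have [e [f ->]] := wl_emb s D; have [e' [f' ->]] := wl_emb s D'.
exact: ceq_emb.
Qed.

Lemma ceq_wr {C : partial_2precategory} {x y z : ob C} {p q p' q' : seq1 C x y}
    {D : diag p q} {D' : diag p' q'} (s : seq1 C y z) :
  ceq D D' -> ceq (whiskerr D s) (whiskerr D' s).
Proof.
have [e [f ->]] := wr_emb D s; have [e' [f' ->]] := wr_emb D' s.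
exact: ceq_emb.
Qed.

Lemma ceq_wll {C : partial_2precategory} {x y z t : ob C} {p q : seq1 C x y}
    (s : seq1 C z x) (u : seq1 C t z) (D : diag p q) :
  ceq (whiskerl u (whiskerl s D)) (whiskerl (u ## s) D).
Proof.
have [e [f ->]] := wl_emb s D.
have [e' [f' ->]] := wl_emb u (emb s D (pnil y) e f).
have [e'' [f'' ->]] := wl_emb (u ## s) D.
exact: ceq_emb2.
Qed.

Lemma ceq_wrr {C : partial_2precategory} {x y z t : ob C} {p q : seq1 C x y}
    (D : diag p q) (s : seq1 C y z) (u : seq1 C z t) :
  ceq (whiskerr (whiskerr D s) u) (whiskerr D (s ## u)).
Proof.
have [e [f ->]] := wr_emb D s.
have [e' [f' ->]] := wr_emb (emb (pnil x) D s e f) u.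
have [e'' [f'' ->]] := wr_emb D (s ## u).
exact: ceq_emb2.
Qed.

Lemma ceq_wlr_emb {C : partial_2precategory} {x y z t : ob C} {p q : seq1 C x y}
    (s : seq1 C z x) (D : diag p q) (u : seq1 C y t) {p' q' : seq1 C z t} e f :
  ceq (whiskerl s (whiskerr D u)) (emb s D u e f : diag p' q').
Proof.
have [e1 [f1 ->]] := wr_emb D u.
have [e' [f' ->]] := wl_emb s (emb (pnil x) D u e1 f1).
by apply: ceq_emb2; rewrite papp_nil.
Qed.

Lemma ceq_wrl_emb {C : partial_2precategory} {x y z t : ob C} {p q : seq1 C x y}
    (s : seq1 C z x) (D : diag p q) (u : seq1 C y t) {p' q' : seq1 C z t} e f :
  ceq (whiskerr (whiskerl s D) u) (emb s D u e f : diag p' q').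
Proof.
have [e1 [f1 ->]] := wl_emb s D.
have [e' [f' ->]] := wr_emb (emb s D (pnil y) e1 f1) u.
exact: ceq_emb2.
Qed.

Lemma ceq_wlr {C : partial_2category} {x y z t : ob C} {p q : seq1 C x y}
    (s : seq1 C z x) (D : diag p q) (u : seq1 C y t) :
  ceq (whiskerl s (whiskerr D u)) (whiskerr (whiskerl s D) u).
Proof.
have h1 := ceq_wlr_emb (s := s) D (u := u) erefl erefl.
have h2 := ceq_wrl_emb (s := s) D (u := u) erefl erefl.
exact: ceq_trans h1 (ceq_sym h2).
Qed.

Lemma ceq_wr0 {C : partial_2precategory} {x y : ob C} {p q : seq1 C x y}
    (D : diag p q) : ceq (whiskerr D (pnil y)) D.
Proof. by have [e [f ->]] := wr_emb D (pnil y); apply: ceq_emb_nil. Qed.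

Lemma ceq_wl0 {C : partial_2precategory} {x y : ob C} {p q : seq1 C x y}
    (D : diag p q) : ceq (whiskerl (pnil x) D) D.
Proof. by have [e [f ->]] := wl_emb (pnil x) D; apply: ceq_emb_nil. Qed.

Lemma iddiag_wl {C : partial_2precategory} {x y z : ob C} {p q : seq1 C x y}
    (s : seq1 C z x) (S : idseq p q) :
  exists T : idseq (s ## p) (s ## q), iddiag T = whiskerl s (iddiag S).
Proof. by have [e [f ->]] := wl_emb s (iddiag S); apply: idemb. Qed.

Lemma iddiag_wr {C : partial_2precategory} {x y z : ob C} {p q : seq1 C x y}
    (S : idseq p q) (s : seq1 C y z) :
  exists T : idseq (p ## s) (q ## s), iddiag T = whiskerr (iddiag S) s.
Proof. by have [e [f ->]] := wr_emb (iddiag S) s; apply: idemb. Qed.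

(** Rewriting [r] takes place far from [D]. *)
Lemma ceq_exchr {C : partial_2precategory} {x y z : ob C} {p q : seq1 C x y}
    (D : diag p q) {r r' : seq1 C y z} (S : idseq r r') :
  ceq (whiskerr D r) (whiskerr D r').
Proof.
have [T hT] := iddiag_wl p S; have [U hU] := iddiag_wl q S.
exists T, U; rewrite hT hU; apply: diag_eq_sym; exact: diag_interchange.
Qed.

Lemma ceq_exchl {C : partial_2precategory} {x y z : ob C} {p q : seq1 C x y}
    (D : diag p q) {l l' : seq1 C z x} (S : idseq l l') :
  ceq (whiskerl l D) (whiskerl l' D).
Proof.
have [T hT] := iddiag_wr S p; have [U hU] := iddiag_wr S q.
exists T, U; rewrite hT hU; exact: diag_interchange.
Qed.

Lemma ceq_hcat {C : partial_2category} {x y z : ob C}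
    {p q p1 q1 : seq1 C x y} {p' q' p1' q1' : seq1 C y z} {D : diag p q}
    {E : diag p' q'} {D1 : diag p1 q1} {E1 : diag p1' q1'} :
  ceq D D1 -> ceq E E1 -> ceq (hcat D E) (hcat D1 E1).
Proof.
move=> h h'; have [S _] := h'; have [_ [T _]] := h.
apply: ceq_vcat.
- exact: ceq_trans (ceq_exchr D S) (ceq_wr _ h).
- exact: ceq_trans (ceq_exchl E T) (ceq_wl _ h').
Qed.

(** * Identities slide past faces *)

Lemma cyclic_eq {C : partial_2precategory} {x y x' y' : ob C}
    {p q : seq1 C x y} {p' q' : seq1 C x' y'} {u u' : seq1 C x x'}
    {v v' : seq1 C x' x} {A : shom2 p q} {A' : shom2 p' q'} :
  cyclic u v A A' -> u = u' -> v = v' -> cyclic u' v' A A'.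
Proof. by move=> h <- <-. Qed.

(** Composition of rotations past a full turn, with the cuts explicit. *)
Lemma cyclic_wrap {C : partial_2precategory} {x y x' y' x'' y'' : ob C}
    {p q : seq1 C x y} {p' q' : seq1 C x' y'} {p'' q'' : seq1 C x'' y''}
    {c : seq1 C x x''} {v' : seq1 C x'' x'} {v : seq1 C x' x}
    {A : shom2 p q} {A' : shom2 p' q'} {A'' : shom2 p'' q''} :
  cyclic (c ## v') v A A' -> cyclic (v ## c) v' A' A'' -> cyclic c (v' ## v) A A''.
Proof.
move=> h h'; have [f1 [f1' _]] := h; have [f2 [f2' _]] := h'.
have [X hX] : exists X : shom2 p'' q'', cyclic c (v' ## v) A X.
  by apply: cyclic_ex; rewrite ?f1 ?f2' papp_assoc.
have [Y hY] : exists Y : shom2 p' q', cyclic v' (v ## c) X Y.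
  by apply: cyclic_ex; rewrite ?f1' ?f2' ?papp_assoc.
have eY := cyclic_fun (cyclic_comp hX hY) h erefl erefl; subst Y.
by rewrite -(cyclic_fun (cyclic_sym hY) h' erefl erefl).
Qed.

(** Compares two faces through a common one of which both are rotations. *)
Lemma cyclic_diff {C : partial_2precategory} {x y x' y' x'' y'' : ob C}
    {p q : seq1 C x y} {p' q' : seq1 C x' y'} {p'' q'' : seq1 C x'' y''}
    {u : seq1 C x x'} {u' : seq1 C x' x''} {w : seq1 C x'' x}
    {A : shom2 p q} {X : shom2 p' q'} {Y : shom2 p'' q''} :
  cyclic u (u' ## w) A X -> cyclic (u ## u') w A Y -> cyclic u' (w ## u) X Y.
Proof.
move=> hX hY; have [_ [f1 _]] := hX; have [_ [f2 _]] := hY.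
have [Z hZ] : exists Z : shom2 p'' q'', cyclic u' (w ## u) X Z.
  by apply: cyclic_ex; rewrite ?f1 ?f2 papp_assoc.
by rewrite (cyclic_fun hY (cyclic_comp hX hZ) erefl erefl).
Qed.

Lemma cyclic_same {C : partial_2precategory} {x y x' y' y'' : ob C}
    {p q : seq1 C x y} {p' q' : seq1 C x' y'} {p'' q'' : seq1 C x' y''}
    {u : seq1 C x x'} {v : seq1 C x' x}
    {A : shom2 p q} {X : shom2 p' q'} {Y : shom2 p'' q''} :
  cyclic u v A X -> cyclic u v A Y -> cyclic (pnil x') (v ## u) X Y.
Proof.
move=> hX hY; apply: (@cyclic_diff _ _ _ _ _ _ _ _ _ _ _ _ _ u (pnil x') v A) => //.
exact: cyclic_eq hY (esym (papp_nil u)) erefl.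
Qed.

Lemma cyclic_turn {C : partial_2precategory} {x y y' : ob C}
    {p q : seq1 C x y} {p' q' : seq1 C x y'} {w : seq1 C x x}
    {A : shom2 p q} {A' : shom2 p' q'} :
  cyclic w (pnil x) A A' -> cyclic (pnil x) w A A'.
Proof.
move=> [e [e' <-]]; exists (etrans e (papp_nil w)), (etrans e' (esym (papp_nil w))).
by rewrite (cyc_turn e e' (etrans e (papp_nil w)) (etrans e' (esym (papp_nil w)))).
Qed.

(** Faces obtained by different rotations have boundaries that are equal only up
to associativity and reversal; this reconciles the composites of such faces. *)
Lemma sv2_cast {C : partial_2precategory} {x y : ob C} {P P' c Q Q' : seq1 C x y}
    {N : shom2 P c} {N' : shom2 P' c} {T : shom2 c Q} {T' : shom2 c Q'}
    (h : scomp2 N T) :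
  P = P' -> Q = Q' ->
  cyclic (pnil x) (P ## c^T) N N' -> cyclic (pnil x) (c ## Q^T) T T' ->
  exists h' : scomp2 N' T', cyclic (pnil x) (P ## Q^T) (sv2 h) (sv2 h').
Proof.
move=> eP eQ hN hT; subst P' Q'.
have eN := cyclic_fun (cyclic_refl N erefl) hN erefl erefl.
have eT := cyclic_fun (cyclic_refl T erefl) hT erefl erefl.
subst N' T'; exists h; exact: cyclic_refl.
Qed.

Lemma layer_cast {C : partial_2precategory} {x y x' y' : ob C}
    {p q : seq1 C x y} {l : seq1 C x x'} {a a' b b' : seq1 C x' y'}
    {A : shom2 a b} {A' : shom2 a' b'} {r : seq1 C y' y} {h h' e1 e2 e1' e2'} :
  a = a' -> b = b' -> cyclic (pnil x') (a ## b^T) A A' ->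
  Layer l A r h e1 e2 = Layer l A' r h' e1' e2' :> layer p q.
Proof.
move=> ea eb hA; subst a' b'.
have eA := cyclic_fun (cyclic_refl A erefl) hA erefl erefl.
by subst A'; apply: layer_ext.
Qed.

(** The target of [ident h] is left free, because the composites with an identity
are only propositionally equal to their other factor. *)
Definition triangle {C : partial_2precategory} {x y z : ob C} {a : shom1 x y}
    {b : shom1 y z} (h : scomp1 a b) {c : shom1 x z} (e : sh1 h = c) :
    shom2 (ptwo a b) (pone c) :=
  match e in _ = c return shom2 (ptwo a b) (pone c) with erefl => ident h end.

Lemma flexible_tri {C : partial_2precategory} {x y z : ob C} {a : shom1 x y}
    {b : shom1 y z} (h : scomp1 a b) {c : shom1 x z} (e : sh1 h = c) :
  flexible (triangle e).
Proof. by case: c / e; apply: flexible_ident. Qed.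

Lemma triangle_step {C : partial_2precategory} {x y x' z' y' : ob C}
    {p q : seq1 C x y} (l : seq1 C x x') {a : shom1 x' z'} {b : shom1 z' y'}
    {h : scomp1 a b} {c : shom1 x' y'} (e : sh1 h = c) (r : seq1 C y' y)
    (hp : polygon (ptwo a b) (pone c)) (f : p = l ## ptwo a b ## r)
    (f' : q = l ## pone c ## r) :
  exists s : idstep p q, idlayer s = Layer l (triangle e) r hp f f'.
Proof.
case: c / e hp f' => hp f'; exists (Compose (Composition l h r f f')) => /=.
exact: layer_ext.
Qed.

Lemma triangle_step_inv {C : partial_2precategory} {x y x' z' y' : ob C}
    {p q : seq1 C x y} (l : seq1 C x x') {a : shom1 x' z'} {b : shom1 z' y'}
    {h : scomp1 a b} {c : shom1 x' y'} (e : sh1 h = c) (r : seq1 C y' y)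
    (hp : polygon (pone c) (ptwo a b)) (f : p = l ## pone c ## r)
    (f' : q = l ## ptwo a b ## r) :
  exists s : idstep p q, idlayer s = Layer l (tr2 (triangle e)) r hp f f'.
Proof.
case: c / e hp f => hp f; exists (Decompose (Composition l h r f' f)) => /=.
exact: layer_ext.
Qed.

(** The loops formed by [s1] and [s2] fix [A] and [M] by the Diagram axiom. The
conclusion is an equality of simple 2-morphisms and not only of diagrams, so the
result can be rotated. *)
Lemma vcomp_parallel {C : partial_2category} {x y : ob C} {s p q : seq1 C x y}
    (A : shom2 s p) (M : shom2 s q) (s1 s2 : idstep p q) :
  vcomp_layer A (idlayer s1) M -> vcomp_layer A (idlayer s2) M.
Proof.
move=> h1.
have := vcomp_diag_rec (diagram_axiomr (icons s1 (icons (stepinv s2) (inil _))) A).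
move=> [N [k1 [N' [k2 ?]]]] /=; subst N'.
have ? := vcomp_layer_fun k1 h1; subst N.
have := vcomp_diag_rec (diagram_axiomr (icons (stepinv s2) (icons s2 (inil _))) M).
move=> [N [k3 [N' [k4 ?]]]] /=; subst N'.
by have ? := vcomp_layer_fun k3 k2; subst N.
Qed.

Ltac cyceq h := apply: (cyclic_eq h); pathq.

(** Rotated suitably, [A] has a target in which [g] is followed by the reverse of
[f]. Inserting [e] between them next to [g] or next to the reverse of [f] gives
the same face [M], by [vcomp_parallel]. Rotated back, the first insertion is the
triangle of [g] and [e] above [A], and the second one is a triangle below [A]
with side [f], from which [e] passes on the right of [A]. *)
Lemma slide_right {C : partial_2category} {x y0 y1 z : ob C}
    (a : seq1 C x y0) (f : shom1 y0 z) (b : seq1 C x y1) (g : shom1 y1 z)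
    (e : shom1 z z) (hg : scomp1 g e) (eg : sh1 hg = g)
    (hf : scomp1 e (tr1 f)) (ef : sh1 hf = tr1 f)
    (I' : shom2 (pone f) (ptwo f e))
    (A : shom2 (a ## pone f) (b ## pone g)) :
  cyclic (pone (tr1 f)) (ptwo f (tr1 e)) (tr2 (triangle ef)) I' ->
  forall (p m m' q : seq1 C x z) hA hG hI hA' e1 e2 e3 e4 f1 f2 f3 f4,
  diag_eq
    (dcons (Layer (pnil x) A (pnil z) hA e1 e2 : layer p m)
      (dcons (Layer b (tr2 (triangle eg)) (pnil z) hG e3 e4 : layer m q) (dempty q)))
    (dcons (Layer a I' (pnil z) hI f1 f2 : layer p m')
      (dcons (Layer (pnil x) A (pone e) hA' f3 f4 : layer m' q) (dempty q))).
Proof.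
move=> hI'.
set w := b^T ## a.
have [A1 cA1] : exists A1 : shom2 w (ptwo g (tr1 f)),
    cyclic (a ## pone f ## pone (tr1 g)) (b^T) A A1.
  by apply: cyclic_ex; rewrite /w; pathq.
pose p1 := ptwo g (tr1 f); pose p2 := pcons g (ptwo e (tr1 f)).
have d1 : p1 = pnil y1 ## pone g ## pone (tr1 f) by [].
have d2 : p2 = pnil y1 ## ptwo g e ## pone (tr1 f) by [].
have d3 : p1 = pone g ## pone (tr1 f) ## pnil y0 by [].
have d4 : p2 = pone g ## ptwo e (tr1 f) ## pnil y0 by [].
have [s1 es1] := triangle_step_inv eg (or_introl I) d1 d2.
have [s2 es2] := triangle_step_inv ef (or_introl I) d3 d4.
have [M cM1] : exists M, vcomp_layer A1 (idlayer s1) M.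
  rewrite es1; apply: vcomp_layer_ex => //; exact/flexible_tr2/flexible_tri.
have cM2 := vcomp_parallel s2 cM1.
move: cM1 cM2; rewrite es1 es2 => -[N1 [h1 [cN1 cM1]]] [N2 [h2 [cN2 cM2]]].
(* The first insertion: the triangle of [g] and [e] is glued to the target of
   [A], and the result [ML] is a rotation of [M]. *)
have [A' cA'] : exists A' : shom2 (b^T ## (a ## pone f) ## (pnil z)^T) (pone g),
    cyclic ((a ## pone f) ## (pnil z)^T ## (pone g)^T) (b^T) A A'.
  by apply: cyclic_ex; pathq.
have k1 : cyclic (pnil _) (b^T ## a ## pone f ## pone (tr1 g)) N1 A'.
  have t1 : cyclic (b^T ## (a ## pone f ## pone (tr1 g))) (pnil y1) A1 N1.
    by cyceq cN1.
  have t2 : cyclic ((a ## pone f ## pone (tr1 g)) ## pnil y1) (b^T) A A1.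
    by cyceq cA1.
  have t3 := cyclic_wrap t2 t1.
  have t4 : cyclic (a ## pone f ## pone (tr1 g)) (pnil y1 ## b^T) A A'.
    by cyceq cA'.
  by cyceq (cyclic_same t3 t4).
have [h1' k1'] : exists h1' : scomp2 A' (tr2 (triangle eg)),
    cyclic (pnil _) (b^T ## a ## pone f ## pone (tr1 e) ## pone (tr1 g))
      (sv2 h1) (sv2 h1').
  have t1 : (pnil y1)^T ## w ## (pone (tr1 f))^T =
            b^T ## (a ## pone f) ## (pnil z)^T by rewrite /w; pathq.
  have t2 : cyclic (pnil y1)
      (((pnil y1)^T ## w ## (pone (tr1 f))^T) ## (pone g)^T) N1 A'.
    by cyceq k1.
  have [h' k'] := sv2_cast h1 t1 erefl t2 (cyclic_refl _ erefl).
  by exists h'; cyceq k'.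
have [ML cML] : exists ML : shom2 (a ## pone f) (b ## ptwo g e),
    cyclic (b^T) ((a ## pone f) ## (pnil z)^T ## (ptwo g e)^T) (sv2 h1') ML.
  by apply: cyclic_ex; pathq.
(* The second insertion: the triangle with side [f] is glued to the source of
   [A]. It composes with [A] in the orientation opposite to the current one, which
   is the second case of [glue]; the result [MR] is again a rotation of [M]. *)
have [Ar cAr] : exists Ar : shom2 (pone f ## (pone e)^T) (pone f),
    cyclic (pnil _) (pone f ## (pone e)^T ## (pone f)^T) I' Ar.
  by apply: cyclic_ex; pathq.
have [Br cBr] : exists Br : shom2 (pone f) (a^T ## (b ## pone g)),
    cyclic a (pone f ## (b ## pone g)^T) A Br.
  by apply: cyclic_ex; pathq.
have [Aq cAq] : exists Aq : shom2 ((pone f)^T) ((pone f ## (pone e)^T)^T),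
    cyclic (pone f ## (pone e)^T) ((pone f)^T) Ar Aq.
  by apply: cyclic_ex; pathq.
have [Bq cBq] : exists Bq : shom2 ((a^T ## (b ## pone g))^T) ((pone f)^T),
    cyclic (pone f) ((a^T ## (b ## pone g))^T) Br Bq.
  by apply: cyclic_ex; pathq.
have k2 : cyclic (pnil _) (pone (tr1 g) ## b^T ## a ## pone f) N2 Bq.
  have t1 : cyclic (a ## pone f) (pone (tr1 g) ## b^T) A Bq.
    have u1 : cyclic a (pone f ## pone (tr1 g) ## b^T) A Br by cyceq cBr.
    have u2 : cyclic (pone f) ((pone (tr1 g) ## b^T) ## a) Br Bq by cyceq cBq.
    exact: cyclic_comp u1 u2.
  have t2 : cyclic (a ## pone f) (pone (tr1 g) ## b^T) A N2.
    have u1 : cyclic ((a ## pone f) ## pone (tr1 g)) (b^T) A A1 by cyceq cA1.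
    have u2 : cyclic (b^T ## a ## pone f) (pone (tr1 g)) A1 N2 by cyceq cN2.
    exact: cyclic_wrap u1 u2.
  by cyceq (cyclic_same t2 t1).
have k3 : cyclic (pnil _) (pone (tr1 f) ## (ptwo e (tr1 f))^T) (tr2 (triangle ef)) Aq.
  have u1 : cyclic (pone (tr1 f)) (pone f ## pone (tr1 e)) (tr2 (triangle ef)) Ar.
    have u2 : cyclic (pone (tr1 f)) (pnil y0 ## pone f ## pone (tr1 e))
       (tr2 (triangle ef)) I' by cyceq hI'.
    have u3 : cyclic (pnil y0) ((pone f ## pone (tr1 e)) ## pone (tr1 f)) I' Ar.
      by cyceq cAr.
    by cyceq (cyclic_comp u2 u3).
  have u2 : cyclic (pone (tr1 f) ## (pone f ## pone (tr1 e))) (pnil z)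
      (tr2 (triangle ef)) Aq.
    apply: (cyclic_comp (u' := pone f ## pone (tr1 e))); first by cyceq u1.
    by cyceq cAq.
  by have := cyclic_turn u2 => u3; cyceq u3.
have [h2' k2'] : exists h2' : scomp2 Bq Aq,
    cyclic (pnil _) (pone (tr1 g) ## b^T ## a ## pone f ## pone (tr1 e))
      (sv2 h2) (sv2 h2').
  have t1 : (pone g)^T ## w ## (pnil y0)^T = (a^T ## (b ## pone g))^T.
    by rewrite /w; pathq.
  have t2 : ptwo e (tr1 f) = (pone f ## (pone e)^T)^T by pathq.
  have t3 : cyclic (pnil z)
      (((pone g)^T ## w ## (pnil y0)^T) ## (pone (tr1 f))^T) N2 Bq by cyceq k2.
  have [h' k'] := sv2_cast h2 t1 t2 t3 k3.
  by exists h'; cyceq k'.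
have [Mr cMr] : exists Mr : shom2 (pone f ## (pone e)^T) (a^T ## (b ## pone g)),
    cyclic ((a^T ## (b ## pone g))^T) (pone f ## (pone e)^T) (sv2 h2') Mr.
  by apply: cyclic_ex; pathq.
have [MR cMR] : exists MR : shom2 (a ## pone f) ((b ## pone g) ## pone e),
    cyclic (pone f ## (pone e)^T ## (b ## pone g)^T) a Mr MR.
  by apply: cyclic_ex; pathq.
have kL : cyclic (b^T) (a ## pone f ## pone (tr1 e) ## pone (tr1 g)) M ML.
  set V := a ## pone f ## pone (tr1 e) ## pone (tr1 g).
  have u1 : cyclic (pnil y1) (b^T ## V) (sv2 h1) M by cyceq cM1.
  have u2 : cyclic (pnil y1) (b^T ## V) (sv2 h1) (sv2 h1') by cyceq k1'.
  have u3 : cyclic (pnil y1 ## b^T) V (sv2 h1) ML.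
    apply: (cyclic_comp u2); by cyceq cML.
  by have := cyclic_diff u1 u3 => u4; cyceq u4.
have kR : cyclic (b^T) (a ## pone f ## pone (tr1 e) ## pone (tr1 g)) M MR.
  have u1 : cyclic (w ## pone f ## pone (tr1 e)) (pone (tr1 g)) M (sv2 h2).
    by have := cyclic_sym cM2 => u; cyceq u.
  have u2 : cyclic ((w ## pone f ## pone (tr1 e)) ## pnil _) (pone (tr1 g)) M (sv2 h2').
    apply: (cyclic_comp (w := pone (tr1 g))); first by cyceq u1.
    by cyceq k2'.
  have u3 : cyclic w ((pone f ## pone (tr1 e)) ## pone (tr1 g)) M Mr.
    apply: (cyclic_wrap (A' := sv2 h2')); first by cyceq u2.
    by cyceq cMr.
  have u4 : cyclic (b^T) (a ## ((pone f ## pone (tr1 e)) ## pone (tr1 g))) M MR.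
    apply: (cyclic_wrap (A' := Mr)); first by cyceq u3.
    by cyceq cMR.
  by cyceq u4.
have kLR : cyclic (pnil _) ((a ## pone f) ## (b ## ptwo g e)^T) ML MR.
  by cyceq (cyclic_same kL kR).
move=> p m m' q hA hG hI hA' e1 e2 e3 e4 f1 f2 f3 f4.
have hL : polygon (a ## pone f) (b ## ptwo g e) by left; apply: nonempty_appr.
have hR : polygon (a ## pone f) ((b ## pone g) ## pone e).
  by left; apply: nonempty_appr.
have i1 : p = pnil x ## (a ## pone f) ## pnil z by [].
have i2 : q = pnil x ## (b ## ptwo g e) ## pnil z by rewrite e4; pathq.
have i3 : q = pnil x ## ((b ## pone g) ## pone e) ## pnil z by rewrite e4; pathq.
have eLR : Layer (pnil x) ML (pnil z) hL i1 i2 = Layer (pnil x) MR (pnil z) hR i1 i3.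
  by apply: layer_cast kLR => //; pathq.
apply: diag_eq_trans (_ : diag_eq _ (dcons (Layer (pnil x) ML (pnil z) hL i1 i2)
                                        (dempty q))) _.
  apply/closure_step/step_merge_step/step_merge.
  unshelve eapply (merge_eq (@merge_lower C x z p m q x z y1 z
    (pnil x) b (pone g) (ptwo g e) (pnil z) (a ## pone f) (pnil z)
    A (tr2 (triangle eg)) ML A' (sv2 h1') hA hG hL _ _ _ _ _ _ cA' _ cML));
    first [layerq|pathq|by left; exists h1'|assumption].
rewrite eLR; apply/diag_eq_sym/closure_step/step_merge_step/step_merge.
unshelve eapply (merge_eq (@merge_right C x z p m' q x y0 z z
    (pnil x) a (pone f) (pone e) (pone f) (b ## pone g) (pnil z)
    I' A MR Ar Br Mr hI hA' hR _ _ _ _ _ _ cAr cBr _ cMR));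
    first [layerq|pathq|assumption|idtac].
by right; exists Bq, Aq, h2'.
Qed.

(** The mirror image of [slide_right]. *)
Lemma slide_left {C : partial_2category} {x y0 y1 z : ob C}
    (f : shom1 z y0) (a : seq1 C y0 x) (g : shom1 z y1) (b : seq1 C y1 x)
    (e : shom1 z z) (hg : scomp1 e g) (eg : sh1 hg = g)
    (hf : scomp1 (tr1 f) e) (ef : sh1 hf = tr1 f)
    (I' : shom2 (pone f) (ptwo e f))
    (A : shom2 (pone f ## a) (pone g ## b)) :
  cyclic (ptwo (tr1 f) (tr1 e)) (pone f) (tr2 (triangle ef)) I' ->
  forall (p m m' q : seq1 C z x) hA hG hI hA' e1 e2 e3 e4 f1 f2 f3 f4,
  diag_eq
    (dcons (Layer (pnil z) A (pnil x) hA e1 e2 : layer p m)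
      (dcons (Layer (pnil z) (tr2 (triangle eg)) b hG e3 e4 : layer m q) (dempty q)))
    (dcons (Layer (pnil z) I' a hI f1 f2 : layer p m')
      (dcons (Layer (pone e) A (pnil x) hA' f3 f4 : layer m' q) (dempty q))).
Proof.
move=> hI'.
set w := a ## b^T.
have [A1 cA1] : exists A1 : shom2 w (ptwo (tr1 f) g),
    cyclic (pone f) (a ## b^T ## pone (tr1 g)) A A1.
  by apply: cyclic_ex; rewrite /w; pathq.
pose p1 := ptwo (tr1 f) g; pose p2 := pcons (tr1 f) (ptwo e g).
have d1 : p1 = pone (tr1 f) ## pone g ## pnil y1 by [].
have d2 : p2 = pone (tr1 f) ## ptwo e g ## pnil y1 by [].
have d3 : p1 = pnil y0 ## pone (tr1 f) ## pone g by [].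
have d4 : p2 = pnil y0 ## ptwo (tr1 f) e ## pone g by [].
have [s1 es1] := triangle_step_inv eg (or_introl I) d1 d2.
have [s2 es2] := triangle_step_inv ef (or_introl I) d3 d4.
have [M cM1] : exists M, vcomp_layer A1 (idlayer s1) M.
  rewrite es1; apply: vcomp_layer_ex => //; exact/flexible_tr2/flexible_tri.
have cM2 := vcomp_parallel s2 cM1.
move: cM1 cM2; rewrite es1 es2 => -[N1 [h1 [cN1 cM1]]] [N2 [h2 [cN2 cM2]]].
(* The first insertion. *)
have [A' cA'] : exists A' : shom2 ((pnil z)^T ## (pone f ## a) ## b^T) (pone g),
    cyclic ((pone f ## a) ## b^T ## (pone g)^T) ((pnil z)^T) A A'.
  by apply: cyclic_ex; pathq.
have k1 : cyclic (pnil _) (pone f ## a ## b^T ## pone (tr1 g)) N1 A'.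
  have t1 : cyclic ((a ## b^T ## pone (tr1 g)) ## pnil z) (pone f) A1 N1.
    by cyceq cN1.
  have t2 : cyclic (pnil z ## pone f) (a ## b^T ## pone (tr1 g)) A A1.
    by cyceq cA1.
  have t3 := cyclic_wrap t2 t1.
  have t4 : cyclic (pnil z) (pone f ## a ## b^T ## pone (tr1 g)) A A'.
    by have := cyclic_turn cA' => t; cyceq t.
  by cyceq (cyclic_same t3 t4).
have [h1' k1'] : exists h1' : scomp2 A' (tr2 (triangle eg)),
    cyclic (pnil _) (pone f ## a ## b^T ## pone (tr1 g) ## pone (tr1 e))
      (sv2 h1) (sv2 h1').
  have t1 : (pone (tr1 f))^T ## w ## (pnil y1)^T =
            (pnil z)^T ## (pone f ## a) ## b^T by rewrite /w; pathq.
  have t2 : cyclic (pnil z)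
      (((pone (tr1 f))^T ## w ## (pnil y1)^T) ## (pone g)^T) N1 A'.
    by cyceq k1.
  have [h' k'] := sv2_cast h1 t1 erefl t2 (cyclic_refl _ erefl).
  by exists h'; cyceq k'.
have [ML cML] : exists ML : shom2 (pone f ## a) (ptwo e g ## b),
    cyclic ((pnil z)^T) ((pone f ## a) ## b^T ## (ptwo e g)^T) (sv2 h1') ML.
  by apply: cyclic_ex; pathq.
(* The second insertion. *)
have [Ar cAr] : exists Ar : shom2 ((pone e)^T ## pone f) (pone f),
    cyclic (pone f ## (pone f)^T) ((pone e)^T) I' Ar.
  by apply: cyclic_ex; pathq.
have [Br cBr] : exists Br : shom2 (pone f) ((pone g ## b) ## a^T),
    cyclic (pnil z) (pone f ## a ## (pone g ## b)^T) A Br.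
  by apply: cyclic_ex; pathq.
have [Aq cAq] : exists Aq : shom2 ((pone f)^T) (((pone e)^T ## pone f)^T),
    cyclic ((pone e)^T ## pone f) ((pone f)^T) Ar Aq.
  by apply: cyclic_ex; pathq.
have [Bq cBq] : exists Bq : shom2 (((pone g ## b) ## a^T)^T) ((pone f)^T),
    cyclic (pone f) (((pone g ## b) ## a^T)^T) Br Bq.
  by apply: cyclic_ex; pathq.
have k2 : cyclic (pnil _) (a ## b^T ## pone (tr1 g) ## pone f) N2 Bq.
  have t1 : cyclic (pnil z ## pone f) (a ## b^T ## pone (tr1 g)) A Bq.
    apply: (cyclic_comp (w := a ## b^T ## pone (tr1 g))); first by cyceq cBr.
    by cyceq cBq.
  have t2 : cyclic (pone f) (pnil _ ## a ## b^T ## pone (tr1 g)) A N2.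
    have u1 : cyclic (pone f ## pnil _) (a ## b^T ## pone (tr1 g)) A A1.
      by cyceq cA1.
    have u2 : cyclic ((a ## b^T ## pone (tr1 g)) ## pone f) (pnil _) A1 N2.
      by cyceq cN2.
    exact: cyclic_wrap u1 u2.
  by cyceq (cyclic_same t2 t1).
have k3 : cyclic (pnil _) (pone (tr1 f) ## (ptwo (tr1 f) e)^T) (tr2 (triangle ef)) Aq.
  have u1 : cyclic (pone (tr1 f)) (pone (tr1 e) ## pone f) (tr2 (triangle ef)) Ar.
    have u2 : cyclic (pone (tr1 f) ## pone (tr1 e)) (pone f)
       (tr2 (triangle ef)) I' by cyceq hI'.
    apply: (cyclic_wrap u2); by cyceq cAr.
  have u2 : cyclic (pone (tr1 f) ## (pone (tr1 e) ## pone f)) (pnil _)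
      (tr2 (triangle ef)) Aq.
    apply: (cyclic_comp (u' := pone (tr1 e) ## pone f)); first by cyceq u1.
    by cyceq cAq.
  by have := cyclic_turn u2 => u3; cyceq u3.
have [h2' k2'] : exists h2' : scomp2 Bq Aq,
    cyclic (pnil _) (a ## b^T ## pone (tr1 g) ## pone (tr1 e) ## pone f)
      (sv2 h2) (sv2 h2').
  have t1 : (pnil y0)^T ## w ## (pone g)^T = ((pone g ## b) ## a^T)^T.
    by rewrite /w; pathq.
  have t2 : ptwo (tr1 f) e = ((pone e)^T ## pone f)^T by pathq.
  have t3 : cyclic (pnil y0)
      (((pnil y0)^T ## w ## (pone g)^T) ## (pone (tr1 f))^T) N2 Bq by cyceq k2.
  have [h' k'] := sv2_cast h2 t1 t2 t3 k3.
  by exists h'; cyceq k'.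
have [Mr cMr] : exists Mr : shom2 ((pone e)^T ## pone f) ((pone g ## b) ## a^T),
    cyclic (((pone g ## b) ## a^T)^T) ((pone e)^T ## pone f) (sv2 h2') Mr.
  by apply: cyclic_ex; pathq.
have [MR cMR] : exists MR : shom2 (pone f ## a) (pone e ## (pone g ## b)),
    cyclic ((pone e)^T) (pone f ## a ## (pone g ## b)^T) Mr MR.
  by apply: cyclic_ex; pathq.
set V := a ## b^T ## pone (tr1 g) ## pone (tr1 e).
have kL : cyclic V (pone f) M ML.
  have u1 : cyclic V (pone f) M (sv2 h1).
    by have := cyclic_sym cM1 => u; cyceq u.
  have u2 : cyclic (V ## pnil _) (pone f) M (sv2 h1').
    apply: (cyclic_comp (w := pone f)); first by cyceq u1.
    by cyceq k1'.
  have u3 : cyclic ((V ## pnil _) ## pnil _) (pone f) M ML.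
    apply: (cyclic_comp (w := pone f)); first by cyceq u2.
    by cyceq cML.
  by cyceq u3.
have kR : cyclic V (pone f) M MR.
  have u1 : cyclic (pnil _) (V ## pone f) M (sv2 h2).
    by have := cyclic_turn (cyclic_sym cM2) => u; cyceq u.
  have u2 : cyclic (pnil _ ## pnil _) (V ## pone f) M (sv2 h2').
    apply: (cyclic_comp (u' := pnil _) (w := V ## pone f) u1); by cyceq k2'.
  have u3 : cyclic ((pnil _ ## pnil _) ## (w ## pone (tr1 g)))
      (pone (tr1 e) ## pone f) M Mr.
    apply: (cyclic_comp (w := pone (tr1 e) ## pone f) (u' := w ## pone (tr1 g))); first by cyceq u2.
    by cyceq cMr.
  have u4 : cyclic (((pnil _ ## pnil _) ## (w ## pone (tr1 g))) ## pone (tr1 e))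
      (pone f) M MR.
    apply: (cyclic_comp u3); by cyceq cMR.
  by cyceq u4.
have kLR : cyclic (pnil _) ((pone f ## a) ## (ptwo e g ## b)^T) ML MR.
  by cyceq (cyclic_same kL kR).
move=> p m m' q hA hG hI hA' e1 e2 e3 e4 f1 f2 f3 f4.
have hL : polygon (pone f ## a) (ptwo e g ## b) by left.
have hR : polygon (pone f ## a) (pone e ## (pone g ## b)) by left.
have i1 : p = pnil z ## (pone f ## a) ## pnil x by [].
have i2 : q = pnil z ## (ptwo e g ## b) ## pnil x by rewrite e4; pathq.
have i3 : q = pnil z ## (pone e ## (pone g ## b)) ## pnil x by rewrite e4; pathq.
have eLR : Layer (pnil z) ML (pnil x) hL i1 i2 = Layer (pnil z) MR (pnil x) hR i1 i3.
  by apply: layer_cast kLR => //; pathq.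
apply: diag_eq_trans (_ : diag_eq _ (dcons (Layer (pnil z) ML (pnil x) hL i1 i2)
                                        (dempty q))) _.
  apply/closure_step/step_merge_step/step_merge.
  unshelve eapply (merge_eq (@merge_lower C z x p m q z x z y1
    (pnil z) (pnil z) (pone g) (ptwo e g) b (pone f ## a) (pnil x)
    A (tr2 (triangle eg)) ML A' (sv2 h1') hA hG hL _ _ _ _ _ _ cA' _ cML));
    first [layerq|pathq|by left; exists h1'|assumption].
rewrite eLR; apply/diag_eq_sym/closure_step/step_merge_step/step_merge.
unshelve eapply (merge_eq (@merge_left C z x p m' q z z y0 x
    (pnil z) (pone e) (pone f) a (pone f) (pone g ## b) (pnil x)
    I' A MR Ar Br Mr hI hA' hR _ _ _ _ _ _ cAr cBr _ cMR));
    first [layerq|pathq|assumption|idtac].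
by right; exists Bq, Aq, h2'.
Qed.

Lemma idseq_idr {C : partial_2precategory} {x z : ob C} (e : shom1 z z)
    (l : seq1 C x z) :
  is_identity1 e -> nonempty l -> inhabited (idseq l (l ## pone e)).
Proof.
move=> [_ he] /snoc_case[y [l' [f ->]]]; have [h eh] := he _ f.
have f1 : l' ## pone f = l' ## pone f ## pnil z by [].
have f2 : (l' ## pone f) ## pone e = l' ## ptwo f e ## pnil z by pathq.
have [s _] := triangle_step_inv eh (or_introl I) f1 f2.
by split; apply: icons s (inil _).
Qed.

Lemma idseq_idl {C : partial_2precategory} {x z : ob C} (e : shom1 z z)
    (r : seq1 C z x) :
  is_identity1 e -> nonempty r -> inhabited (idseq r (pone e ## r)).
Proof.
move=> [he _] /cons_case[y [f [r' ->]]]; have [h eh] := he _ f.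
have f1 : pone f ## r' = pnil z ## pone f ## r' by [].
have f2 : pone e ## pone f ## r' = pnil z ## ptwo e f ## r' by [].
have [s _] := triangle_step_inv eh (or_introl I) f1 f2.
by split; apply: icons s (inil _).
Qed.

Lemma solid_idr {C : partial_2category} {y z : ob C} (e : shom1 z z)
    (f : shom1 y z) : is_identity1 e -> solid (pone f).
Proof.
by move=> [_ he]; have [h eh] := he _ f; have [_ [hs _]] := loop_back h; rewrite eh in hs.
Qed.

Lemma solid_idl {C : partial_2category} {y z : ob C} (e : shom1 z z)
    (f : shom1 z y) : is_identity1 e -> solid (pone f).
Proof.
by move=> [he _]; have [h eh] := he _ f; have [_ [hs _]] := loop_back h; rewrite eh in hs.
Qed.

(** The triangle with side [f] in [slide_right] is a rotation of the triangle of
[e] and the reverse of [f]. Applied to a face equal to the empty diagram on [f],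
[slide_right] shows that it is equal to the usual triangle of [f] and [e]. *)
Lemma face_idr {C : partial_2category} {x z : ob C} (e : shom1 z z)
    (a b : seq1 C x z) (A : shom2 a b) hA :
  is_identity1 e -> nonempty a -> nonempty b ->
  ceq (face A hA) (whiskerr (face A hA) (pone e)).
Proof.
move=> he /snoc_case[y0 [a' [f ea]]] /snoc_case[y1 [b' [g eb]]]; subst a b.
have [hel her] := he.
have [hg eg] := her _ g; have [hf eff] := her _ f; have [hf' ef] := hel _ (tr1 f).
have [I' hI'] : exists I' : shom2 (pone f) (ptwo f e),
    cyclic (pone (tr1 f)) (ptwo f (tr1 e)) (tr2 (triangle ef)) I'.
  by apply: cyclic_ex; pathq.
have sl := slide_right _ _ hI'.
have [_ [J [hJ eJ]]] := solid_idr f he.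
have hI : polygon (pone f) (ptwo f e) by left.
have e1 : pone f = pnil y0 ## (pnil y0 ## pone f) ## pnil z by [].
have e2 : ptwo f e = pnil y0 ## ptwo f e ## pnil z by [].
have e3 : ptwo f e = pnil y0 ## (pnil y0 ## pone f) ## pone e by [].
have k : diag_eq (dcons (Layer (pnil y0) (tr2 (triangle eff)) (pnil z) hI e1 e2) (dempty _))
                 (dcons (Layer (pnil y0) I' (pnil z) hI e1 e2) (dempty _)).
  have := sl y0 y0 (pnil y0) (pnil y0) f hf eff J (pone f) (pone f) (ptwo f e) (ptwo f e)
    hJ hI hI hJ e1 e1 e1 e2 e1 e2 e3 e3 => k.
  apply: diag_eq_trans (diag_eq_sym (face_local e1 e1 _ eJ)) _.
  apply: diag_eq_trans k _.
  apply: closure_cons; exact: (face_local e3 e3 (dempty _) eJ).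
have f1 : a' ## pone f = a' ## pone f ## pnil z by [].
have f2 : (a' ## pone f) ## pone e = a' ## ptwo f e ## pnil z by pathq.
have g1 : b' ## pone g = b' ## pone g ## pnil z by [].
have g2 : (b' ## pone g) ## pone e = b' ## ptwo g e ## pnil z by pathq.
have hG : polygon (pone g) (ptwo g e) by left.
have [s es] := triangle_step_inv eff hI f1 f2.
have [t et] := triangle_step_inv eg hG g1 g2.
exists (icons s (inil _)), (icons t (inil _)); apply: diag_eq_sym.
have i1 : a' ## pone f = pnil x ## (a' ## pone f) ## pnil z by rewrite /= papp_nil.
have i2 : b' ## pone g = pnil x ## (b' ## pone g) ## pnil z by rewrite /= papp_nil.
have i3 : (a' ## pone f) ## pone e = pnil x ## (a' ## pone f) ## pone e by [].
have i4 : (b' ## pone g) ## pone e = pnil x ## (b' ## pone g) ## pone e by [].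
have := sl x y1 a' b' g hg eg A _ _ _ _ hA hG hI hA i1 i2 g1 g2 f1 f2 i3 i4 => k2.
have k3 : diag_eq (dcons (idlayer s) (dempty _))
     (dcons (Layer a' I' (pnil z) hI f1 f2) (dempty _)).
  rewrite es; move: k; rewrite !face_eq.
  by move/(emb_eq (l := a') (r := pnil z) f1 f2); rewrite !emb_face.
have -> : vcat (face A hA) (iddiag (icons t (inil ((b' ## pone g) ## pone e)))) =
   dcons (Layer (pnil x) A (pnil z) hA i1 i2)
     (dcons (Layer b' (tr2 (triangle eg)) (pnil z) hG g1 g2) (dempty _)).
  by rewrite /= et; congr dcons; apply: layer_ext.
apply: diag_eq_trans k2 _.
have -> : vcat (iddiag (icons s (inil ((a' ## pone f) ## pone e))))
    (whiskerr (face A hA) (pone e)) =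
  vcat (dcons (idlayer s) (dempty _))
    (dcons (Layer (pnil x) A (pone e) hA i3 i4) (dempty _)).
  by rewrite /=; congr (dcons _ (dcons _ _)); apply: layer_ext.
exact: (diag_eq_vcat (diag_eq_sym k3) (diag_eq_refl (dcons _ _))).
Qed.

Lemma face_idl {C : partial_2category} {x z : ob C} (e : shom1 z z)
    (a b : seq1 C z x) (A : shom2 a b) hA :
  is_identity1 e -> nonempty a -> nonempty b ->
  ceq (face A hA) (whiskerl (pone e) (face A hA)).
Proof.
move=> he /cons_case[y0 [f [a' ea]]] /cons_case[y1 [g [b' eb]]]; subst a b.
have [hel her] := he.
have [hg eg] := hel _ g; have [hf eff] := hel _ f; have [hf' ef] := her _ (tr1 f).
have [I' hI'] : exists I' : shom2 (pone f) (ptwo e f),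
    cyclic (ptwo (tr1 f) (tr1 e)) (pone f) (tr2 (triangle ef)) I'.
  by apply: cyclic_ex; pathq.
have sl := slide_left _ _ hI'.
have [_ [J [hJ eJ]]] := solid_idl f he.
have hI : polygon (pone f) (ptwo e f) by left.
have e1 : pone f = pnil z ## pone f ## pnil y0 by [].
have e2 : ptwo e f = pnil z ## ptwo e f ## pnil y0 by [].
have e3 : ptwo e f = pone e ## pone f ## pnil y0 by [].
have k : diag_eq (dcons (Layer (pnil z) (tr2 (triangle eff)) (pnil y0) hI e1 e2) (dempty _))
                 (dcons (Layer (pnil z) I' (pnil y0) hI e1 e2) (dempty _)).
  have := sl y0 y0 (pnil y0) f (pnil y0) hf eff J (pone f) (pone f) (ptwo e f)
    (ptwo e f) hJ hI hI hJ e1 e1 e1 e2 e1 e2 e3 e3 => k.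
  apply: diag_eq_trans (diag_eq_sym (face_local e1 e1 _ eJ)) _.
  apply: diag_eq_trans k _.
  apply: closure_cons; exact: (face_local e3 e3 (dempty _) eJ).
have f1 : pone f ## a' = pnil z ## pone f ## a' by [].
have f2 : pone e ## pone f ## a' = pnil z ## ptwo e f ## a' by [].
have g1 : pone g ## b' = pnil z ## pone g ## b' by [].
have g2 : pone e ## pone g ## b' = pnil z ## ptwo e g ## b' by [].
have hG : polygon (pone g) (ptwo e g) by left.
have [s es] := triangle_step_inv eff hI f1 f2.
have [t et] := triangle_step_inv eg hG g1 g2.
exists (icons s (inil _)), (icons t (inil _)); apply: diag_eq_sym.
have i1 : pone f ## a' = pnil z ## (pone f ## a') ## pnil x by rewrite /= papp_nil.
have i2 : pone g ## b' = pnil z ## (pone g ## b') ## pnil x by rewrite /= papp_nil.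
have i3 : pone e ## pone f ## a' = pone e ## (pone f ## a') ## pnil x by pathq.
have i4 : pone e ## pone g ## b' = pone e ## (pone g ## b') ## pnil x by pathq.
have := sl x y1 a' g b' hg eg A _ _ _ _ hA hG hI hA i1 i2 g1 g2 f1 f2 i3 i4 => k2.
have k3 : diag_eq (dcons (idlayer s) (dempty _))
     (dcons (Layer (pnil z) I' a' hI f1 f2) (dempty _)).
  rewrite es; move: k; rewrite !face_eq.
  by move/(emb_eq (l := pnil z) (r := a') f1 f2); rewrite !emb_face.
have -> : vcat (face A hA) (iddiag (icons t (inil (pone e ## pone g ## b')))) =
   dcons (Layer (pnil z) A (pnil x) hA i1 i2)
     (dcons (Layer (pnil z) (tr2 (triangle eg)) b' hG g1 g2) (dempty _)).
  by rewrite /= et; congr dcons; apply: layer_ext.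
apply: diag_eq_trans k2 _.
have -> : vcat (iddiag (icons s (inil (pone e ## pone f ## a'))))
    (whiskerl (pone e) (face A hA)) =
  vcat (dcons (idlayer s) (dempty _))
    (dcons (Layer (pone e) A (pnil x) hA i3 i4) (dempty _)).
  by rewrite /=; congr (dcons _ (dcons _ _)); apply: layer_ext.
exact: (diag_eq_vcat (diag_eq_sym k3) (diag_eq_refl (dcons _ _))).
Qed.

(** [face_idr] and [face_idl] need a nonempty source and target. A face [F] that
lacks one of them acquires it when it is joined to [e], on either side, and [e]
can then be moved past the joined face. *)
Lemma bubble_slide {C : partial_2category} {z : ob C} (e : shom1 z z)
    {a b : seq1 C z z} (F : diag a b) {a1 b1 a2 b2 : seq1 C z z}
    (M1 : shom2 a1 b1) (M2 : shom2 a2 b2) h1 h2 :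
  is_identity1 e -> nonempty a1 -> nonempty b1 -> nonempty a2 -> nonempty b2 ->
  ceq (face M1 h1) (whiskerr F (pone e)) ->
  ceq (face M2 h2) (whiskerl (pone e) F) ->
  ceq (whiskerl (pone e) F) (whiskerr F (pone e)).
Proof.
move=> he na1 nb1 na2 nb2 k1 k2.
have u1 : ceq (whiskerl (pone e) F) (whiskerr (whiskerl (pone e) F) (pone e)).
  apply: (ceq_trans (ceq_sym k2) _).
  apply: (ceq_trans (face_idr M2 h2 he na2 nb2) _).
  exact: ceq_wr.
have u2 : ceq (whiskerr F (pone e)) (whiskerl (pone e) (whiskerr F (pone e))).
  apply: (ceq_trans (ceq_sym k1) _).
  apply: (ceq_trans (face_idl M1 h1 he na1 nb1) _).
  exact: ceq_wl.
apply: (ceq_trans u1 _); apply: ceq_sym; apply: (ceq_trans u2 _).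
exact: ceq_wlr.
Qed.

(** The triangle of the last edge [g] of the target and [e] is glued on top. *)
Lemma join_target_r {C : partial_2category} {x z : ob C} (e : shom1 z z)
    (a b : seq1 C x z) (A : shom2 a b) hA :
  is_identity1 e -> nonempty b ->
  exists (M : shom2 (a ## pone e) b) hM,
    ceq (face M hM) (whiskerr (face A hA) (pone e)).
Proof.
move=> [_ he] /snoc_case[y [b0 [g eb]]]; subst b; rename b0 into b; have [h eg] := he _ g.
have [M k] := merge_left_ex (s := pone e) (A := A)
  (B := triangle eg : shom2 (pone g ## pone e) (pone g))
  (or_intror (flexible_tri eg)) I.
have hM : polygon (a ## pone e) (b ## pone g).
  by left; apply: nonempty_appr.
exists M, hM.
have e1 : a ## pone e = pnil x ## a ## pone e ## pnil z by [].
have e2 : (b ## pone g) ## pone e = pnil x ## (b ## pone g) ## pone e ## pnil z by [].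
have e3 : (b ## pone g) ## pone e = b ## ptwo g e ## pnil z by pathq.
have e4 : b ## pone g = b ## pone g ## pnil z by [].
have f1 : a ## pone e = pnil x ## (a ## pone e) ## pnil z by pathq.
have f2 : b ## pone g = pnil x ## (b ## pone g) ## pnil z by pathq.
have hT : polygon (ptwo g e) (pone g) by left.
have [t et] := triangle_step eg hT e3 e4.
apply: ceq_trans (ceq_vcat_idr _ (icons t (inil _))).
apply/diag_eq_ceq/diag_eq_sym; rewrite -(face_eq M hM f1 f2).
have -> : whiskerr (face A hA) (pone e) =
    dcons (Layer (pnil x) A (pone e) hA e1 e2) (dempty _).
  by congr dcons; apply: layer_ext.
have := k x z _ _ _ _ (pnil x) (pnil z) (dempty _) hA hT hM e1 e2 e3 e4 f1 f2.
by rewrite /= et.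
Qed.

Lemma join_target_l {C : partial_2category} {x z : ob C} (e : shom1 z z)
    (a b : seq1 C z x) (A : shom2 a b) hA :
  is_identity1 e -> nonempty b ->
  exists (M : shom2 (pone e ## a) b) hM,
    ceq (face M hM) (whiskerl (pone e) (face A hA)).
Proof.
move=> [he _] /cons_case[y [g [b0 eb]]]; subst b; rename b0 into b; have [h eg] := he _ g.
have [M k] := merge_right_ex (l := pone e) (A := A)
  (B := triangle eg : shom2 (pone e ## pone g) (pone g))
  (or_intror (flexible_tri eg)) I.
have hM : polygon (pone e ## a) (pone g ## b) by left.
exists M, hM.
have e1 : pone e ## a = pone e ## a ## pnil x by rewrite papp_nil.
have e2 : pone e ## pone g ## b = pone e ## (pone g ## b) ## pnil x by pathq.
have e3 : pone e ## pone g ## b = pnil z ## ptwo e g ## b ## pnil x by pathq.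
have e3' : pone e ## pone g ## b = pnil z ## ptwo e g ## b by [].
have e4 : pone g ## b = pnil z ## pone g ## b ## pnil x by pathq.
have e4' : pone g ## b = pnil z ## pone g ## b by [].
have f1 : pone e ## a = pnil z ## (pone e ## a) ## pnil x by pathq.
have f2 : pone g ## b = pnil z ## (pone g ## b) ## pnil x by pathq.
have hT : polygon (ptwo e g) (pone g) by left.
have [t et] := triangle_step eg hT e3' e4'.
apply: ceq_trans (ceq_vcat_idr _ (icons t (inil _))).
apply/diag_eq_ceq/diag_eq_sym; rewrite -(face_eq M hM f1 f2).
have -> : whiskerl (pone e) (face A hA) =
    dcons (Layer (pone e) A (pnil x) hA e1 e2) (dempty _).
  by congr dcons; apply: layer_ext.
have := k z x _ _ _ _ (pnil z) (pnil x) (dempty _) hA hT hM e1 e2 e3 e4 f1 f2.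
have <- : Layer (pnil z) (triangle eg) b hT e3' e4' =
          Layer (pnil z) (triangle eg) (b ## pnil x) hT e3 e4.
  by apply: layer_ext; rewrite ?papp_nil.
by rewrite /= et.
Qed.

(** The triangle of the last edge [f] of the source and [e] is glued below. *)
Lemma join_source_r {C : partial_2category} {x z : ob C} (e : shom1 z z)
    (a b : seq1 C x z) (A : shom2 a b) hA :
  is_identity1 e -> nonempty a ->
  exists (M : shom2 a (b ## pone e)) hM,
    ceq (face M hM) (whiskerr (face A hA) (pone e)).
Proof.
move=> [_ he] /snoc_case[y [a0 [f ea]]]; subst a; rename a0 into a; have [h ef] := he _ f.
have [M k] := merge_right_ex (s := pone e)
  (A := tr2 (triangle ef) : shom2 (pone f) (pone f ## pone e)) (B := A)
  (or_introl (flexible_tr2 (flexible_tri ef))) I.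
have hM : polygon (a ## pone f) (b ## pone e) by left; apply: nonempty_appr.
exists M, hM.
have e1 : a ## pone f = a ## pone f ## pnil z by [].
have e2 : (a ## pone f) ## pone e = a ## ptwo f e ## pnil z by pathq.
have e3 : (a ## pone f) ## pone e = pnil x ## (a ## pone f) ## pone e ## pnil z by [].
have e4 : b ## pone e = pnil x ## b ## pone e ## pnil z by [].
have f1 : a ## pone f = pnil x ## (a ## pone f) ## pnil z by pathq.
have f2 : b ## pone e = pnil x ## (b ## pone e) ## pnil z by pathq.
have hT : polygon (pone f) (ptwo f e) by left.
have [t et] := triangle_step_inv ef hT e1 e2.
apply: ceq_trans (ceq_vcat_idl (icons t (inil _)) _).
apply/diag_eq_ceq/diag_eq_sym; rewrite -(face_eq M hM f1 f2).
have -> : whiskerr (face A hA) (pone e) =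
    dcons (Layer (pnil x) A (pone e) hA e3 e4) (dempty _).
  by congr dcons; apply: layer_ext.
have := k x z _ _ _ _ (pnil x) (pnil z) (dempty _) hT hA hM e1 e2 e3 e4 f1 f2.
by rewrite /= et.
Qed.

Lemma join_source_l {C : partial_2category} {x z : ob C} (e : shom1 z z)
    (a b : seq1 C z x) (A : shom2 a b) hA :
  is_identity1 e -> nonempty a ->
  exists (M : shom2 a (pone e ## b)) hM,
    ceq (face M hM) (whiskerl (pone e) (face A hA)).
Proof.
move=> [he _] /cons_case[y [f [a0 ea]]]; subst a; rename a0 into a; have [h ef] := he _ f.
have [M k] := merge_left_ex (l := pone e)
  (A := tr2 (triangle ef) : shom2 (pone f) (pone e ## pone f)) (B := A)
  (or_introl (flexible_tr2 (flexible_tri ef))) I.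
have hM : polygon (pone f ## a) (pone e ## b) by left.
exists M, hM.
have e1 : pone f ## a = pnil z ## pone f ## a ## pnil x by pathq.
have e1' : pone f ## a = pnil z ## pone f ## a by [].
have e2 : pone e ## pone f ## a = pnil z ## ptwo e f ## a ## pnil x by pathq.
have e2' : pone e ## pone f ## a = pnil z ## ptwo e f ## a by [].
have e3 : pone e ## pone f ## a = pone e ## (pone f ## a) ## pnil x by pathq.
have e4 : pone e ## b = pone e ## b ## pnil x by pathq.
have f1 : pone f ## a = pnil z ## (pone f ## a) ## pnil x by pathq.
have f2 : pone e ## b = pnil z ## (pone e ## b) ## pnil x by pathq.
have hT : polygon (pone f) (ptwo e f) by left.
have [t et] := triangle_step_inv ef hT e1' e2'.
apply: ceq_trans (ceq_vcat_idl (icons t (inil _)) _).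
apply/diag_eq_ceq/diag_eq_sym; rewrite -(face_eq M hM f1 f2).
have -> : whiskerl (pone e) (face A hA) =
    dcons (Layer (pone e) A (pnil x) hA e3 e4) (dempty _).
  by congr dcons; apply: layer_ext.
have := k z x _ _ _ _ (pnil z) (pnil x) (dempty _) hT hA hM e1 e2 e3 e4 f1 f2.
have <- : Layer (pnil z) (tr2 (triangle ef)) a hT e1' e2' =
          Layer (pnil z) (tr2 (triangle ef)) (a ## pnil x) hT e1 e2.
  by apply: layer_ext; rewrite ?papp_nil.
by rewrite /= et.
Qed.

Lemma nonempty_app {O : Type} {E : O -> O -> Type} {x y z : O}
    (p : path E x y) (q : path E y z) :
  nonempty (p ## q) -> nonempty p \/ nonempty q.
Proof. by case: p q => [a|a b c e p] q /=; [right|left]. Qed.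

Lemma slide_face {C : partial_2category} {z : ob C} (e : shom1 z z)
    {a b : seq1 C z z} (A : shom2 a b) hA :
  is_identity1 e ->
  ceq (whiskerl (pone e) (face A hA)) (whiskerr (face A hA) (pone e)).
Proof.
move=> he; case: (classic (nonempty a)) => na; last first.
  have nb : nonempty b by case: (hA).
  have [M1 [h1 k1]] := join_target_r A hA he nb.
  have [M2 [h2 k2]] := join_target_l A hA he nb.
  apply: (bubble_slide he _ nb _ nb k1 k2); last by [].
  exact: nonempty_appr.
have [M1 [h1 k1]] := join_source_r A hA he na.
have [M2 [h2 k2]] := join_source_l A hA he na.
apply: (bubble_slide he na _ na _ k1 k2); last by [].
exact: nonempty_appr.
Qed.

Lemma emb_wlr {C : partial_2category} {x y x' y' : ob C} {a b : seq1 C x' y'}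
    {p q : seq1 C x y} (l : seq1 C x x') (D : diag a b) (r : seq1 C y' y) e f :
  ceq (emb l D r e f : diag p q) (whiskerl l (whiskerr D r)).
Proof. exact/ceq_sym/ceq_wlr_emb. Qed.

(** If the sequence [r] on the right of the face is nonempty, [e] is inserted
there, away from the face. Otherwise [face_idr] applies, or else the sequence on
the left is nonempty, and [e] is inserted there and slides past the face. *)
Lemma layer_idr {C : partial_2category} {x z : ob C} (e : shom1 z z)
    {p q : seq1 C x z} (L : layer p q) :
  is_identity1 e -> nonempty p -> nonempty q ->
  ceq (dcons L (dempty q)) (whiskerr (dcons L (dempty q)) (pone e)).
Proof.
move=> he np nq; case: L => x' y' l a b A r h e1 e2.
rewrite -(emb_face A h e1 e2); have [F eF] : exists F, F = face A h by eexists.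
rewrite -eF.
have k0 := emb_wlr F e1 e2.
apply: (ceq_trans k0); apply: ceq_sym; apply: (ceq_trans (ceq_wr _ k0)).
apply: (ceq_trans (ceq_sym (ceq_wlr _ _ _))).
apply: (ceq_trans (ceq_wl l (ceq_wrr _ _ _))).
apply: ceq_sym; case: (path_case r) => [[ez er]|hr]; last first.
  have nr : nonempty r by case: hr => m [? [? ->]].
  have [S] := idseq_idr he nr.
  by apply: ceq_wl; apply: ceq_exchr S.
subst y' r => /=.
apply: (ceq_trans (ceq_wl l (ceq_wr0 F))).
case: (classic (nonempty a /\ nonempty b)) => [[na nb]|nab].
  by apply: ceq_wl; rewrite eF; apply: face_idr.
have ex : x' = z.
  case: (path_case a) => [[ex ea] //|[m [e0 [a0 ea]]]].
  case: (path_case b) => [[ex eb] //|[m' [e0' [b0 eb]]]].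
  by case: nab; rewrite ea eb.
subst x'; have nl : nonempty l.
  apply: NNPP => nl; apply: nab; split.
    by move: np; rewrite e1 /= papp_nil => /nonempty_app[/nl|].
  by move: nq; rewrite e2 /= papp_nil => /nonempty_app[/nl|].
have [S] := idseq_idr he nl.
apply: (ceq_trans (ceq_exchl F S)).
apply: (ceq_trans (ceq_sym (ceq_wll _ _ _))).
by apply: ceq_wl; rewrite eF; apply: slide_face.
Qed.

Lemma layer_idl {C : partial_2category} {x z : ob C} (e : shom1 z z)
    {p q : seq1 C z x} (L : layer p q) :
  is_identity1 e -> nonempty p -> nonempty q ->
  ceq (dcons L (dempty q)) (whiskerl (pone e) (dcons L (dempty q))).
Proof.
move=> he np nq; case: L => x' y' l a b A r h e1 e2.
rewrite -(emb_face A h e1 e2); have [F eF] : exists F, F = face A h by eexists.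
rewrite -eF.
have k0 := emb_wlr F e1 e2.
apply: (ceq_trans k0); apply: ceq_sym; apply: (ceq_trans (ceq_wl _ k0)).
apply: (ceq_trans (ceq_wll _ _ _)).
apply: ceq_sym; case: (path_case l) => [[ex el]|hl]; last first.
  have nl : nonempty l by case: hl => m [? [? ->]].
  have [S] := idseq_idl he nl.
  exact: ceq_exchl S.
subst x' l; rewrite /=; apply: (ceq_trans (ceq_wl0 _)).
case: (classic (nonempty a /\ nonempty b)) => [[na nb]|nab].
  apply: (ceq_trans (ceq_wr r (_ : ceq F (whiskerl (pone e) F)))).
    by rewrite eF; apply: face_idl.
  by apply: ceq_sym; exact: (ceq_wlr (pone e) F r).
have ey : y' = z.
  case: (path_case a) => [[ey ea] //|[m [e0 [a0 ea]]]].
  case: (path_case b) => [[ey eb] //|[m' [e0' [b0 eb]]]].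
  by case: nab; rewrite ea eb.
subst y'; have nr : nonempty r.
  apply: NNPP => nr; apply: nab; split.
    by move: np; rewrite e1 /= => /nonempty_app[|/nr].
  by move: nq; rewrite e2 /= => /nonempty_app[|/nr].
have [S] := idseq_idl he nr.
apply: (ceq_trans (ceq_exchr F S)).
apply: (ceq_trans (ceq_sym (ceq_wrr _ _ _))).
apply: ceq_sym; apply: (ceq_trans (ceq_wlr (pone e) F r)).
by apply: ceq_wr; rewrite eF; apply: slide_face.
Qed.

(** Diagrams whose current sequence is never empty. *)
Fixpoint thick {C : partial_2precategory} {x y : ob C} {p q : seq1 C x y}
    (D : diag p q) : Prop :=
  match D with
  | dempty p => nonempty p
  | @dcons _ _ _ p _ _ _ D' => nonempty p /\ thick D'
  end.

Lemma thick_vcat {C : partial_2precategory} {x y : ob C} {p q r : seq1 C x y}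
    (D : diag p q) (E : diag q r) : thick D -> thick E -> thick (vcat D E).
Proof. by elim: D E => //= {}p {}q t L D IH E [np hD] hE; split=> //; apply: IH. Qed.

Lemma thick_src {C : partial_2precategory} {x y : ob C} {p q : seq1 C x y}
    (D : diag p q) : thick D -> nonempty p.
Proof. by case: D => [r|r s t L D] //= []. Qed.

Lemma thick_wl {C : partial_2precategory} {x y z : ob C} {p q : seq1 C x y}
    (s : seq1 C z x) (D : diag p q) : nonempty s -> thick (whiskerl s D).
Proof.
move=> ns; elim: D => [r|r t u L D IH] /=; first exact: nonempty_appl.
by split=> //; apply: nonempty_appl.
Qed.

Lemma thick_wr {C : partial_2precategory} {x y z : ob C} {p q : seq1 C x y}
    (D : diag p q) (s : seq1 C y z) : nonempty s -> thick (whiskerr D s).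
Proof.
move=> ns; elim: D => [r|r t u L D IH] /=; first exact: nonempty_appr.
by split=> //; apply: nonempty_appr.
Qed.

Lemma thick_iddiag {C : partial_2precategory} {x y : ob C} {p q : seq1 C x y}
    (S : idseq p q) : nonempty p -> thick (iddiag S).
Proof.
elim: S => //= {}p p' {}q s S IH np; split=> //; apply: IH.
by case: (idstep_nonempty s).
Qed.

(** The two halves of a diagram that passes through the empty sequence can be
swept in the other order, where the current sequence is never empty: the
Eckmann-Hilton argument. *)
Lemma thicken {C : partial_2category} {x y : ob C} {p q : seq1 C x y}
    (D : diag p q) :
  nonempty p -> nonempty q ->
  exists p' q' (D' : diag p' q'), thick D' /\ ceq D D'.
Proof.
elim: D => {p q} [p|p q r L D IH] np nr.
  by exists p, p, (dempty p); split=> //; apply: ceq_refl.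
case: (path_case q) => [[exy eq]|hq]; last first.
  have nq : nonempty q by case: hq => m [? [? ->]].
  have [p' [q' [D' [hD' k]]]] := IH nq nr; have [T _] := k.
  exists p, q', (dcons L (vcat (iddiag T) D')); split=> /=.
    by split=> //; apply: thick_vcat hD'; apply: thick_iddiag.
  apply: (@ceq_vcat _ _ _ _ _ _ _ _ _ (dcons L (dempty q)) D (dcons L (dempty q))).
    exact: ceq_refl.
  exact: ceq_trans k (ceq_sym (ceq_vcat_idl _ _)).
subst y q.
exists (p ## pnil x), (pnil x ## r),
  (vcat (whiskerl p D) (whiskerr (dcons L (dempty (pnil x))) r)); split.
  by apply: thick_vcat; [apply: thick_wl|apply: thick_wr].
have := diag_interchange (dcons L (dempty (pnil x))) D.
move/diag_eq_ceq => k; apply: ceq_trans k.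
have k1 := ceq_wr0 (dcons L (dempty (pnil x))).
have k2 := ceq_wl0 D.
exact: ceq_sym (ceq_vcat k1 k2).
Qed.

Lemma ceq_dempty {C : partial_2precategory} {x y : ob C} {p q : seq1 C x y}
    (S : idseq p q) : ceq (dempty p) (dempty q).
Proof. by exists S, S; rewrite vcat_dempty. Qed.

Lemma diag_idr {C : partial_2category} {x z : ob C} (e : shom1 z z)
    {p q : seq1 C x z} (D : diag p q) :
  is_identity1 e -> nonempty p -> nonempty q ->
  ceq D (whiskerr D (pone e)).
Proof.
move=> he np nq; have [p' [q' [D' [hD' k]]]] := thicken D np nq.
apply: (ceq_trans k); apply: ceq_sym; apply: (ceq_trans (ceq_wr _ k)).
apply: ceq_sym; elim: D' {k} hD' => {p q np nq D p' q'} [p|p q r L D IH] /=.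
  by move/(idseq_idr he) => [S]; apply: ceq_dempty.
move=> [np hD].
apply: (@ceq_vcat _ _ _ _ _ _ _ _ _ (dcons L (dempty q)) D
  (whiskerr (dcons L (dempty q)) (pone e))); last exact: IH.
exact: layer_idr he np (thick_src hD).
Qed.

Lemma diag_idl {C : partial_2category} {x z : ob C} (e : shom1 z z)
    {p q : seq1 C z x} (D : diag p q) :
  is_identity1 e -> nonempty p -> nonempty q ->
  ceq D (whiskerl (pone e) D).
Proof.
move=> he np nq; have [p' [q' [D' [hD' k]]]] := thicken D np nq.
apply: (ceq_trans k); apply: ceq_sym; apply: (ceq_trans (ceq_wl _ k)).
apply: ceq_sym; elim: D' {k} hD' => {p q np nq D p' q'} [p|p q r L D IH] /=.
  by move/(idseq_idl he) => [S]; apply: ceq_dempty.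
move=> [np hD].
apply: (@ceq_vcat _ _ _ _ _ _ _ _ _ (dcons L (dempty q)) D
  (whiskerl (pone e) (dcons L (dempty q)))); last exact: IH.
exact: layer_idl he np (thick_src hD).
Qed.

Lemma insertr {C : partial_2category} {x y z : ob C} (e : shom1 z z)
    {p q : seq1 C x z} (r : seq1 C z y) (D : diag p q) :
  is_identity1 e -> nonempty (p ## r) -> nonempty (q ## r) ->
  ceq (whiskerr D r) (whiskerr D (pone e ## r)).
Proof.
move=> he np nq; case: (path_case r) => [[ey er]|hr]; last first.
  have nr : nonempty r by case: hr => m [? [? ->]].
  by have [S] := idseq_idl he nr; apply: ceq_exchr S.
subst y r; apply: (ceq_trans (ceq_wr0 _)); rewrite papp_nil.
by apply: diag_idr => //; [move: np|move: nq]; rewrite /= papp_nil.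
Qed.

Lemma insertl {C : partial_2category} {x y z : ob C} (e : shom1 z z)
    {p q : seq1 C z y} (l : seq1 C x z) (D : diag p q) :
  is_identity1 e -> nonempty (l ## p) -> nonempty (l ## q) ->
  ceq (whiskerl l D) (whiskerl l (whiskerl (pone e) D)).
Proof.
move=> he np nq; apply: ceq_sym; apply: (ceq_trans (ceq_wll _ _ _)); apply: ceq_sym.
case: (path_case l) => [[ex el]|hl]; last first.
  have nl : nonempty l by case: hl => m [? [? ->]].
  by have [S] := idseq_idr he nl; apply: ceq_exchl S.
subst z l; apply: (ceq_trans (ceq_wl0 _)).
exact: diag_idl.
Qed.

(** The two factors are swept one after the other, and [e] is inserted in each
sweep. This needs nonempty sequences; if the one between the two sweeps is empty,
the other order is used. *)
Lemma insert_identity {C : partial_2category} {x y z : ob C} (e : shom1 z z)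
    {p q : seq1 C x z} {p' q' : seq1 C z y} (D : diag p q) (D' : diag p' q') :
  is_identity1 e -> nonempty (p ## p') -> nonempty (q ## q') ->
  ceq (hcat D D') (hcat D (hcat (dempty (pone e)) D')).
Proof.
move=> he np nq.
case: (classic (nonempty (q ## p'))) => nm.
  by apply: ceq_vcat; [apply: insertr|apply: insertl].
have nm' : nonempty (p ## q').
  case: (nonempty_app np) => h; first exact: nonempty_appl.
  by case: nm; apply: nonempty_appr.
have k1 := diag_eq_ceq (diag_interchange D D').
have k2 := diag_eq_ceq (diag_interchange D (whiskerl (pone e) D')).
apply: (ceq_trans k1); apply: ceq_sym; apply: (ceq_trans k2); apply: ceq_sym.
by apply: ceq_vcat; [apply: insertl|apply: insertr].
Qed.

(** * Classes of sequences and diagrams *)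

(** Classes are predicates, so equivalent elements have equal classes by
extensionality. *)
Lemma clsP {T : Type} {R : T -> T -> Prop} (a b : T) :
  equivalence T R -> cls R a = cls R b <-> R a b.
Proof.
move=> [Rr Rt Rs]; split=> [e|h].
  have e' : R a = R b := f_equal (@proj1_sig _ _) e.
  by rewrite e'; apply: Rr.
have e : R a = R b.
  apply: functional_extensionality => c; apply: propositional_extensionality.
  by split=> h'; [apply: Rt h'; apply: Rs|apply: Rt h'].
rewrite /cls; move: (ex_intro _ a _) (ex_intro _ b _); rewrite e => i j.
by rewrite (proof_irrelevance _ i j).
Qed.

Lemma quot_rep {T : Type} {R : T -> T -> Prop} (c : quot R) :
  exists t, c = cls R t.
Proof. by case: c => P [t e]; exists t; subst P. Qed.

Lemma cls1P {C : partial_2precategory} {x y : ob C} (p q : seq1 C x y) :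
  cls1 p = cls1 q <-> clos_refl_sym_trans _ step1 p q.
Proof. by apply: clsP; apply: clos_rst_is_equiv. Qed.

Lemma cls2_seqP {C : partial_2precategory} {x y : ob C} {p q : seq1 C x y}
    (D E : diag p q) : cls2_seq D = cls2_seq E <-> diag_eq D E.
Proof.
apply: clsP; split.
- exact: diag_eq_refl.
- move=> a b c; exact: diag_eq_trans.
- move=> a b; exact: diag_eq_sym.
Qed.

Lemma step1_emb {C : partial_2precategory} {x y x' y' : ob C}
    (l : seq1 C x x') (p q : seq1 C x' y') (r : seq1 C y' y) :
  step1 p q -> step1 (l ## p ## r) (l ## q ## r).
Proof.
case=> [{}p {}q [x1 m y1 k a b h t e e']|z k e t he].
  by apply: step1_comp; apply: (@Composition C x y _ _ x1 m y1 (l ## k) a b h (t ## r)); pathq.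
have -> : l ## (k ## pone e ## t) ## r = (l ## k) ## pone e ## (t ## r) by pathq.
have -> : l ## (k ## t) ## r = (l ## k) ## (t ## r) by pathq.
exact: step1_id.
Qed.

Lemma cls1_emb {C : partial_2precategory} {x y x' y' : ob C}
    (l : seq1 C x x') (p q : seq1 C x' y') (r : seq1 C y' y) :
  cls1 p = cls1 q -> cls1 (l ## p ## r) = cls1 (l ## q ## r).
Proof.
move/cls1P => h; apply/cls1P; elim: h => {p q} [p q h|p|p q _ IH|p q s _ IH _ IH'].
- by apply: rst_step; apply: step1_emb.
- exact: rst_refl.
- exact: rst_sym.
- exact: rst_trans IH IH'.
Qed.

Lemma cls1_app {C : partial_2precategory} {x y z : ob C}
    {p p' : seq1 C x y} {q q' : seq1 C y z} :
  cls1 p = cls1 p' -> cls1 q = cls1 q' -> cls1 (p ## q) = cls1 (p' ## q').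
Proof.
move=> hp hq.
have := @cls1_emb C x z x y (pnil x) p p' q hp => /= ->.
by have := @cls1_emb C x z y z p' q q' (pnil z) hq; rewrite !papp_nil.
Qed.

(** ** Regular representatives *)

(** The empty sequence is joined to no other one by compositions and
decompositions, although it is identified with the identity if there is one. All
sequences are made comparable by appending that identity to them. *)
Definition tail {C : partial_2precategory} {y : ob C} (t : seq1 C y y) : Prop :=
  (exists e, is_identity1 e /\ t = pone e) \/
  (~ (exists e : shom1 y y, is_identity1 e)) /\ t = pnil y.

Lemma tail_ex {C : partial_2precategory} (y : ob C) :
  exists t : seq1 C y y, tail t.
Proof.
case: (classic (exists e : shom1 y y, is_identity1 e)) => [[e he]|h].
  by exists (pone e); left; exists e.
by exists (pnil y); right.
Qed.

Lemma tail_idseq {C : partial_2precategory} {y : ob C} (t t' : seq1 C y y) :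
  tail t -> tail t' -> inhabited (idseq t t').
Proof.
case=> [[e [he ->]]|[h ->]]; case=> [[e' [he' ->]]|[h' ->]].
- have [S] := idseq_idr he' (I : nonempty (pone e)).
  have [T] := idseq_idl he (I : nonempty (pone e')).
  by split; apply: idcat S (idinv T).
- by case: h'; exists e.
- by case: h; exists e'.
- by split; apply: inil.
Qed.

Lemma nonempty_regular {C : partial_2precategory} {x y : ob C} (p : seq1 C x y) :
  nonempty p -> regular p.
Proof. by case: p. Qed.

Lemma regular_nonempty {C : partial_2precategory} {x y : ob C} (p : seq1 C x y)
    (e : shom1 y y) : is_identity1 e -> regular p -> nonempty p.
Proof. by case: p e => //= a e he []; exists e. Qed.

Lemma tail_regular {C : partial_2precategory} {x y : ob C} (p : seq1 C x y)
    (t : seq1 C y y) : tail t -> regular (p ## t).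
Proof.
case=> [[e [he ->]]|[h ->]].
  by apply/nonempty_regular/nonempty_appr.
by rewrite papp_nil; case: p h.
Qed.

Lemma regular_tail {C : partial_2precategory} {x y : ob C} (p : seq1 C x y)
    (t : seq1 C y y) : regular p -> tail t -> inhabited (idseq p (p ## t)).
Proof.
move=> hp [[e [he ->]]|[h ->]].
  by apply: (idseq_idr he); apply: (regular_nonempty he hp).
by rewrite papp_nil; split; apply: inil.
Qed.

(** The sequence [p] can be empty only if [e] lives at its target, and then the
tail is an identity. *)
Lemma tail_nonempty {C : partial_2precategory} {z y : ob C} (e : shom1 z z)
    (p : seq1 C z y) (t : seq1 C y y) :
  is_identity1 e -> tail t -> nonempty (p ## t).
Proof.
case: p e t => [a|a b c f p] e t he ht //=.
by case: ht => [[e' [_ ->]]|[[]]] //; exists e.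
Qed.

Lemma cls1_tail {C : partial_2precategory} {x y : ob C} (p : seq1 C x y)
    (t : seq1 C y y) : tail t -> cls1 (p ## t) = cls1 p.
Proof.
case=> [[e [he ->]]|[h ->]]; last by rewrite papp_nil.
apply/cls1P/rst_step.
by have := step1_id p (pnil y) he; rewrite !papp_nil.
Qed.

Lemma cls1_idseq {C : partial_2precategory} {x y : ob C} (p q : seq1 C x y)
    (t : seq1 C y y) :
  tail t -> cls1 p = cls1 q -> inhabited (idseq (p ## t) (q ## t)).
Proof.
move=> ht /cls1P; elim=> {p q} [p q|p|p q _ [S]|p q s _ [S] _ [T]].
- case=> [{}p {}q c|z l e r he].
    by have [S] := iddiag_wr (icons (Compose c) (inil _)) t; split.
  have nr := tail_nonempty r he ht.
  have [T] := idseq_idl he nr.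
  by apply: (idseq_embed (l := l) (r := pnil y) (idinv T)); pathq.
- by split; apply: inil.
- by split; apply: idinv.
- by split; apply: idcat S T.
Qed.

Lemma regular_idseq {C : partial_2precategory} {x y : ob C} (p q : seq1 C x y) :
  regular p -> regular q -> cls1 p = cls1 q -> inhabited (idseq p q).
Proof.
move=> hp hq e; have [t ht] := tail_ex y.
have [S] := regular_tail hp ht; have [T] := cls1_idseq ht e.
have [U] := regular_tail hq ht.
by split; apply: idcat S (idcat T (idinv U)).
Qed.

(** ** Equality of 2-morphisms *)

(** Equality of the 2-morphisms of the completion that are represented by [D]
and [D'], see [class2P]. *)
Definition tail_eq {C : partial_2precategory} {x y : ob C} {p q p' q' : seq1 C x y}
    (D : diag p q) (D' : diag p' q') : Prop :=
  forall t, tail t -> ceq (whiskerr D t) (whiskerr D' t).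

Lemma tail_eq_intro {C : partial_2category} {x y : ob C} {p q p' q' : seq1 C x y}
    {D : diag p q} {D' : diag p' q'} {t : seq1 C y y} :
  tail t -> ceq (whiskerr D t) (whiskerr D' t) -> tail_eq D D'.
Proof.
move=> ht h t' ht'; have [S] := tail_idseq ht' ht.
apply: (ceq_trans (ceq_exchr D S)); apply: (ceq_trans h).
exact: ceq_sym (ceq_exchr D' S).
Qed.

Lemma ceq_tail_eq {C : partial_2precategory} {x y : ob C} {p q p' q' : seq1 C x y}
    {D : diag p q} {D' : diag p' q'} : ceq D D' -> tail_eq D D'.
Proof. by move=> h t _; apply: ceq_wr. Qed.

Lemma diag_eq_tail_eq {C : partial_2precategory} {x y : ob C} {p q : seq1 C x y}
    {D D' : diag p q} : diag_eq D D' -> tail_eq D D'.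
Proof. by move=> h; apply/ceq_tail_eq/diag_eq_ceq. Qed.

Lemma tail_eq_refl {C : partial_2precategory} {x y : ob C} {p q : seq1 C x y}
    (D : diag p q) : tail_eq D D.
Proof. exact: diag_eq_tail_eq. Qed.

Lemma tail_eq_sym {C : partial_2category} {x y : ob C} {p q p' q' : seq1 C x y}
    {D : diag p q} {D' : diag p' q'} : tail_eq D D' -> tail_eq D' D.
Proof. by move=> h t ht; apply/ceq_sym/h. Qed.

Lemma tail_eq_trans {C : partial_2category} {x y : ob C}
    {p q p' q' p'' q'' : seq1 C x y}
    {D : diag p q} {D' : diag p' q'} {D'' : diag p'' q''} :
  tail_eq D D' -> tail_eq D' D'' -> tail_eq D D''.
Proof. by move=> h h' t ht; apply: ceq_trans (h t ht) (h' t ht). Qed.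

Lemma tail_eq_vcat {C : partial_2category} {x y : ob C}
    {p q r p' q' r' : seq1 C x y} {D : diag p q} {E : diag q r}
    {D' : diag p' q'} {E' : diag q' r'} :
  tail_eq D D' -> tail_eq E E' -> tail_eq (vcat D E) (vcat D' E').
Proof.
move=> h h' t ht; rewrite !whiskerr_vcat.
exact: ceq_vcat (h t ht) (h' t ht).
Qed.

Lemma tail_eq_dempty {C : partial_2precategory} {x y : ob C} {p q : seq1 C x y} :
  cls1 p = cls1 q -> tail_eq (dempty p) (dempty q).
Proof. by move=> e t ht; have [S] := cls1_idseq ht e; apply: ceq_dempty. Qed.

Lemma hcat_wr {C : partial_2category} {x y z t : ob C}
    {p q : seq1 C x y} {p' q' : seq1 C y z} (D : diag p q) (E : diag p' q')
    (s : seq1 C z t) :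
  ceq (whiskerr (hcat D E) s) (hcat D (whiskerr E s)).
Proof.
rewrite whiskerr_vcat; apply: ceq_vcat; first exact: ceq_wrr.
exact: ceq_sym (ceq_wlr _ _ _).
Qed.

Lemma hcat_mid {C : partial_2category} {x y z t : ob C}
    {p q : seq1 C x y} (s : seq1 C y z) {p' q' : seq1 C z t} (D : diag p q)
    (E : diag p' q') :
  ceq (hcat D (whiskerl s E)) (hcat (whiskerr D s) E).
Proof.
apply: ceq_vcat; first exact: ceq_sym (ceq_wrr _ _ _).
exact: ceq_wll.
Qed.

(** The tail makes the outer sequences nonempty, by [tail_nonempty]. *)
Lemma tail_eq_insert {C : partial_2category} {x y z : ob C} (e : shom1 z z)
    {p q : seq1 C x z} {p' q' : seq1 C z y} (D : diag p q) (D' : diag p' q') :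
  is_identity1 e -> tail_eq (hcat D D') (hcat D (hcat (dempty (pone e)) D')).
Proof.
move=> he t ht.
apply: (ceq_trans (hcat_wr D D' t)); apply: ceq_sym.
apply: (ceq_trans (hcat_wr D (hcat (dempty (pone e)) D') t)).
apply: (ceq_trans (ceq_hcat (ceq_refl D) (hcat_wr (dempty (pone e)) D' t))).
apply: ceq_sym; apply: (insert_identity D (whiskerr D' t) he);
  by apply: nonempty_appr; apply: (tail_nonempty _ he ht).
Qed.

(** The tail of the common object can be inserted between the factors. *)
Lemma tail_eq_hcat {C : partial_2category} {x y z : ob C}
    {p q p1 q1 : seq1 C x y} {p' q' p1' q1' : seq1 C y z} {D : diag p q}
    {E : diag p' q'} {D1 : diag p1 q1} {E1 : diag p1' q1'} :
  tail_eq D D1 -> tail_eq E E1 -> tail_eq (hcat D E) (hcat D1 E1).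
Proof.
move=> h h' t ht; have [s hs] := tail_ex y.
have mid (a b : seq1 C x y) (a' b' : seq1 C y z) (F : diag a b) (G : diag a' b') :
    ceq (whiskerr (hcat F G) t) (hcat (whiskerr F s) (whiskerr G t)).
  case: (hs) => [[e [he es]]|[_ es]]; subst s.
    apply: (ceq_trans (tail_eq_insert F G he ht)).
    apply: (ceq_trans (hcat_wr _ _ _)).
    apply: (ceq_trans (ceq_hcat (ceq_refl F) (hcat_wr _ _ _))).
    exact: hcat_mid.
  apply: (ceq_trans (hcat_wr _ _ _)).
  exact: ceq_hcat (ceq_sym (ceq_wr0 F)) (ceq_refl _).
apply: (ceq_trans (mid _ _ _ _ D E)); apply: ceq_sym.
apply: (ceq_trans (mid _ _ _ _ D1 E1)); apply: ceq_sym.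
exact: ceq_hcat (h s hs) (h' t ht).
Qed.

(** If the tail is an identity, regularity makes both sequences nonempty. *)
Lemma regular_ceq {C : partial_2category} {x y : ob C} {p q : seq1 C x y}
    (D : diag p q) (t : seq1 C y y) :
  regular p -> regular q -> tail t -> ceq D (whiskerr D t).
Proof.
move=> hp hq [[e [he ->]]|[_ ->]]; last exact: ceq_sym (ceq_wr0 D).
by apply: (diag_idr D he); apply: (regular_nonempty he).
Qed.

Lemma tail_eq_ceq {C : partial_2category} {x y : ob C} {p q p' q' : seq1 C x y}
    {D : diag p q} {D' : diag p' q'} :
  regular p -> regular q -> regular p' -> regular q' -> tail_eq D D' -> ceq D D'.
Proof.
move=> hp hq hp' hq' h; have [t ht] := tail_ex y.
apply: (ceq_trans (regular_ceq D hp hq ht)).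
apply: (ceq_trans (h t ht)).
exact: ceq_sym (regular_ceq D' hp' hq' ht).
Qed.

(** [cls2] with arbitrary names for the classes of the source and the target. *)
Definition class2 {C : partial_2precategory} {x y : ob C} {f g : hom1 x y}
    {p q : seq1 C x y} (hp : cls1 p = f) (hq : cls1 q = g) (D : diag p q) :
    hom2 f g :=
  cls (clos_refl_sym_trans _ (@rep2_step C x y f g)) (Rep2 hp hq D).

Lemma ceq_rep {C : partial_2category} {x y : ob C} {f g : hom1 x y}
    {p q p' q' : seq1 C x y} hp hq hp' hq' {D : diag p q} {D' : diag p' q'} :
  ceq D D' ->
  clos_refl_sym_trans (rep2 f g) (@rep2_step C x y f g)
    (Rep2 hp hq D) (Rep2 hp' hq' D').
Proof.
move=> [S [T h]]; apply: rst_step; apply: (rep2_canonical _ _ _ _ (S := idinv S) (T := T)).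
apply: diag_eq_trans (diag_eq_vcat (diag_eq_refl _) (diag_eq_sym h)) _.
rewrite -vcat_assoc.
exact: (diag_eq_vcat (idinvl S) (diag_eq_refl D')).
Qed.

Lemma tail_eq_rep {C : partial_2category} {x y : ob C} {f g : hom1 x y}
    {p q p' q' : seq1 C x y} hp hq hp' hq' {D : diag p q} {D' : diag p' q'} :
  tail_eq D D' ->
  clos_refl_sym_trans (rep2 f g) (@rep2_step C x y f g)
    (Rep2 hp hq D) (Rep2 hp' hq' D').
Proof.
move=> h; have [t ht] := tail_ex y.
have add (a b : seq1 C x y) ha hb (F : diag a b) ha' hb' :
    clos_refl_sym_trans (rep2 f g) (@rep2_step C x y f g)
      (Rep2 ha hb F) (Rep2 ha' hb' (whiskerr F t)).
  case: (ht) => [[e [he et]]|[_ et]]; subst t; last first.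
    exact/ceq_rep/ceq_sym/ceq_wr0.
  have ha0 : cls1 (a ## pnil y) = f by rewrite papp_nil.
  have hb0 : cls1 (b ## pnil y) = g by rewrite papp_nil.
  apply: rst_trans (ceq_rep ha hb ha0 hb0 (_ : ceq F (hcat F (dempty (pnil y))))) _.
    rewrite /hcat /= vcat_dempty; exact: ceq_sym (ceq_wr0 F).
  apply: rst_trans (rst_step _ _ _ _ (rep2_identity F (dempty (pnil y)) ha0 hb0 ha' hb' he)) _.
  by apply: ceq_rep; rewrite /hcat /= vcat_dempty; apply: ceq_refl.
have hpt : cls1 (p ## t) = f by rewrite cls1_tail.
have hqt : cls1 (q ## t) = g by rewrite cls1_tail.
have hpt' : cls1 (p' ## t) = f by rewrite cls1_tail.
have hqt' : cls1 (q' ## t) = g by rewrite cls1_tail.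
apply: rst_trans (add _ _ _ _ D hpt hqt) _.
apply: rst_trans (rst_sym _ _ _ _ (add _ _ _ _ D' hpt' hqt')).
exact: ceq_rep (h t ht).
Qed.

Definition rep_teq {C : partial_2precategory} {x y : ob C} {f g : hom1 x y}
    (r r' : rep2 f g) : Prop :=
  match r, r' with Rep2 _ _ D, Rep2 _ _ D' => tail_eq D D' end.

Lemma rep2_teq {C : partial_2category} {x y : ob C} {f g : hom1 x y}
    (r r' : rep2 f g) :
  clos_refl_sym_trans (rep2 f g) (@rep2_step C x y f g) r r' -> rep_teq r r'.
Proof.
elim=> {r r'} [r r' h|[p q hp hq D]|r r' _|r r' r'' _ IH _].
- case: h => [p p' q q' hp hp' hq hq' D D' S T h|z e p q p' q' D D' hp hq hp' hq' he] /=.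
    apply/ceq_tail_eq; apply: ceq_trans (diag_eq_ceq h).
    apply: ceq_sym; apply: (ceq_trans (ceq_vcat_idl _ _)).
    exact: ceq_vcat_idr.
  exact: tail_eq_insert.
- exact: tail_eq_refl.
- case: r => ? ? ? ? D; case: r' => ? ? ? ? D'; exact: tail_eq_sym.
- case: r IH => ? ? ? ? D; case: r' => ? ? ? ? D'; case: r'' => ? ? ? ? D''.
  exact: tail_eq_trans.
Qed.

(** The generators of the relation on representatives preserve [tail_eq];
conversely the tail is inserted by one of them. *)
Lemma class2P {C : partial_2category} {x y : ob C} {f g : hom1 x y}
    {p q p' q' : seq1 C x y} {hp : cls1 p = f} {hq : cls1 q = g}
    {hp' : cls1 p' = f} {hq' : cls1 q' = g} {D : diag p q} {D' : diag p' q'} :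
  class2 hp hq D = class2 hp' hq' D' <-> tail_eq D D'.
Proof.
split=> [/(proj1 (clsP _ _ (clos_rst_is_equiv _ _))) /rep2_teq //|h].
apply/(proj2 (clsP _ _ (clos_rst_is_equiv _ _))).
exact: tail_eq_rep.
Qed.

(** A representative with tails lies between regular sequences, and these are
joined to [p] and [q]. *)
Lemma rep_at {C : partial_2category} {x y : ob C} {f g : hom1 x y}
    (c : hom2 f g) {p q : seq1 C x y} (hp : cls1 p = f) (hq : cls1 q = g) :
  regular p -> regular q -> exists D : diag p q, c = class2 hp hq D.
Proof.
move=> rp rq; have [[p0 q0 hp0 hq0 D0] ->] := quot_rep c.
have [t ht] := tail_ex y.
have rp0 := tail_regular p0 ht; have rq0 := tail_regular q0 ht.
have [S] : inhabited (idseq p (p0 ## t)).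
  by apply: regular_idseq => //; rewrite cls1_tail // hp hp0.
have [T] : inhabited (idseq (q0 ## t) q).
  by apply: regular_idseq => //; rewrite cls1_tail // hq hq0.
exists (vcat (iddiag S) (vcat (whiskerr D0 t) (iddiag T))).
apply/class2P/(tail_eq_intro ht)/ceq_sym.
apply: (ceq_trans (ceq_sym (regular_ceq _ rp rq ht))).
apply: (ceq_trans (ceq_vcat_idl _ _)).
exact: ceq_vcat_idr.
Qed.

Lemma transport_class2 {C : partial_2precategory} {x y : ob C}
    {f g f' g' : hom1 x y} (ef : f = f') (eg : g = g')
    {p q : seq1 C x y} (hp : cls1 p = f) (hq : cls1 q = g) (D : diag p q) :
  transport ef eg (class2 hp hq D) = class2 (etrans hp ef) (etrans hq eg) D.
Proof. by case: f' / ef; case: g' / eg. Qed.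

(** * The completion *)

Lemma regular_rep {C : partial_2precategory} {x y : ob C} (f : hom1 x y) :
  exists p : seq1 C x y, regular p /\ cls1 p = f.
Proof.
have [p ->] := quot_rep f; have [t ht] := tail_ex y.
by exists (p ## t); split; [apply: tail_regular|apply: cls1_tail].
Qed.

Definition rseq {C : partial_2precategory} {x y : ob C} (f : hom1 x y) :
    seq1 C x y :=
  proj1_sig (constructive_indefinite_description _ (regular_rep f)).

Lemma rseq_regular {C : partial_2precategory} {x y : ob C} (f : hom1 x y) :
  regular (rseq f).
Proof. by rewrite /rseq; case: constructive_indefinite_description => p []. Qed.

Lemma rseq_cls {C : partial_2precategory} {x y : ob C} (f : hom1 x y) :
  cls1 (rseq f) = f.
Proof. by rewrite /rseq; case: constructive_indefinite_description => p []. Qed.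

Definition rdiag {C : partial_2category} {x y : ob C} {f g : hom1 x y}
    (c : hom2 f g) : diag (rseq f) (rseq g) :=
  proj1_sig (constructive_indefinite_description _
    (rep_at c (rseq_cls f) (rseq_cls g) (rseq_regular f) (rseq_regular g))).

Lemma rdiagE {C : partial_2category} {x y : ob C} {f g : hom1 x y}
    (c : hom2 f g) : class2 (rseq_cls f) (rseq_cls g) (rdiag c) = c.
Proof. by rewrite /rdiag; case: constructive_indefinite_description. Qed.

Lemma rdiag_class2 {C : partial_2category} {x y : ob C} {f g : hom1 x y}
    {p q : seq1 C x y} (hp : cls1 p = f) (hq : cls1 q = g) (D : diag p q) :
  tail_eq (rdiag (class2 hp hq D)) D.
Proof. exact: (proj1 class2P (rdiagE (class2 hp hq D))). Qed.

Definition completion (C : partial_2category) : two_category_data (@hom2 C) :=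
  {| id1 := fun x => cls1 (pnil x);
     hcomp1 := fun x y z f g => cls1 (rseq f ## rseq g);
     id2 := fun x y f => class2 (rseq_cls f) (rseq_cls f) (dempty (rseq f));
     vcomp2 := fun x y f g h c d =>
       class2 (rseq_cls f) (rseq_cls h) (vcat (rdiag c) (rdiag d));
     hcomp2 := fun x y z f g f' g' c d => cls2 (hcat (rdiag c) (rdiag d)) |}.

Lemma completion_spec (C : partial_2category) : is_completion (completion C).
Proof.
have hc x y z (p : seq1 C x y) (q : seq1 C y z) :
    hcomp1 (completion C) (cls1 p) (cls1 q) = cls1 (p ## q).
  by apply: cls1_app; rewrite rseq_cls.
apply: (@IsCompletion _ _ _ hc) => //.
- move=> x y p /=; apply/class2P/tail_eq_dempty; exact: rseq_cls.
- move=> x y p q r D E /=; apply/class2P/tail_eq_vcat; exact: rdiag_class2.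
- move=> x y z p q p' q' D E /=; rewrite transport_class2.
  apply/class2P/tail_eq_hcat; exact: rdiag_class2.
Qed.

Lemma tail_eq_rdiag_hcomp {C : partial_2category} {x y z : ob C}
    {f g : hom1 x y} {f' g' : hom1 y z} (c : hom2 f g) (d : hom2 f' g') :
  tail_eq (rdiag (hcomp2 (completion C) c d)) (hcat (rdiag c) (rdiag d)).
Proof. exact: rdiag_class2. Qed.

Lemma hcat_vcat {C : partial_2precategory} {x y z : ob C}
    {p q r : seq1 C x y} {p' q' r' : seq1 C y z} (D : diag p q) (E : diag q r)
    (D' : diag p' q') (E' : diag q' r') :
  diag_eq (hcat (vcat D E) (vcat D' E')) (vcat (hcat D D') (hcat E E')).
Proof.
rewrite /hcat whiskerr_vcat whiskerl_vcat !vcat_assoc.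
apply: diag_eq_vcat => //; rewrite -!vcat_assoc; apply: diag_eq_vcat => //.
exact: diag_interchange.
Qed.

Lemma hcat_assoc {C : partial_2category} {x y z t : ob C}
    {p p1 : seq1 C x y} {q q1 : seq1 C y z} {r r1 : seq1 C z t}
    (D : diag p p1) (E : diag q q1) (F : diag r r1) :
  ceq (hcat (hcat D E) F) (hcat D (hcat E F)).
Proof.
rewrite /hcat whiskerr_vcat whiskerl_vcat !vcat_assoc.
apply: ceq_vcat; first exact: ceq_wrr.
apply: ceq_vcat; first exact: ceq_sym (ceq_wlr _ _ _).
exact: ceq_sym (ceq_wll _ _ _).
Qed.

Lemma completion_strict (C : partial_2category) :
  is_strict_2category (completion C).
Proof.
have ha x y z t (f : hom1 x y) (g : hom1 y z) (h : hom1 z t) :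
    hcomp1 (completion C) (hcomp1 (completion C) f g) h =
    hcomp1 (completion C) f (hcomp1 (completion C) g h).
  rewrite /= (cls1_app (rseq_cls _) erefl) papp_assoc.
  by apply: cls1_app => //; rewrite rseq_cls.
have hl x y (f : hom1 x y) : hcomp1 (completion C) (id1 (completion C) x) f = f.
  by rewrite /= (cls1_app (rseq_cls _) erefl) /= rseq_cls.
have hr x y (f : hom1 x y) : hcomp1 (completion C) f (id1 (completion C) y) = f.
  by rewrite /= (cls1_app erefl (rseq_cls _)) papp_nil rseq_cls.
apply: (@IsStrict2Category _ _ _ _ ha hl hr).
- move=> x y f g h k A B D /=; apply/class2P.
  apply: (tail_eq_trans (tail_eq_vcat (rdiag_class2 _ _ _) (tail_eq_refl _))).
  rewrite vcat_assoc; apply: tail_eq_vcat; first exact: tail_eq_refl.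
  exact: tail_eq_sym (rdiag_class2 _ _ _).
- move=> x y f g A /=; rewrite -[RHS]rdiagE; apply/class2P.
  exact: tail_eq_vcat (rdiag_class2 _ _ _) (tail_eq_refl (rdiag A)).
- move=> x y f g A /=; rewrite -[RHS]rdiagE; apply/class2P.
  apply: (tail_eq_trans (tail_eq_vcat (tail_eq_refl (rdiag A)) (rdiag_class2 _ _ _))).
  rewrite vcat_dempty; exact: tail_eq_refl.
- move=> x y z f g /=; apply/class2P.
  apply: (tail_eq_trans (tail_eq_hcat (rdiag_class2 _ _ _) (rdiag_class2 _ _ _))).
  by apply: tail_eq_dempty; rewrite rseq_cls.
- move=> x y z f g h f' g' h' A B A' B' /=; apply/class2P.
  apply: (tail_eq_trans (tail_eq_hcat (rdiag_class2 _ _ _) (rdiag_class2 _ _ _))).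
  apply: (tail_eq_trans (diag_eq_tail_eq (hcat_vcat _ _ _ _))).
  by apply: tail_eq_sym; apply: tail_eq_vcat; apply: tail_eq_rdiag_hcomp.
- move=> x y z t f f' g g' h h' A B D /=; rewrite transport_class2; apply/class2P.
  apply: (tail_eq_trans (tail_eq_hcat (tail_eq_rdiag_hcomp _ _) (tail_eq_refl _))).
  apply: (tail_eq_trans (ceq_tail_eq (hcat_assoc _ _ _))).
  by apply: tail_eq_sym; apply: tail_eq_hcat; [apply: tail_eq_refl|apply: tail_eq_rdiag_hcomp].
- move=> x y f g A; rewrite -[RHS]rdiagE /= transport_class2; apply/class2P.
  apply: (tail_eq_trans (tail_eq_hcat (rdiag_class2 _ _ _) (tail_eq_refl _))).
  apply: (tail_eq_trans (tail_eq_hcat (tail_eq_dempty (rseq_cls _)) (tail_eq_refl _))).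
  exact: ceq_tail_eq (ceq_wl0 _).
- move=> x y f g A; rewrite -[RHS]rdiagE /= transport_class2; apply/class2P.
  apply: (tail_eq_trans (tail_eq_hcat (tail_eq_refl _) (rdiag_class2 _ _ _))).
  apply: (tail_eq_trans (tail_eq_hcat (tail_eq_refl _) (tail_eq_dempty (rseq_cls _)))).
  rewrite /hcat vcat_dempty.
  exact: ceq_tail_eq (ceq_wr0 _).
Qed.

Definition quot_pick {T : Type} {R : T -> T -> Prop} (c : quot R) : T :=
  proj1_sig (constructive_indefinite_description _ (quot_rep c)).

Lemma quot_pickK {T : Type} {R : T -> T -> Prop} (c : quot R) : cls R (quot_pick c) = c.
Proof. by rewrite /quot_pick; case: constructive_indefinite_description. Qed.

Lemma quot_pick_seq {C : partial_2precategory} {x y : ob C} {p q : seq1 C x y}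
    (D : diag p q) : diag_eq (quot_pick (cls2_seq D)) D.
Proof. by apply/cls2_seqP; apply: quot_pickK. Qed.

Lemma hom2_seq_idseq {C : partial_2category} {x y : ob C}
    {p p' q q' : seq1 C x y} (S : idseq p' p) (T : idseq q q') :
  exists f : hom2_seq p q -> hom2_seq p' q',
    bijective f /\
    forall (S : idseq p' p) (T : idseq q q') (D : diag p q),
      f (cls2_seq D) = cls2_seq (vcat (iddiag S) (vcat D (iddiag T))).
Proof.
pose mv (a a' b b' : seq1 C x y) (S : idseq a' a) (T : idseq b b')
    (c : hom2_seq a b) : hom2_seq a' b' :=
  cls2_seq (vcat (iddiag S) (vcat (quot_pick c) (iddiag T))).
have mvE a a' b b' (U U' : idseq a' a) (V V' : idseq b b') (D : diag a b) :
    mv _ _ _ _ U V (cls2_seq D) = cls2_seq (vcat (iddiag U') (vcat D (iddiag V'))).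
  apply/cls2_seqP; apply: diag_eq_vcat; first exact: thin.
  apply: diag_eq_vcat; [exact: quot_pick_seq|exact: thin].
have mvK a a' b b' (U : idseq a' a) (U' : idseq a a') (V : idseq b b')
    (V' : idseq b' b) (c : hom2_seq a b) :
    mv _ _ _ _ U' V' (mv _ _ _ _ U V c) = c.
  rewrite -[c]quot_pickK (mvE _ _ _ _ U U V V) (mvE _ _ _ _ U' U' V' V').
  apply/cls2_seqP/ceq_diag_eq.
  apply: (ceq_trans (ceq_vcat_idl _ _)); apply: (ceq_trans (ceq_vcat_idr _ _)).
  apply: (ceq_trans (ceq_vcat_idl _ _)); exact: ceq_vcat_idr.
exists (mv _ _ _ _ S T); split; last by move=> U V D; apply: mvE.
by exists (mv _ _ _ _ (idinv S) (idinv T)) => c; apply: mvK.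
Qed.

Lemma hom2_seq_hom2 {C : partial_2category} {x y : ob C} {p q : seq1 C x y} :
  regular p -> regular q ->
  exists f : hom2_seq p q -> hom2 (cls1 p) (cls1 q),
    bijective f /\ forall D : diag p q, f (cls2_seq D) = cls2 D.
Proof.
move=> rp rq.
pose f (c : hom2_seq p q) : hom2 (cls1 p) (cls1 q) := cls2 (quot_pick c).
have fE (D : diag p q) : f (cls2_seq D) = cls2 D.
  by apply/class2P/diag_eq_tail_eq; apply: quot_pick_seq.
exists f; split=> //.
pose rep (c : hom2 (cls1 p) (cls1 q)) := constructive_indefinite_description _
  (rep_at c (erefl (cls1 p)) (erefl (cls1 q)) rp rq).
exists (fun c => cls2_seq (proj1_sig (rep c))) => c.
- rewrite -[RHS]quot_pickK; apply/cls2_seqP/ceq_diag_eq/tail_eq_ceq => //.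
  apply/(@class2P _ _ _ _ _ _ _ _ _ erefl erefl erefl erefl).
  exact: esym (proj2_sig (rep (f c))).
- by rewrite fE [RHS](proj2_sig (rep c)).
Qed.

Theorem mainTheorem1 (C : partial_2category) :
  (exists K : two_category_data (@hom2 C),
     is_completion K /\ is_strict_2category K)
  /\
  (forall (x y : ob C) (p p' q q' : seq1 C x y),
     idseq p' p -> idseq q q' ->
     exists f : hom2_seq p q -> hom2_seq p' q',
       bijective f /\
       forall (S : idseq p' p) (T : idseq q q') (D : diag p q),
         f (cls2_seq D) = cls2_seq (vcat (iddiag S) (vcat D (iddiag T))))
  /\
  (forall (x y : ob C) (p p' : seq1 C x y),
     regular p -> regular p' -> cls1 p = cls1 p' -> inhabited (idseq p p'))
  /\
  (forall (x y : ob C) (p q : seq1 C x y),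
     regular p -> regular q ->
     exists f : hom2_seq p q -> hom2 (cls1 p) (cls1 q),
       bijective f /\
       forall D : diag p q, f (cls2_seq D) = cls2 D).
Proof.
split; first by exists (completion C); split;
  [apply: completion_spec|apply: completion_strict].
split; first by move=> x y p p' q q'; apply: hom2_seq_idseq.
split; first by move=> x y p p'; apply: regular_idseq.
by move=> x y p q; apply: hom2_seq_hom2.
Qed.
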